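(* Let $\alpha\ge0$, let $\rho_+=\rho_-=:\hat\rho>0$ be a constant, and let $\mathfrak p\in C([0,\infty))\cap C^1(0,\infty)$ with $\mathfrak p'>0$ in $(0,\infty)$. Let $(\rho_0,n_0)\in L^1_{\mathrm{loc}}(\mathbb R)^2$ with $\rho_0\ge0$ and $\mathcal E(0;\rho_0,n_0\,|\,\hat\rho,0)<\infty$. Let $(\rho,n)$ be a weak solution of the scaled damped Euler system with initial data $(\rho_0,n_0)$ satisfying at least one of the following two entropy conditions. Either (local entropy inequality) $\rho,\frac n\rho\in L^\infty_{\mathrm{loc}}([0,\infty);L^\infty(\mathbb R))$, $h(\rho)\in L^1_{\mathrm{loc}}([0,\infty)\times\mathbb R)$, and for all $0\le\chi\in C_c^\infty([0,\infty)\times\mathbb R)$ $$\int_0^\infty\!\!\int_{\mathbb R}-\chi_\tau\eta(\tau;\rho,n)+\chi_y\big(\tfrac y2\eta(\tau;\rho,n)-q(\tau;\rho,n)\big)+\chi\big(\tfrac12\eta(\tau;\rho,n)+\alpha\tfrac{n^2}\rho\big)dy\,d\tau\le\int_{\mathbb R}\chi(0,y)\eta(0;\rho_0,n_0)\,dy;$$ or (total relative entropy inequality) there is $\rho_\infty\in C^1(\mathbb R)$ such that for some $R>0$, $\rho_\infty(y)=\rho_+$ for $y>R$ and $\rho_\infty(y)=\rho_-$ for $y<-R$, and such that for all $0\le\varphi\in C_c^\infty([0,\infty))$ $$\int_0^\infty-\varphi_\tau\mathcal E(\tau;\rho,n|\rho_\infty,0)+\varphi\Big(\tfrac12\mathcal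 E(\tau;\rho,n|\rho_\infty,0)+\int_{\mathbb R}\alpha\tfrac{n^2}\rho dy\Big)d\tau\le\varphi(0)\mathcal E(0;\rho_0,n_0|\rho_\infty,0)+\int_0^\infty\varphi\int_{\mathbb R}h'(\rho_\infty)_y\big(\tfrac y2(\rho-\rho_\infty)-n\big)dy\,d\tau.$$ Then $$\mathcal E(\tau;\rho(\tau),n(\tau)\,|\,\hat\rho,0)\le e^{-\tau/2}\,\mathcal E(0;\rho_0,n_0\,|\,\hat\rho,0)\quad\text{for a.a. }\tau>0$$ and $$\alpha\int_\tau^\infty\!\!\int_{\mathbb R}\frac{|n|^2}\rho\,dy\,d\tau'\le e^{-\tau/2}\,\mathcal E(0;\rho_0,n_0\,|\,\hat\rho,0)\quad\text{for a.a. }\tau>0.$$ If $\mathfrak p$ additionally satisfies $$\exists\,c>0:\ \mathfrak p'(z)\le c\,\frac{\mathfrak p(z)}z\ \ (z>0)\qquad\text{and}\qquad\int_0^1\frac{\mathfrak p(z)}{z^2}\,dz<\infty,$$ then the same statement also holds for $\rho_+=\rho_-=\hat\rho=0$.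
   Context: Potential: $h\in C([0,\infty))\cap C^2(0,\infty)$ denotes an internal energy potential of $\mathfrak p$, i.e. $\mathfrak p(z)=zh'(z)-h(z)$, hence $h''(z)=\mathfrak p'(z)/z$, for $z>0$ (unique up to a linear term, which does not affect relative quantities; under the additional pressure condition in the claim $h$ is $C^1$ up to $0$). Relative potential: $h(\rho|\bar\rho)=h(\rho)-h(\bar\rho)-h'(\bar\rho)(\rho-\bar\rho)$. Convention: $\frac00:=0$ (so $n/\rho:=0$ where $\rho=n=0$). Scaled damped Euler system on $(0,\infty)\times\mathbb R$ (time $\tau$, space $y$): $$\rho_\tau=\tfrac y2\rho_y-n_y,\qquad n_\tau=\tfrac y2 n_y+\tfrac12 n-\Big(\frac{n^2}\rho\Big)_y-e^\tau\big(\mathfrak p(\rho)_y+\alpha n\big).$$ Weak solution with initial data $(\rho_0,n_0)\in L^1_{\mathrm{loc}}(\mathbb R)^2$, $\rho_0\ge0$: a pair $(\rho,n)\in L^1_{\mathrm{loc}}([0,\infty)\times\mathbb R)^2$ with $\frac{n^2}\rho,\mathfrak p(\rho)\in L^1_{\mathrm{loc}}([0,\infty)\times\mathbb R)$, $\rho\ge0$ a.e., such that for all $\phi,\psi\in C_c^\infty([0,\infty)\times\mathbb R)$ $$-\int_0^\infty\!\!\int_{\mathbb R}\phi_\tau\rho+\phi_y\big(-\tfrac y2\rho+n\big)-\tfrac12\phi\rho\,dy\,d\tau=\int_{\mathbb R}\phi(0,y)\rho_0\,dy,$$ $$-\int_0^\infty\!\!\int_{\mathbb R}\psi_\tau n+\psi_y\Big(-\tfrac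 y2 n+\frac{n^2}\rho+e^\tau \mathfrak p(\rho)\Big)-\psi e^\tau\alpha n\,dy\,d\tau=\int_{\mathbb R}\psi(0,y)n_0\,dy.$$ Entropy, flux, relative entropy: $$\eta(\tau;\rho,n)=e^{-\tau}\frac{n^2}{2\rho}+h(\rho),\quad q(\tau;\rho,n)=e^{-\tau}\frac{n^3}{2\rho^2}+nh'(\rho),\quad \eta(\tau;\rho,n|\bar\rho,\bar n)=\tfrac12e^{-\tau}\rho\Big|\frac n\rho-\frac{\bar n}{\bar\rho}\Big|^2+h(\rho|\bar\rho),$$ $$\mathcal E(\tau;\rho,n\,|\,\bar\rho,\bar n)=\int_{\mathbb R}\eta(\tau;\rho(y),n(y)|\bar\rho(y),\bar n(y))\,dy$$ (finiteness of $\mathcal E$ implicitly includes $\rho,\bar\rho\ge0$ a.e.). *)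

(* Defs.v *)
From HB Require Import structures.
From mathcomp Require Import all_boot all_order all_algebra.
From mathcomp Require Import all_classical all_reals all_analysis.
From mathcomp Require Import measurable_realfun.
Set Implicit Arguments.
Unset Strict Implicit.
Unset Printing Implicit Defensive.
Import Order.TTheory GRing.Theory Num.Theory.
Import numFieldNormedType.Exports.
Local Open Scope classical_set_scope.
Local Open Scope ring_scope.

Notation lebR R := (@lebesgue_measure R).
Notation lebR2 R := (@lebesgue_measure R \x @lebesgue_measure R)%E.

(* On the finite-dimensional spaces R and R * R used below, this is the usual
   class C^k. *)
Fixpoint is_Ck (R : realType) (V : normedModType R) (k : nat) (f : V -> R) :
    Prop :=
  match k with
  | 0 => continuous f
  | k'.+1 => (forall x, differentiable f x) /\ forall v, is_Ck k' ('D_v f)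
  end.

(* C_c^oo of a closed half-line or half-plane consists of the restrictions of
   these functions; the conditions below never look at negative times. *)
Definition test_function (R : realType) (V : normedModType R) (f : V -> R) :=
  (forall k, is_Ck k f) /\ compact (closure [set x | f x != 0]).

(* Space-time points are pairs (time, space). *)
Definition dtime (R : realType) (f : R * R -> R) : R * R -> R := 'D_(1, 0) f.
Definition dspace (R : realType) (f : R * R -> R) : R * R -> R := 'D_(0, 1) f.

Definition half_plane (R : realType) : set (R * R) := [set x | 0 <= x.1].
Arguments half_plane R : clear implicits.

Definition L1loc_half_plane (R : realType) (f : R * R -> \bar R) :=
  measurable_fun (half_plane R) f /\
  forall K : set (R * R), K `<=` half_plane R -> compact K ->
    (\int[lebR2 R]_(x in K) `|f x| < +oo)%E.

Definition L1loc (R : realType) (D : set R) (f : R -> \bar R) :=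
  measurable_fun D f /\
  forall K : set R, K `<=` D -> compact K ->
    (\int[lebR R]_(y in K) `|f y| < +oo)%E.

Definition weak_derivative (R : realType) (W : R -> \bar R) (w : R -> R) :=
  [/\ L1loc setT W, L1loc setT (EFin \o w) &
    forall theta : R -> R, test_function theta ->
      (\int[lebR R]_y (W y * (derive1 theta y)%:E) =
       - (\int[lebR R]_y (w y * theta y)%:E))%E].

Definition pressure_law (R : realType) (p : R -> R) :=
  [/\ {within `[0, +oo[, continuous p},
      forall z, 0 < z -> derivable p z 1,
      forall z, 0 < z -> {for z, continuous (derive1 p)} &
      forall z, 0 < z -> 0 < derive1 p z].

Definition internal_potential (R : realType) (p h : R -> R) :=
  [/\ {within `[0, +oo[, continuous h},
      forall z, 0 < z -> derivable h z 1 /\ derivable (derive1 h) z 1,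
      forall z, 0 < z -> {for z, continuous (derive1 (derive1 h))} &
      forall z, 0 < z -> p z = z * derive1 h z - h z].

Definition vacuum_condition (R : realType) (p : R -> R) :=
  (exists2 c : R, 0 < c & forall z, 0 < z -> derive1 p z <= c * (p z / z)) /\
  (\int[lebR R]_(z in `]0%R, 1%R[) (p z / z ^+ 2)%:E < +oo)%E.

Section entropies.
Variable R : realType.
Local Open Scope ereal_scope.

(* m^2 / r with 0/0 = 0; division in R would also give m^2 / 0 = 0 for
   m != 0, whereas that case has to be excluded by finiteness. *)
Definition sq_over (m r : R) : \bar R :=
  if r == 0%R then (if m == 0%R then 0 else +oo) else (m ^+ 2 / r)%:E.

(* h is only given on [0, +oo); finite energy forces r >= 0. *)
Definition potential (h : R -> R) (r : R) : \bar R :=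
  if (0 <= r)%R then (h r)%:E else +oo.

(* h' on [0, +oo); h'(0) may be -oo, in which case 0 * h'(0) = 0. *)
Definition dpotential (h : R -> R) (r : R) : \bar R :=
  if (0 < r)%R then (derive1 h r)%:E else lim ((derive1 h z)%:E @[z --> 0%R^'+]).

Definition rel_potential (h : R -> R) (r rb : R) : \bar R :=
  if (0 <= r)%R && (0 <= rb)%R
  then (h r)%:E - (h rb)%:E - dpotential h rb * (r - rb)%:E else +oo.

Definition entropy (h : R -> R) (t r m : R) : \bar R :=
  (expR (- t) / 2)%:E * sq_over m r + potential h r.

Definition entropy_flux (h : R -> R) (t r m : R) : \bar R :=
  (expR (- t) * (m ^+ 3 / (2 * r ^+ 2)))%:E + m%:E * dpotential h r.

(* r |m/r - mb/rb|^2, infinite if one of the velocities is. *)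
Definition rel_kinetic (r m rb mb : R) : \bar R :=
  if ((r == 0) && (m != 0) || (rb == 0) && (mb != 0))%R then +oo
  else (r * `|m / r - mb / rb| ^+ 2)%:E.

Definition rel_entropy (h : R -> R) (t r m rb mb : R) : \bar R :=
  (expR (- t) / 2)%:E * rel_kinetic r m rb mb + rel_potential h r rb.

Definition rel_energy (h : R -> R) (t : R) (rho n rhob nb : R -> R) : \bar R :=
  \int[lebR R]_y rel_entropy h t (rho y) (n y) (rhob y) (nb y).

Definition dissipation (alpha : R) (rho n : R -> R) : \bar R :=
  \int[lebR R]_y (alpha%:E * sq_over (n y) (rho y)).

End entropies.

Definition weak_solution (R : realType) (alpha : R) (p : R -> R)
    (rho0 n0 : R -> R) (rho n : R * R -> R) :=
  [/\ [/\ L1loc_half_plane (EFin \o rho),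
          L1loc_half_plane (EFin \o n),
          L1loc_half_plane (fun x => sq_over (n x) (rho x)) &
          L1loc_half_plane (fun x => (p (rho x))%:E)],
      {ae lebR2 R, forall x, half_plane R x -> 0 <= rho x},
      forall phi : R * R -> R, test_function phi ->
        (- (\int[lebR2 R]_(x in half_plane R)
             (dtime phi x * rho x
              + dspace phi x * (- (x.2 / 2) * rho x + n x)
              - 2^-1 * phi x * rho x)%R%:E)
         = \int[lebR R]_y (phi (0%R, y) * rho0 y)%R%:E)%E &
      forall psi : R * R -> R, test_function psi ->
        (- (\int[lebR2 R]_(x in half_plane R)
             (dtime psi x * n x
              + dspace psi x * (- (x.2 / 2) * n x + n x ^+ 2 / rho x
                                + expR x.1 * p (rho x))
              - psi x * expR x.1 * alpha * n x)%R%:E)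
         = \int[lebR R]_y (psi (0%R, y) * n0 y)%R%:E)%E].

(* The space L^oo_loc([0,oo); L^oo(R)). *)
Definition Linfty_loc_time (R : realType) (f : R * R -> R) :=
  forall T : R, exists M : R,
    {ae lebR2 R, forall x, 0 <= x.1 <= T -> `|f x| <= M}.

Definition local_entropy_inequality (R : realType) (alpha : R) (h : R -> R)
    (rho0 n0 : R -> R) (rho n : R * R -> R) :=
  [/\ Linfty_loc_time rho,
      Linfty_loc_time (fun x => n x / rho x),
      L1loc_half_plane (fun x => potential h (rho x)) &
      forall chi : R * R -> R, test_function chi ->
        (forall x, half_plane R x -> 0 <= chi x) ->
        let eta x := entropy h x.1 (rho x) (n x) in
        let q x := entropy_flux h x.1 (rho x) (n x) in
        (\int[lebR2 R]_(x in half_plane R)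
           ((- dtime chi x)%:E * eta x
            + (dspace chi x)%:E * ((x.2 / 2)%:E * eta x - q x)
            + (chi x)%:E * (2^-1%:E * eta x
                            + alpha%:E * sq_over (n x) (rho x)))
         <= \int[lebR R]_y ((chi (0%R, y))%:E * entropy h 0 (rho0 y) (n0 y)))%E].

(* The function w is h'(rhoi)_y, taken in the weak sense because h'(rhoi) need
   not be C^1 where rhoi vanishes.  The two L1loc conditions say that the
   integrals in the inequality are meaningful. *)
Definition total_rel_entropy_inequality (R : realType) (alpha : R)
    (h : R -> R) (rhom rhop : R) (rho0 n0 : R -> R) (rho n : R * R -> R) :=
  exists (rhoi w : R -> R),
    let E t := rel_energy h t (fun y => rho (t, y)) (fun y => n (t, y))
                 rhoi (cst 0%R) in
    let source x := w x.2 * (x.2 / 2 * (rho x - rhoi x.2) - n x) in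
    [/\ is_Ck 1 rhoi,
        exists2 r : R, 0 < r &
          forall y, (r < y -> rhoi y = rhop) /\ (y < - r -> rhoi y = rhom),
        weak_derivative (fun y => dpotential h (rhoi y)) w,
        L1loc `[0, +oo[ E /\ L1loc_half_plane (EFin \o source) &
        forall phi : R -> R, test_function phi ->
          (forall t, 0 <= t -> 0 <= phi t) ->
          (\int[lebR R]_(t in `[0%R, +oo[)
             ((- derive1 phi t)%:E * E t
              + (phi t)%:E * (2^-1%:E * E t
                  + dissipation alpha (fun y => rho (t, y))
                                      (fun y => n (t, y))))
           <= (phi 0%R)%:E * rel_energy h 0 rho0 n0 rhoi (cst 0%R)
              + \int[lebR R]_(t in `[0%R, +oo[)
                  ((phi t)%:E * \int[lebR R]_y (source (t, y))%:E))%E].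

(* Main.v *)
Require Import Defs.
From HB Require Import structures.
From mathcomp Require Import all_boot all_order all_algebra.
From mathcomp Require Import all_classical all_reals all_analysis.
From mathcomp Require Import measurable_realfun.
From mathcomp Require Import ring lra.
Set Implicit Arguments.
Unset Strict Implicit.
Unset Printing Implicit Defensive.
Import Order.TTheory GRing.Theory Num.Theory.
Import numFieldNormedType.Exports.
Local Open Scope classical_set_scope.
Local Open Scope ring_scope.

(** Let [E(t)] be the relative energy with respect to the constant state
    [(rhohat, 0)], let [E0] be its initial value and [D(t)] the dissipation
    [alpha int n^2 / rho]. Both claims follow from the inequality
      [int exp(t/2) (- psi'(t) E(t) + psi(t) D(t)) dt <= psi(0) E0]
    for the nonnegative cutoffs in time [psi] that are nonincreasing for positive
    times. Indeed, when [psi] equals [1] up to [a] and decreases to [0] on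
    [[a, b]], this bounds the averages of [exp(t/2) E(t)] by [E0], and Lebesgue's
    differentiation theorem gives the decay of the energy ([energy_decay]); it
    also bounds [int exp(s/2) D(s) ds] by [E0], and the weight is at least
    [exp(t/2)] after time [t] ([dissipation_decay]). Under either entropy
    condition the inequality amounts to testing it with [exp(t/2) psi(t)]: the
    weight compensates the damping term [1/2 E] produced by the scaling.

    Under the local entropy inequality ([local_energy_inequality]) one has to
    localize in space. The relative entropy is the entropy minus an affine
    function of the density, [a rho + b] with [a = h'(rhohat)], so its balance is
    that of the entropy minus [a] times the mass equation and minus [b] times
    the mass equation of the constant state. The relative flux is [q - a n].
    Since the density and the velocity are bounded up to the end of the support
    of [psi], this flux is bounded by a constant times the relative entropy: its
    kinetic part is the kinetic energy times the velocity, and its internal part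
    [n (h'(rho) - a)] is controlled by [reference_slope]. For positive [rhohat]
    the latter is Young's inequality near [rhohat], where [(h' - a)^2] is bounded
    by the relative potential, together with the boundedness of [z h'(z)] at
    the vacuum; for [rhohat = 0] it is where the two conditions on the pressure
    enter. The cutoff in space follows the interval [|y| < k exp(-t/2) - L]. Its
    ends move inwards faster, by [L/2], than the transport [- y/2 d/dy] of the
    scaled system moves them, so for [L] large the boundary terms have a favourable
    sign ([cutoff_absorbs_flux]). Monotone convergence as [k] grows removes the
    cutoff.

    Under the total relative entropy inequality ([total_energy_inequality])
    the reference is a profile [rhoi] that differs from [rhohat] on a bounded set
    only. Put [g = h'(rhoi) - h'(rhohat)], a function of compact support. The
    two relative entropies differ by [rel(rhoi) + g (rho - rhoi)], with [rel] the
    relative potential at [rhohat]. Thus the change of reference contributes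
    the evolution of [int g rho], which the mass equation tested with
    [exp(t/2) psi(t) g(y)] expresses through the source term of the hypothesis,
    and a constant in time, which [profile_moment] evaluates by integrating the
    pressure of the profile by parts. All these contributions cancel.

    The difficulty is the regularity of [g] where [rhoi] vanishes, as [h'] may be
    singular at the vacuum. There [h'] is replaced by truncations of class C^1
    ([trunc]). They show first that the weak derivative of [h'(rhoi)] is its
    classical derivative where [rhoi > 0] and zero elsewhere ([weak_slopeE]), and
    then that [h'(rhoi)] has finite total variation; in particular [h'] is
    finite at the vacuum if [rhoi] reaches it ([profile_fin]). The mass equation
    holds for the truncated factors by mollification, and passes to the limit
    by dominated convergence: the products of their slopes with the drift
    [y/2 rho - n] are dominated because the source is integrable
    ([mass_profile]). *)

(** * Smooth functions *)

Section smooth.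
Context {R : realType}.

Section real_derivatives.
Implicit Types (f g : R -> R) (x a b : R).

Lemma der_add f g x a b : is_derive x 1 f a -> is_derive x 1 g b ->
  is_derive x 1 (fun y => f y + g y) (a + b).
Proof. exact: is_deriveD. Qed.

Lemma der_sub f g x a b : is_derive x 1 f a -> is_derive x 1 g b ->
  is_derive x 1 (fun y => f y - g y) (a - b).
Proof. exact: is_deriveB. Qed.

Lemma der_opp f x a : is_derive x 1 f a -> is_derive x 1 (fun y => - f y) (- a).
Proof. exact: is_deriveN. Qed.

Lemma der_mul f g x a b : is_derive x 1 f a -> is_derive x 1 g b ->
  is_derive x 1 (fun y => f y * g y) (f x * b + g x * a).
Proof. exact: is_deriveM. Qed.

Lemma der_cst c x : is_derive x 1 (fun _ : R => c : R) 0.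
Proof. exact: is_derive_cst. Qed.

Lemma der_id x : is_derive x 1 (fun y : R => y) 1.
Proof. exact: is_derive_id. Qed.

Lemma der_comp f g x a b : is_derive (g x) 1 f a -> is_derive x 1 g b ->
  is_derive x 1 (fun y => f (g y)) (a * b).
Proof. exact: is_derive1_comp. Qed.

Lemma der_inv x : x != 0 -> is_derive x 1 (fun y : R => y^-1) (- x ^- 2).
Proof.
move=> x0; apply: (@is_derive_eq _ _ _ _ _ _ _ (- x ^- 2 *: (1 : R))).
  exact: (@is_deriveV _ (fun y : R => y) x 1 1).
by rewrite /GRing.scale /= mulr1.
Qed.

Lemma der_derive1 f x a : is_derive x 1 f a -> derive1 f x = a.
Proof. by move=> d; rewrite derive1E (@derive_val _ _ _ _ _ _ _ d). Qed.

Lemma der_derivable f x a : is_derive x 1 f a -> derivable f x 1.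
Proof. by case. Qed.

Lemma der_continuous f x a : is_derive x 1 f a -> {for x, continuous f}.
Proof. by move=> [d _]; exact/differentiable_continuous/derivable1_diffP. Qed.

Lemma derivable_der f x : derivable f x 1 -> is_derive x 1 f (derive1 f x).
Proof. by move=> d; rewrite derive1E; exact: derivableP. Qed.

(** At the origin the flat functions below are only controlled through their
    size, which has to yield their derivative. *)
Lemma der0_sq f (C : R) : 0 <= C ->
  (forall x, `|x| <= 1 -> `|f x| <= C * x ^+ 2) -> is_derive (0 : R) 1 f 0.
Proof.
move=> C0 Cf.
have f0 : f 0 = 0.
  apply/normr0_eq0/le_anti; rewrite normr_ge0 andbT.
  by have := Cf 0; rewrite normr0 expr0n mulr0; apply.
have cv : h^-1 *: (f (h *: 1 + 0) - f 0) @[h --> 0^'] --> (0 : R).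
  apply/cvgr0Pnorm_le => e e0.
  near=> h.
  have h0 : h != 0 by near: h; exact: nbhs_dnbhs_neq.
  rewrite f0 subr0 addr0 /GRing.scale /= mulr1 normrM normfV.
  rewrite ler_pdivrMl ?normr_gt0 //.
  apply: le_trans (Cf _ _) _.
    by near: h; apply: dnbhs0_le; exact: ltr01.
  rewrite -normr_id -real_normK ?num_real // normr_id expr2 mulrA mulrC.
  rewrite ler_wpM2l //.
  have : `|h| <= e / (C + 1) by near: h; apply: dnbhs0_le; rewrite divr_gt0 // ltr_wpDl.
  rewrite ler_pdivlMr ?ltr_wpDl // => /(le_trans _); apply.
  by rewrite mulrC ler_wpM2l // lerDl.
apply: DeriveDef; first by apply/cvg_ex; exists 0.
exact/cvg_lim.
Unshelve. all: by end_near. Qed.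

End real_derivatives.

Definition smooth (V : normedModType R) (f : V -> R) := forall k, is_Ck k f.

Lemma is_CkW (V : normedModType R) k (f : V -> R) : is_Ck k.+1 f -> is_Ck k f.
Proof.
elim: k f => [|k IH] f [df Df] /=.
  by move=> x; exact: differentiable_continuous.
by split=> // v; apply: IH; exact: Df.
Qed.

Lemma is_Ck_cst (V : normedModType R) k (c : R) : is_Ck k (fun _ : V => c).
Proof.
elim: k c => [|k IH] c /=; first by move=> x; exact: cvg_cst.
split=> [x|v]; first exact: differentiable_cst.
rewrite (_ : 'D_v _ = fun=> 0); first exact: IH.
by apply/funext => x; rewrite derive_cst.
Qed.

Lemma is_CkD (V : normedModType R) k (f g : V -> R) :
  is_Ck k f -> is_Ck k g -> is_Ck k (fun x => f x + g x).
Proof.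
elim: k f g => [|k IH] f g /=.
  by move=> cf cg x; exact: cvgD (cf x) (cg x).
move=> [df Df] [dg Dg]; split=> [x|v]; first exact: differentiableD.
rewrite (_ : 'D_v _ = fun x => 'D_v f x + 'D_v g x); first exact: IH.
by apply/funext => x; rewrite deriveD //; exact: diff_derivable.
Qed.

Lemma is_CkM (V : normedModType R) k (f g : V -> R) :
  is_Ck k f -> is_Ck k g -> is_Ck k (fun x => f x * g x).
Proof.
elim: k f g => [|k IH] f g.
  by move=> /= cf cg x; exact: cvgM (cf x) (cg x).
move=> fk gk; have [df Df] := fk; have [dg Dg] := gk.
split=> [x|v]; first exact: differentiableM.
rewrite (_ : 'D_v _ = fun x => f x * 'D_v g x + g x * 'D_v f x).
  by apply: is_CkD; apply: IH; [exact: is_CkW|exact: Dg|exact: is_CkW|exact: Df].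
by apply/funext => x; rewrite deriveM //; exact: diff_derivable.
Qed.

Lemma derive_comp_diff (V : normedModType R) (f : V -> R) (g : R -> R) x v :
  differentiable f x -> differentiable g (f x) ->
  'D_v (fun y => g (f y)) x = 'D_1 g (f x) * 'D_v f x.
Proof.
move=> df dg; rewrite -[fun y => _]/(g \o f).
rewrite deriveE; last exact: differentiable_comp.
rewrite diff_comp //= deriveE // deriveE //.
rewrite -[in LHS](mulr1 ('d f x v)) -[_ * 1]/('d f x v *: (1:R)) linearZ /=.
by rewrite mulrC.
Qed.

Lemma is_Ck_comp (V : normedModType R) k (f : V -> R) (g : R -> R) :
  is_Ck k f -> is_Ck k g -> is_Ck k (fun x => g (f x)).
Proof.
elim: k f g => [|k IH] f g.
  by move=> /= cf cg x; apply: continuous_comp; [exact: cf | exact: cg].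
move=> fk gk; have [df Df] := fk; have [dg Dg] := gk.
split=> [x|v]; first exact: differentiable_comp.
rewrite (_ : 'D_v _ = fun x => 'D_1 g (f x) * 'D_v f x).
  apply: is_CkM; last exact: Df.
  by apply: (IH f ('D_1 g)); [exact: is_CkW|exact: Dg].
by apply/funext => x; exact: derive_comp_diff.
Qed.

Lemma is_Ck_linear (V : normedModType R) k (f : {linear V -> R}) :
  continuous f -> is_Ck k f.
Proof.
move=> cf; case: k => [//|k]; split=> [x|v].
  exact: linear_differentiable.
rewrite (_ : 'D_v _ = cst (f v)); first exact: is_Ck_cst.
apply/funext => x; rewrite deriveE; last exact: linear_differentiable.
by rewrite diff_lin.
Qed.

Lemma smooth_fst : smooth (fst : R * R -> R).
Proof. by move=> k; apply: (@is_Ck_linear _ k fst); by move=> x; exact: cvg_fst. Qed.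

Lemma smooth_snd : smooth (snd : R * R -> R).
Proof. by move=> k; apply: (@is_Ck_linear _ k snd); by move=> x; exact: cvg_snd. Qed.

Lemma smooth_id : smooth (idfun : R -> R).
Proof. by move=> k; apply: (@is_Ck_linear _ k idfun); move=> x; exact: cvg_id. Qed.

Lemma derive_derive1 (f : R -> R) v x : derivable f x 1 ->
  'D_v f x = v * derive1 f x.
Proof.
move=> df; have /derivable1_diffP dfx := df.
rewrite deriveE // derive1E' //.
by rewrite -[in LHS](mulr1 v) -[v * 1]/(v *: (1:R)) linearZ.
Qed.

Lemma is_Ck_derive1 k (f : R -> R) : (forall x, derivable f x 1) ->
  is_Ck k (derive1 f) -> is_Ck k.+1 f.
Proof.
move=> df Df; split=> [x|v]; first exact/derivable1_diffP.
rewrite (_ : 'D_v _ = fun x => v * derive1 f x).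
  by apply: is_CkM => //; exact: is_Ck_cst.
by apply/funext => x; exact: derive_derive1.
Qed.

Lemma is_Ck1 k (f : R -> R) : is_Ck k.+1 f ->
  (forall x, derivable f x 1) /\ is_Ck k (derive1 f).
Proof.
move=> [df Df]; split=> [x|]; first exact/derivable1_diffP.
rewrite (_ : derive1 f = 'D_1 f); first exact: Df.
by apply/funext => x; rewrite derive1E.
Qed.

Lemma smooth1P (f : R -> R) : smooth f <->
  (forall x, derivable f x 1) /\ smooth (derive1 f).
Proof.
split=> [sf|[df sf]].
  split; first by have [] := is_Ck1 (sf 1%N).
  by move=> k; have [] := is_Ck1 (sf k.+1).
case=> [|k]; last exact: is_Ck_derive1.
by move=> x; apply/differentiable_continuous/derivable1_diffP.
Qed.

Lemma smooth_expR : smooth (@expR R).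
Proof.
elim=> [|k IH]; first exact: continuous_expR.
apply: is_Ck_derive1 => [x|]; first exact: derivable_expR.
rewrite (_ : derive1 expR = expR); first exact: IH.
by apply/funext => x; rewrite derive1E (@derive_val _ _ _ _ _ _ _ (is_derive_expR x)).
Qed.

Lemma smoothD (V : normedModType R) (f g : V -> R) :
  smooth f -> smooth g -> smooth (fun x => f x + g x).
Proof. by move=> sf sg k; exact: is_CkD. Qed.

Lemma smoothM (V : normedModType R) (f g : V -> R) :
  smooth f -> smooth g -> smooth (fun x => f x * g x).
Proof. by move=> sf sg k; exact: is_CkM. Qed.

Lemma smooth_cst (V : normedModType R) (c : R) : smooth (fun _ : V => c).
Proof. by move=> k; exact: is_Ck_cst. Qed.

Lemma smooth_comp (V : normedModType R) (f : V -> R) (g : R -> R) :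
  smooth f -> smooth g -> smooth (fun x => g (f x)).
Proof. by move=> sf sg k; exact: is_Ck_comp. Qed.

Lemma smoothN (V : normedModType R) (f : V -> R) :
  smooth f -> smooth (fun x => - f x).
Proof.
move=> sf; rewrite (_ : (fun x => - f x) = fun x => -1 * f x).
  by apply: smoothM => //; exact: smooth_cst.
by apply/funext => x; rewrite mulN1r.
Qed.

Lemma smoothB (V : normedModType R) (f g : V -> R) :
  smooth f -> smooth g -> smooth (fun x => f x - g x).
Proof. by move=> sf sg; apply: smoothD => //; exact: smoothN. Qed.

Lemma smooth_derivable (f : R -> R) x : smooth f -> derivable f x 1.
Proof. by move=> /smooth1P[]. Qed.

Lemma smooth_derive1 (f : R -> R) : smooth f -> smooth (derive1 f).
Proof. by move=> /smooth1P[]. Qed.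

Lemma smooth_cont (V : normedModType R) (f : V -> R) : smooth f -> continuous f.
Proof. by move=> /(_ 0%N). Qed.

(** Functions [P(1/x) exp(-1/x)] rather than [exp(-1/x)] alone: the family is
    closed under differentiation, with [X^2 (P - P')] for [P]. *)
Definition flatp (P : {poly R}) (x : R) : R :=
  if 0 < x then P.[x^-1] * expR (- x^-1) else 0.

Lemma expR_lb n (u : R) : 0 <= u -> u ^+ n <= n`!%:R * expR u.
Proof.
move=> u0; rewrite -ler_pdivrMl ?ltr0n ?fact_gt0 //.
rewrite mulrC.
case: n => [|n]; first by rewrite expr0 fact0 divr1 -expR0 ler_expR.
by apply: le_trans (expR_ge1Dxn n u0); rewrite lerDr.
Qed.


Lemma horner_normr_le (P : {poly R}) : exists n (C : R), 0 <= C /\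
  forall u, 1 <= u -> `|P.[u]| <= C * u ^+ n.
Proof.
exists (size P), (\sum_(i < size P) `|P`_i|); split; first exact: sumr_ge0.
move=> u u1; rewrite horner_coef mulr_suml.
apply: le_trans (ler_norm_sum _ _ _) _; apply: ler_sum => i _.
rewrite normrM ler_wpM2l // ger0_norm ?exprn_ge0 //; last lra.
by rewrite ler_weXn2l // ltnW.
Qed.

(** Exponential decay beats the polynomial in [1/x], which makes [flatp P]
    vanish to second order at the origin. *)
Lemma flatp_lip (P : {poly R}) : exists C : R, 0 <= C /\
  forall x, `|x| <= 1 -> `|flatp P x| <= C * x ^+ 2.
Proof.
have [n [C [C0 CP]]] := horner_normr_le P.
exists (C * (n.+2)`!%:R); split; first by rewrite mulr_ge0.
move=> x x1; rewrite /flatp; case: ifPn => x0; last first.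
  by rewrite normr0 mulr_ge0 ?sqr_ge0 // mulr_ge0.
have xV : 1 <= x^-1 by rewrite invf_ge1 //; move: x1; rewrite gtr0_norm.
rewrite normrM (ger0_norm (expR_ge0 _)).
apply: le_trans (ler_wpM2r (expR_ge0 _) (CP _ xV)) _.
rewrite -!mulrA ler_wpM2l // expRN ler_pdivrMr ?expR_gt0 //.
have := expR_lb n.+2 (ltW (lt_le_trans ltr01 xV)).
rewrite -addn2 exprD => h.
have -> : x^-1 ^+ n = (x^-1 ^+ n * x^-1 ^+ 2) * x ^+ 2.
  by rewrite -mulrA -exprMn mulVf ?gt_eqF // expr1n mulr1.
by rewrite [leRHS]mulrAC ler_wpM2r // sqr_ge0.
Qed.

Lemma flatp_derive (P : {poly R}) (x : R) :
  is_derive x 1 (flatp P) (flatp ('X^2 * (P - P^`())) x).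
Proof.
have [x0|x0|x0] := ltgtP x 0.
- apply: (@is_derive_eq _ _ _ _ _ _ _ 0); last by rewrite /flatp ltNge (ltW x0).
  apply: (@near_eq_is_derive _ _ _ (cst 0)) => //.
  by near=> y; rewrite /flatp ifF // ltNge ltW //; near: y; exact: lt_nbhsl.
- apply: (@near_eq_is_derive _ _ _ (fun y : R => (P.[y^-1] * expR (- y^-1)) : R) (flatp P) x 1) => //.
    by near=> y; rewrite /flatp ifT //; near: y; exact: lt_nbhsr.
  have dV := @der_inv x (lt0r_neq0 x0).
  have d1 := @der_comp (horner P) (fun y : R => y^-1) _ _ _ (is_derive_poly P _) dV.
  have d2 := @der_comp expR (fun y : R => - y^-1) _ _ _ (is_derive_expR _) (der_opp dV).
  apply: is_derive_eq (der_mul d1 d2) _.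
  rewrite /flatp x0 !hornerE /=.
  by field; rewrite gt_eqF.
- subst x; have [C [C0 CP]] := flatp_lip P.
  apply: (@is_derive_eq _ _ _ _ _ _ _ 0); last by rewrite /flatp ltxx.
  exact: der0_sq CP.
Unshelve. all: by end_near. Qed.

Lemma smooth_flatp P : smooth (flatp P).
Proof.
move=> k; elim: k P => [|k IH] P.
  move=> x; exact: der_continuous (flatp_derive P x).
apply: is_Ck_derive1 => [x|]; first exact: der_derivable (flatp_derive P x).
rewrite (_ : derive1 _ = flatp ('X^2 * (P - P^`()))); first exact: IH.
by apply/funext => x; exact: der_derive1 (flatp_derive P x).
Qed.

(** [exp(-1/x)] extended by zero. *)
Definition ebump (x : R) : R := flatp 1 x.
Definition ebump' (x : R) : R := flatp 'X^2 x.

Lemma smooth_ebump : smooth ebump. Proof. exact: smooth_flatp. Qed.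

Lemma der_ebump (x : R) : is_derive x 1 ebump (ebump' x).
Proof.
have := flatp_derive 1 x.
by rewrite /ebump' -polyC1 derivC subr0 polyC1 mulr1.
Qed.

Lemma ebump'_ge0 x : 0 <= ebump' x.
Proof.
rewrite /ebump' /flatp; case: ifP => // x0.
by rewrite mulr_ge0 ?expR_ge0 // !hornerE sqr_ge0.
Qed.

Lemma ebump'_le0 x : x <= 0 -> ebump' x = 0.
Proof. by move=> x0; rewrite /ebump' /flatp ltNge x0. Qed.

Lemma ebump_le0 x : x <= 0 -> ebump x = 0.
Proof. by move=> x0; rewrite /ebump /flatp ltNge x0. Qed.

Lemma ebumpE x : 0 < x -> ebump x = expR (- x^-1).
Proof. by move=> x0; rewrite /ebump /flatp x0 hornerE mul1r. Qed.

Lemma ebump_gt0 x : 0 < x -> 0 < ebump x.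
Proof. by move=> /ebumpE ->; exact: expR_gt0. Qed.

Lemma ebump_ge0 x : 0 <= ebump x.
Proof. by case: (lerP x 0) => [/ebump_le0->//|/ebump_gt0/ltW]. Qed.

Lemma ebump_le1 x : ebump x <= 1.
Proof.
case: (lerP x 0) => [/ebump_le0->//|x0].
by rewrite ebumpE // expR_le1 oppr_le0 invr_ge0 ltW.
Qed.

Lemma ebump_homo x y : x <= y -> ebump x <= ebump y.
Proof.
move=> xy; case: (lerP x 0) => [/ebump_le0->|x0]; first exact: ebump_ge0.
have y0 := lt_le_trans x0 xy.
by rewrite !ebumpE // ler_expR lerN2 lef_pV2.
Qed.

Lemma ebump_cvg (u : nat -> R) : u @ \oo --> +oo -> ebump (u n) @[n --> \oo] --> (1 : R).
Proof.
move=> uoo; have -> : (1 : R) = expR (- 0) by rewrite oppr0 expR0.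
have : expR (- (u n)^-1) @[n --> \oo] --> expR (- 0).
  apply: continuous_cvg; first exact: continuous_expR.
  apply: cvgN; apply/gtr0_cvgV0; last exact: uoo.
  by have /cvgryPgt/(_ 0) := uoo; apply: filterS.
apply: cvg_trans; apply: near_eq_cvg; near=> n.
rewrite ebumpE //; near: n.
by have /cvgryPgt/(_ 0) := uoo.
Unshelve. all: by end_near. Qed.

End smooth.

(** * Test functions and cutoffs on the line *)

Section compact_support.
Context {R : realType}.
Local Notation mu := (@lebesgue_measure R).

Lemma test_function_supp (V : normedModType R) (f : V -> R) :
  test_function f -> exists2 M : R, 0 < M & forall x, M < `|x| -> f x = 0.
Proof.
move=> [_ /compact_bounded[M [Mr HM]]].
exists (`|M| + 1); first by rewrite ltr_wpDl.
move=> x xM; apply/eqP; apply: contraTT xM => fx.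
rewrite -leNgt; apply: (HM (`|M| + 1)).
  by rewrite (le_lt_trans (ler_norm _)) // ltrDl.
exact: subset_closure.
Qed.

Lemma test_function1 (f : R -> R) (M : R) : smooth f ->
  (forall x, M < `|x| -> f x = 0) -> test_function f.
Proof.
move=> sf fM; split=> //.
apply: (@subclosed_compact _ _ `[- M, M]); first exact: closed_closure.
  exact: segment_compact.
apply: (@subset_trans _ (closure `[- M, M])).
  apply: closure_subset => x /= fx; rewrite in_itv /= -ler_norml leNgt.
  by apply: contra fx => /fM ->.
by rewrite -(closure_id _).1 //; exact: interval_closed.
Qed.

Lemma test_function2 (f : R * R -> R) (M : R) : smooth f ->
  (forall x, M < `|x.1| \/ M < `|x.2| -> f x = 0) -> test_function f.
Proof.
move=> sf fM; split=> //.
have cK : compact (`[- M, M] `*` `[- M, M] : set (R * R)).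
  by apply: compact_setX; exact: segment_compact.
apply: (@subclosed_compact _ _ (`[- M, M] `*` `[- M, M])) => //.
  exact: closed_closure.
apply: (@subset_trans _ (closure (`[- M, M] `*` `[- M, M]))).
  apply: closure_subset => x /= fx; rewrite !in_itv /= -!ler_norml.
  split; rewrite leNgt; apply: contra fx => h; apply/eqP/fM; [by left|by right].
rewrite -(closure_id _).1 //; exact: compact_closed.
Qed.

Lemma test_function_smooth (V : normedModType R) (f : V -> R) :
  test_function f -> smooth f.
Proof. by case. Qed.

Lemma continuous_integrable_itv (f : R -> R) (a b : R) :
  continuous f -> mu.-integrable `[a, b] (EFin \o f).
Proof.
move=> cf; apply: continuous_compact_integrable; first exact: segment_compact.
exact: continuous_subspaceT.
Qed.

Lemma continuous_measurable (f : R -> R) (D : set R) :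
  continuous f -> measurable_fun D f.
Proof. by move=> cf; apply: measurable_funTS; exact: continuous_measurable_fun. Qed.

Lemma smooth_emeasurable (f : R -> R) (D : set R) :
  smooth f -> measurable_fun D (fun x => (f x)%:E).
Proof.
move=> sf; have cf : continuous f by exact: smooth_cont.
by apply/measurable_EFinP; exact: continuous_measurable.
Qed.

Lemma integrable_supp (f : R -> \bar R) (M : R) : (forall x, M < `|x| -> f x = 0%E) ->
  mu.-integrable `[- M, M] f -> mu.-integrable setT f.
Proof.
move=> fM /integrable_mkcond; rewrite (_ : f \_ _ = f); first by apply.
apply/funext => x; rewrite patchE; case: ifPn => //.
by rewrite notin_setE /= in_itv /= -ler_norml => /negP; rewrite -ltNge => /fM ->.
Qed.

Lemma Rintegral_supp (f : R -> R) (M : R) : (forall x, M < `|x| -> f x = 0) ->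
  \int[mu]_x f x = \int[mu]_(x in `[- M, M]) f x.
Proof.
move=> f0; rewrite [RHS]Rintegral_mkcond; apply: eq_Rintegral => x _.
rewrite patchE; case: ifPn => //.
by rewrite notin_setE /= in_itv /= -ler_norml => /negP; rewrite -ltNge => /f0.
Qed.

Lemma integrable_cts_supp (f : R -> R) (M : R) (D : set R) : measurable D ->
  continuous f ->
  (forall x, M < `|x| -> f x = 0) -> mu.-integrable D (EFin \o f).
Proof.
move=> mD cf fM; apply: (@integrableS _ _ _ _ setT) => //.
apply: (@integrable_supp _ M) => [x /fM /= ->//|].
exact: continuous_integrable_itv.
Qed.

End compact_support.

Section primitives.
Context {R : realType}.
Local Notation mu := (@lebesgue_measure R).

Definition primitive (f : R -> R) (t : R) : R := \int[mu]_(s in `]-oo, t]) f s.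

Variables (f : R -> R) (A B : R).
Hypothesis cf : continuous f.
Hypothesis f0 : forall x, x <= A \/ B <= x -> f x = 0.

Lemma primitive_integrable D : measurable D -> mu.-integrable D (EFin \o f).
Proof.
move=> mD; apply: (@integrable_cts_supp _ _ (`|A| + `|B|)) => // x.
have hA := ler_norm (- A); have hB := ler_norm B; rewrite normrN in hA.
have hA0 := normr_ge0 A; have hB0 := normr_ge0 B.
by rewrite ltr_normr => /orP[h|h]; apply: f0; [right|left]; lra.
Qed.

Lemma der_primitive (x : R) : is_derive x 1 (primitive f) (f x).
Proof.
have x1 : x < x + 1 by rewrite ltrDl.
have [d e] := @continuous_FTC1 R f -oo%O x (x + 1) x1
  (primitive_integrable (measurable_itv _)) (ltNyr _) (@cf x).
by apply: DeriveDef; [exact: d|rewrite -derive1E; exact: e].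
Qed.

Lemma primitive_le x : x <= A -> primitive f x = 0.
Proof.
move=> xA; rewrite /primitive (@eq_Rintegral _ _ _ _ _ (cst 0)).
  by rewrite Rintegral_cst ?mul0r.
move=> y; rewrite inE /= in_itv /= => yx; apply: f0; left.
exact: le_trans xA.
Qed.

Lemma primitive_ge x : B <= x -> primitive f x = \int[mu]_s f s.
Proof.
move=> Bx; rewrite /primitive Rintegral_mkcond; apply: eq_Rintegral => y _.
rewrite patchE; case: ifPn => //; rewrite notin_setE /= in_itv /= => /negP.
by rewrite -ltNge => xy; rewrite f0 //; right; exact/ltW/(le_lt_trans Bx).
Qed.

Lemma primitive_le_int x : (forall x, 0 <= f x) -> primitive f x <= \int[mu]_s f s.
Proof.
move=> p; rewrite /primitive Rintegral_mkcond; apply: le_Rintegral => //.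
- have := @primitive_integrable `]-oo, x] (measurable_itv _).
  by move/integrable_mkcond => /(_ (measurable_itv _)); rewrite restrict_EFin.
- exact: primitive_integrable.
- by move=> y _; rewrite patchE; case: ifPn.
Qed.

Lemma smooth_primitive : smooth f -> smooth (primitive f).
Proof.
move=> sf; apply/smooth1P; split=> [x|].
  exact: der_derivable (der_primitive x).
rewrite (_ : derive1 _ = f) //.
by apply/funext => x; exact: der_derive1 (der_primitive x).
Qed.

End primitives.

Lemma smooth_exp_half {R : realType} : smooth (fun t : R => expR (t / 2)).
Proof.
apply: (@smooth_comp _ _ _ expR); last exact: smooth_expR.
by apply: smoothM; [exact: smooth_id|exact: smooth_cst].
Qed.

Section bumps.
Context {R : realType}.
Local Notation mu := (@lebesgue_measure R).

(** For [n > 0] this increases with [n] to the indicator of [[a, b]] and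
    vanishes exactly off the open interval. *)
Definition itv_bump (n a b x : R) : R := ebump (n * (x - a)) * ebump (n * (b - x)).

Lemma smooth_itv_bump n a b : smooth (itv_bump n a b).
Proof.
have sid : smooth (fun x : R => x) by exact: smooth_id.
apply: smoothM; apply: (@smooth_comp _ _ _ ebump); try exact: smooth_ebump;
  by apply: smoothM; [exact: smooth_cst|apply: smoothB => //; exact: smooth_cst].
Qed.

Lemma itv_bump_ge0 n a b x : 0 <= itv_bump n a b x.
Proof. by rewrite mulr_ge0 // ebump_ge0. Qed.

Lemma itv_bump_le1 n a b x : itv_bump n a b x <= 1.
Proof. by rewrite mulr_ile1 ?ebump_ge0 ?ebump_le1. Qed.

Lemma itv_bump_out n a b x : 0 < n -> x <= a \/ b <= x -> itv_bump n a b x = 0.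
Proof.
rewrite /itv_bump => n0 [h|h].
  by rewrite ebump_le0 ?mul0r // pmulr_rle0 // subr_le0.
by rewrite mulrC ebump_le0 ?mul0r // pmulr_rle0 // subr_le0.
Qed.

Lemma itv_bump_cvg a b x : a < x < b ->
  itv_bump k.+1%:R a b x @[k --> \oo] --> (1 : R).
Proof.
move=> /andP[ax xb].
have cvy (d : R) : 0 < d -> k.+1%:R * d @[k --> \oo] --> +oo.
  move=> d0; apply/cvgryPge => A; near=> k.
  rewrite -ler_pdivrMr //; apply: le_trans (_ : k%:R <= _); last by rewrite ler_nat.
  by near: k; exact: nbhs_infty_ger.
rewrite -[X in _ --> X]mulr1.
apply: cvgM; apply: (@ebump_cvg _ (fun k => k.+1%:R * _)); apply: cvy; by rewrite subr_gt0.
Unshelve. all: by end_near. Qed.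

Lemma itv_bump_integrable n a b D : 0 < n -> measurable D ->
  mu.-integrable D (EFin \o itv_bump n a b).
Proof.
move=> n0 mD; apply: (@primitive_integrable _ _ a b) => //.
  exact/smooth_cont/smooth_itv_bump.
by move=> x; exact: itv_bump_out.
Qed.

Lemma itv_bump_int_gt0 n a b : 0 < n -> a < b -> 0 < \int[mu]_x itv_bump n a b x.
Proof.
move=> n0 ab.
pose a' := a + (b - a) / 3; pose b' := b - (b - a) / 3.
have ab' : a < a' /\ a' < b' /\ b' < b by rewrite /a' /b'; split; [|split]; lra.
have [aa' [ab'' bb']] := ab'.
pose c := ebump (n * (a' - a)) * ebump (n * (b - b')).
have c0 : 0 < c by rewrite mulr_gt0 // ebump_gt0 // mulr_gt0 // subr_gt0.
apply: lt_le_trans (_ : \int[mu]_(x in `[a', b']) c <= _).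
  rewrite Rintegral_cst //= lebesgue_measure_itv /= lte_fin ab''.
  by rewrite mulr_gt0 //= subr_gt0.
apply: le_trans (_ : \int[mu]_(x in `[a', b']) itv_bump n a b x <= _).
  apply: le_Rintegral => //.
  - by apply: (@continuous_integrable_itv _ (fun=> c)) => x; exact: cvg_cst.
  - exact: itv_bump_integrable.
  - move=> x; rewrite /= in_itv /= => /andP[h1 h2].
    by rewrite ler_pM ?ebump_ge0 // ebump_homo // ler_pM2l // lerB.
rewrite Rintegral_mkcond; apply: le_Rintegral => //.
- have := @itv_bump_integrable n a b `[a', b'] n0 (measurable_itv _).
  by move/integrable_mkcond => /(_ (measurable_itv _)); rewrite restrict_EFin.
- exact: itv_bump_integrable.
- by move=> x _; rewrite patchE; case: ifPn => // _; exact: itv_bump_ge0.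
Qed.

Lemma itv_bump_int_le n a b : 0 < n -> a < b -> \int[mu]_x itv_bump n a b x <= b - a.
Proof.
move=> n0 ab.
have -> : b - a = \int[mu]_(x in `[a, b]) 1.
  by rewrite Rintegral_cst //= lebesgue_measure_itv /= lte_fin ab /= mul1r.
rewrite [leRHS]Rintegral_mkcond; apply: le_Rintegral => //.
- exact: itv_bump_integrable.
- have h : mu.-integrable `[a, b] (EFin \o (fun=> 1 : R)).
    by apply: (@continuous_integrable_itv _ (fun=> 1)) => x; exact: cvg_cst.
  by move/integrable_mkcond : h => /(_ (measurable_itv _)); rewrite restrict_EFin.
- move=> x _; rewrite patchE; case: ifPn => [_|]; first exact: itv_bump_le1.
  rewrite notin_setE /= in_itv /= => h; rewrite itv_bump_out //.
  case: (leP x a) => xa; first by left.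
  by case: (leP b x) => xb; [right|exfalso; apply: h; rewrite !ltW].
Qed.

(** A cutoff in time that only looks at positive times: it is constant up to
    [a], then decreases to zero with the slope of a bump on [a, b].  A second
    bump at negative times makes its support compact. *)
Lemma time_cutoff (n a b : R) : 0 < n -> 0 <= a -> a < b -> exists psi : R -> R,
  [/\ test_function psi, forall t, 0 <= t -> 0 <= psi t,
    forall t : R, 0 <= t -> is_derive t 1 psi (- itv_bump n a b t) &
    forall t, 0 <= t -> t <= a -> psi t = \int[mu]_x itv_bump n a b x].
Proof.
move=> n0 a0 ab.
pose I1 := \int[mu]_x itv_bump 1 (-2) (-1) x; pose I := \int[mu]_x itv_bump n a b x.
have I10 : 0 < I1 by apply: itv_bump_int_gt0; lra.
pose G := primitive (itv_bump n a b); pose H := primitive (itv_bump 1 (-2) (-1)).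
have out1 (x : R) : x <= -2 \/ -1 <= x -> itv_bump 1 (-2) (-1) x = 0.
  exact: itv_bump_out.
have out2 (x : R) : x <= a \/ b <= x -> itv_bump n a b x = 0 by exact: itv_bump_out.
have c1 : continuous (itv_bump (1 : R) (-2) (-1)) by exact/smooth_cont/smooth_itv_bump.
have c2 : continuous (itv_bump n a b) by exact/smooth_cont/smooth_itv_bump.
have Ht t : 0 <= t -> I / I1 * H t = I.
  by move=> t0; rewrite /H (primitive_ge out1) ?divfK ?gt_eqF //; lra.
exists (fun t => I / I1 * H t + -1 * G t); split.
- apply: (@test_function1 _ _ (b + 2)).
    apply: smoothD; apply: smoothM; try exact: smooth_cst.
      by apply: smooth_primitive c1 out1 _; exact: smooth_itv_bump.
    by apply: smooth_primitive c2 out2 _; exact: smooth_itv_bump.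
  move=> x; rewrite ltr_normr => /orP[h|h].
    rewrite Ht; last lra.
    by rewrite /G (primitive_ge out2) ?mulN1r ?subrr //; lra.
  by rewrite /H /G (primitive_le out1) ?(primitive_le out2) ?mulr0 ?addr0 //; lra.
- move=> t t0; rewrite Ht // mulN1r subr_ge0.
  by apply: (primitive_le_int c2 out2) => x; exact: itv_bump_ge0.
- move=> t t0.
  have d1 := der_primitive c1 out1 t; have d2 := der_primitive c2 out2 t.
  apply: is_derive_eq (der_add (der_mul (der_cst _ t) d1) (der_mul (der_cst _ t) d2)) _.
  by rewrite out1 ?mulr0 ?add0r ?mulN1r ?mul0r ?addr0 //; right; lra.
- by move=> t t0 ta; rewrite Ht // /G (primitive_le out2) // mulr0 addr0.
Qed.

End bumps.

(** * Decay from an integrated inequality *)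

Section ae_tools.
Context d (T : measurableType d) (R : realType) (mu : {measure set T -> \bar R}).

Lemma ae_imply (P Q : T -> Prop) : (forall x, P x -> Q x) ->
  {ae mu, forall x, P x} -> {ae mu, forall x, Q x}.
Proof. by move=> PQ; apply: filterS => //; exact: (ae_filter_ringOfSetsType mu). Qed.

Lemma ae_imply2 (P Q S : T -> Prop) : (forall x, P x -> Q x -> S x) ->
  {ae mu, forall x, P x} -> {ae mu, forall x, Q x} -> {ae mu, forall x, S x}.
Proof. by move=> PQ; apply: filterS2 => //; exact: (ae_filter_ringOfSetsType mu). Qed.

Lemma fine_le_ge0 (x : \bar R) : (0 <= x)%E -> ((fine x)%:E <= x)%E.
Proof. by case: x => [r| |] //= _; rewrite ?leey. Qed.

Lemma integrable_fine_comp (D : set T) (F : T -> \bar R) : measurable D ->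
  mu.-integrable D F -> mu.-integrable D (EFin \o (fine \o F)).
Proof.
move=> mD Fi; apply: (le_integrable mD) (Fi).
  apply/measurable_EFinP; apply: measurableT_comp; first exact: fine_measurable.
  by case/integrableP : Fi.
by move=> x _ /=; case: (F x) => //=; rewrite normr0 leey.
Qed.

End ae_tools.

Section almost_everywhere_bounds.
Context {R : realType}.
Local Notation mu := (@lebesgue_measure R).

(** By Lebesgue's differentiation theorem a function is bounded almost
    everywhere by a common bound of its averages. *)
Lemma ae_le_of_averages (f : R -> R) (a b C : R) :
  mu.-integrable `[a, b] (EFin \o f) ->
  (forall c d, a <= c -> c < d -> d <= b ->
     \int[mu]_(x in `]c, d]) f x <= C * (d - c)) ->
  {ae mu, forall x, a < x < b -> f x <= C}.
Proof.
move=> fi fC; pose g := f \_ `[a, b].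
have gi : mu.-integrable setT (EFin \o g).
  by move/integrable_mkcond : fi => /(_ (measurable_itv _)); rewrite restrict_EFin.
have giD (D : set R) : measurable D -> mu.-integrable D (EFin \o g).
  by move=> mD; exact: integrableS gi.
have gl : locally_integrable setT g by exact: integrable_locally.
have := @FTC1Ny R g (fun y => giD _ (measurable_itv _)) gl.
apply: ae_imply => x [dF dF'] /andP[ax xb].
have gx : g x = f x by rewrite /g patchE mem_set //= in_itv /= !ltW.
rewrite -gx -dF' derive1E.
set F := fun x : R => _ in dF dF' *.
have cv : h^-1 *: (F (h *: 1 + x) - F x) @[h --> 0^'+] --> 'D_1 F x.
  exact: cvg_dnbhs_at_right.
rewrite -(cvg_lim _ cv) //; apply: limr_le; first by apply/cvg_ex; exists ('D_1 F x).
near=> h.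
have h0 : 0 < h by near: h; exact: nbhs_right_gt.
have hb : h + x <= b.
  by rewrite -lerBrDr ltW //; near: h; apply: nbhs_right_lt; rewrite subr_gt0.
rewrite /GRing.scale /= mulr1 ler_pdivrMl // mulrC.
have xh : x <= h + x by rewrite lerDr ltW.
rewrite (Rintegral_itvB (giD _ (measurable_itv _))) ?bnd_simp //.
have -> : \int[mu]_(y in `]x, h + x]) g y = \int[mu]_(y in `]x, h + x]) f y.
  apply: eq_Rintegral => y; rewrite inE /= in_itv /= => /andP[xy yh].
  rewrite /g patchE mem_set //= in_itv /= (le_trans yh hb) andbT.
  exact: ltW (lt_trans ax xy).
by apply: le_trans (fC _ _ (ltW ax) _ hb) _; rewrite ?ltrDr // addrK mulrC.
Unshelve. all: by end_near. Qed.

(** Finiteness almost everywhere also comes from the bounds, on segments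
    exhausting the open half-line. *)
Lemma ae_le_of_itv_integrals (F : R -> \bar R) (C : R) :
  measurable_fun `[(0 : R), +oo[ F -> (forall t, 0 <= t -> (0 <= F t)%E) ->
  (forall a b, 0 < a -> a < b ->
     (\int[mu]_(t in `[a, b]) F t <= (C * (b - a))%:E)%E) ->
  {ae mu, forall t, 0 < t -> (F t <= C%:E)%E}.
Proof.
move=> mF F0 FC.
have Fi k : mu.-integrable `[k.+2%:R^-1, k.+2%:R] F.
  apply/integrableP; split.
    apply: measurable_funS mF => // t /=; rewrite !in_itv /= andbT => /andP[+ _].
    by apply: le_trans; rewrite invr_ge0.
  have -> : (\int[mu]_(t in `[k.+2%:R^-1%R, k.+2%:R%R]) `|F t| =
             \int[mu]_(t in `[k.+2%:R^-1%R, k.+2%:R%R]) F t)%E.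
    apply: eq_integral => t; rewrite inE /= in_itv /= => /andP[+ _] => h.
    by rewrite gee0_abs // F0 // (le_trans _ h) // invr_ge0.
  apply: le_lt_trans (FC _ _ _ _) _; rewrite ?ltry ?invr_gt0 //.
  by rewrite (@lt_trans _ _ 1) ?ltr1n // invf_lt1 // ltr1n.
have H k : {ae mu, forall t, k.+2%:R^-1 < t < k.+2%:R -> (F t <= C%:E)%E}.
  have Ffin : {ae mu, forall t, `[k.+2%:R^-1, k.+2%:R]%classic t -> F t \is a fin_num}.
    by apply: integrable_ae (Fi k); exact: measurable_itv.
  have FiE : mu.-integrable `[k.+2%:R^-1, k.+2%:R] (EFin \o (fine \o F)).
    by apply: integrable_fine_comp (Fi k); exact: measurable_itv.
  have H : {ae mu, forall t, k.+2%:R^-1 < t < k.+2%:R -> fine (F t) <= C}.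
    apply: (ae_le_of_averages FiE) => c e kc ce ek.
    have c0 : 0 < c by apply: lt_le_trans kc; rewrite invr_gt0.
    have Fce := FC c e c0 ce.
    have mFce : measurable_fun `[c, e] F.
      apply: measurable_funS mF => // t /=; rewrite !in_itv /= andbT => /andP[+ _].
      exact/le_trans/ltW.
    have F0' t : `[c, e]%classic t -> (0 <= F t)%E.
      by rewrite /= in_itv /= => /andP[ct _]; rewrite F0 // (le_trans (ltW c0)).
    have sub : `]c, e] `<=` `[c, e] by apply: subset_itvr; rewrite bnd_simp.
    rewrite -lee_fin; apply: le_trans Fce.
    apply: (@le_trans _ _ (\int[mu]_(t in `]c, e]) F t)%E); last exact: ge0_subset_integral.
    rewrite /Rintegral fineK; last first.
      apply: integrable_fin_num => //; apply: integrableS FiE => // t /= .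
      by rewrite !in_itv /= => /andP[ct te]; rewrite (le_trans kc (ltW ct)) (le_trans te ek).
    apply: ge0_le_integral => //.
    - by move=> t /sub/F0' h; rewrite lee_fin fine_ge0.
    - case/integrableP : FiE => + _; apply: measurable_funS => // t /= .
      by rewrite !in_itv /= => /andP[ct te]; rewrite (le_trans kc (ltW ct)) (le_trans te ek).
    - exact: measurable_funS mFce.
    - by move=> t /sub/F0' h; exact: fine_le_ge0.
  apply: ae_imply2 H Ffin => t H1 H2 /[dup] kt /andP[k1 k2].
  by rewrite -(fineK (H2 _)) ?lee_fin ?H1 //= in_itv /= !ltW.
apply: ae_imply (ae_foralln H) => t Ht t0.
have [k tk] : exists k : nat, k.+2%:R^-1 < t < k.+2%:R.
  exists (Num.bound t + Num.bound t^-1)%N; apply/andP; split.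
    rewrite invf_plt ?posrE //.
    apply: lt_le_trans (archi_boundP (ltW _)) _; rewrite ?invr_gt0 // ler_nat.
    by rewrite -addn2 -addnA addnCA leq_addr.
  apply: lt_le_trans (archi_boundP (ltW t0)) _; rewrite ler_nat.
  by rewrite -addn2 -addnA leq_addr.
exact: Ht tk.
Qed.

End almost_everywhere_bounds.

Section decay.
Context {R : realType}.
Local Notation mu := (@lebesgue_measure R).
Variables (E D : R -> \bar R) (E0 : R).
Hypothesis mE : measurable_fun `[(0 : R), +oo[ E.
Hypothesis mD : measurable_fun `[(0 : R), +oo[ D.
Hypothesis E_ge0 : forall t, 0 <= t -> (0 <= E t)%E.
Hypothesis D_ge0 : forall t, 0 <= t -> (0 <= D t)%E.
Hypothesis EI : forall psi : R -> R, test_function psi ->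
  (forall t, 0 <= t -> 0 <= psi t) -> (forall t, 0 <= t -> derive1 psi t <= 0) ->
  (\int[mu]_(t in `[0%R, +oo[) ((expR (t / 2))%:E *
     ((- derive1 psi t)%:E * E t + (psi t)%:E * D t)) <= (psi 0%R * E0)%:E)%E.

Let mexp : measurable_fun `[(0 : R), +oo[ (fun t => (expR (t / 2))%:E).
Proof.
apply: smooth_emeasurable; exact: smooth_exp_half.
Qed.

Let mE' : measurable_fun `[(0 : R), +oo[ (fun t => (expR (t / 2))%:E * E t)%E.
Proof. exact: emeasurable_funM. Qed.

Let mD' : measurable_fun `[(0 : R), +oo[ (fun t => (expR (t / 2))%:E * D t)%E.
Proof. exact: emeasurable_funM. Qed.

Let E'_ge0 t : 0 <= t -> (0 <= (expR (t / 2))%:E * E t)%E.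
Proof. by move=> t0; rewrite mule_ge0 ?E_ge0 // lee_fin expR_ge0. Qed.

Let D'_ge0 t : 0 <= t -> (0 <= (expR (t / 2))%:E * D t)%E.
Proof. by move=> t0; rewrite mule_ge0 ?D_ge0 // lee_fin expR_ge0. Qed.

(** Testing with the cutoffs whose slope is a bump gives both a bound on
    averages of the energy and a bound on the dissipation before [a]. *)
Lemma energy_bump_bound n a b : 0 < n -> 0 <= a -> a < b ->
  (\int[mu]_(t in `[0%R, +oo[) ((itv_bump n a b t)%:E * ((expR (t / 2))%:E * E t)) <=
     ((b - a) * E0)%:E)%E /\
  (\int[mu]_(t in `[0%R, a]) ((expR (t / 2))%:E * D t) <= E0%:E)%E.
Proof.
move=> n0 a0 ab; have [psi [tp p0 dp pa]] := time_cutoff n0 a0 ab.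
have dpE t : 0 <= t -> derive1 psi t = - itv_bump n a b t.
  by move=> t0; exact: der_derive1 (dp t t0).
have := EI tp p0.
have dle t : 0 <= t -> derive1 psi t <= 0.
  by move=> t0; rewrite dpE // oppr_le0 itv_bump_ge0.
move=> /(_ dle).
have eqI : (\int[mu]_(t in `[0%R, +oo[) ((expR (t / 2))%:E *
     ((- derive1 psi t)%:E * E t + (psi t)%:E * D t)) =
  \int[mu]_(t in `[0%R, +oo[) ((itv_bump n a b t)%:E * ((expR (t / 2))%:E * E t)) +
  \int[mu]_(t in `[0%R, +oo[) ((psi t)%:E * ((expR (t / 2))%:E * D t)))%E.
  rewrite -ge0_integralD //.
  - apply: eq_integral => t; rewrite inE /= in_itv /= andbT => t0.
    rewrite dpE // opprK ge0_muleDr ?mule_ge0 ?lee_fin ?itv_bump_ge0 ?p0 ?E_ge0 ?D_ge0 //.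
    by rewrite !muleA; congr (_ * _ + _ * _)%E; rewrite muleC.
  - by move=> t /=; rewrite in_itv /= andbT => t0; rewrite mule_ge0 ?E'_ge0 ?lee_fin ?itv_bump_ge0.
  - apply: emeasurable_funM => //; apply: smooth_emeasurable; exact: smooth_itv_bump.
  - by move=> t /=; rewrite in_itv /= andbT => t0; rewrite mule_ge0 ?D'_ge0 ?lee_fin ?p0.
  - apply: emeasurable_funM => //; apply: smooth_emeasurable; exact: test_function_smooth.
rewrite eqI => {eqI} H.
have I0 := itv_bump_int_gt0 n0 ab; have Ile := itv_bump_int_le n0 ab.
have psi0 := pa 0 (lexx _) a0; rewrite psi0 in H.
set X := (X in (X + _ <= _)%E) in H; set Y := (Y in (_ + Y <= _)%E) in H.
have X0 : (0 <= X)%E.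
  apply: integral_ge0 => t /=; rewrite in_itv /= andbT => t0.
  by rewrite mule_ge0 ?E'_ge0 ?lee_fin ?itv_bump_ge0.
have Y0 : (0 <= Y)%E.
  apply: integral_ge0 => t /=; rewrite in_itv /= andbT => t0.
  by rewrite mule_ge0 ?D'_ge0 ?lee_fin ?p0.
have E00 : 0 <= E0.
  rewrite -(pmulr_rge0 _ I0) -lee_fin; apply: le_trans H; exact: adde_ge0.
split.
  apply: le_trans (_ : X + Y <= _)%E; first by rewrite leeDl.
  by apply: le_trans H _; rewrite lee_fin ler_wpM2r.
have mset : `[0, a] `<=` `[(0 : R), +oo[.
  by apply: subset_itvl.
have : (\int[mu]_(t in `[0%R, a]) ((\int[mu]_x itv_bump n a b x)%:E * ((expR (t / 2))%:E * D t)) <=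
        (\int[mu]_x itv_bump n a b x * E0)%:E)%E.
  apply: le_trans H; apply: le_trans (_ : Y <= _)%E; last by rewrite leeDr.
  apply: le_trans (_ : \int[mu]_(t in `[0%R, a]) ((psi t)%:E * ((expR (t / 2))%:E * D t)) <= _)%E.
    rewrite le_eqVlt; apply/orP; left; apply/eqP; apply: eq_integral => t.
    by rewrite inE /= in_itv /= => /andP[t0 ta]; rewrite pa.
  apply: ge0_subset_integral => //.
    apply: emeasurable_funM => //; apply: smooth_emeasurable; exact: test_function_smooth.
  move=> t /=; rewrite in_itv /= andbT => t0.
  by rewrite mule_ge0 ?D'_ge0 ?lee_fin ?p0.
rewrite ge0_integralZl_EFin //; last 3 first.
- by move=> t /mset /=; rewrite in_itv /= andbT; exact: D'_ge0.
- exact: measurable_funS mD'.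
- exact: ltW.
by rewrite EFinM lee_pmul2l // lte_fin.
Qed.

End decay.

Section decay_estimates.
Context {R : realType}.
Local Notation mu := (@lebesgue_measure R).

Lemma ebump_square_le (I : \bar R) (c K : R) : 0 < c -> (0 <= I)%E ->
  (forall n : nat, ((ebump (n.+1%:R * c) ^+ 2)%:E * I <= K%:E)%E) -> (I <= K%:E)%E.
Proof.
move=> c0 I0 H.
have e0 n : 0 < ebump (n.+1%:R * c) ^+ 2.
  by rewrite exprn_gt0 // ebump_gt0 // mulr_gt0.
case: I I0 H => [r|_ /(_ 0%N)|//].
  move=> r0 H; rewrite lee_fin.
  have cvy : ebump (n.+1%:R * c) ^+ 2 * r @[n --> \oo] --> (1 ^+ 2 * r : R).
    apply: cvgMl; rewrite (_ : (fun n => _) = fun n => ebump (n.+1%:R * c) * ebump (n.+1%:R * c)) //.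
    have h : ebump (n.+1%:R * c) @[n --> \oo] --> (1 : R).
      apply: (@ebump_cvg _ (fun n => n.+1%:R * c)).
      apply/cvgryPge => A; near=> k.
      rewrite -ler_pdivrMr //; apply: le_trans (_ : k%:R <= _); last by rewrite ler_nat.
      by near: k; exact: nbhs_infty_ger.
    exact: cvgM.
  rewrite expr1n mul1r in cvy.
  rewrite -(cvg_lim _ cvy) //; apply: limr_le; first by apply/cvg_ex; exists r.
  by near=> n; have := H n; rewrite -EFinM lee_fin.
by rewrite gt0_muley // lte_fin.
Unshelve. all: by end_near. Qed.

Variables (E D : R -> \bar R) (E0 : R).
Hypothesis mE : measurable_fun `[(0 : R), +oo[ E.
Hypothesis mD : measurable_fun `[(0 : R), +oo[ D.
Hypothesis E_ge0 : forall t, 0 <= t -> (0 <= E t)%E.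
Hypothesis D_ge0 : forall t, 0 <= t -> (0 <= D t)%E.
Hypothesis EI : forall psi : R -> R, test_function psi ->
  (forall t, 0 <= t -> 0 <= psi t) -> (forall t, 0 <= t -> derive1 psi t <= 0) ->
  (\int[mu]_(t in `[0%R, +oo[) ((expR (t / 2))%:E *
     ((- derive1 psi t)%:E * E t + (psi t)%:E * D t)) <= (psi 0%R * E0)%:E)%E.

Let F t := ((expR (t / 2))%:E * E t)%E.

Let F_ge0 t : 0 <= t -> (0 <= F t)%E.
Proof. by move=> t0; rewrite mule_ge0 ?E_ge0 // lee_fin expR_ge0. Qed.

Let mexp : measurable_fun `[(0 : R), +oo[ (fun t => (expR (t / 2))%:E).
Proof. by apply: smooth_emeasurable; exact: smooth_exp_half. Qed.

Let mF : measurable_fun `[(0 : R), +oo[ F.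
Proof. exact: emeasurable_funM. Qed.

Let bump_bound n a b n0 a0 ab := (@energy_bump_bound R E D E0 mE mD E_ge0 D_ge0 EI n a b n0 a0 ab).

Let E00 : 0 <= E0.
Proof.
have [_] := @bump_bound 1 0 1 ltr01 (lexx _) ltr01.
rewrite -lee_fin; apply: le_trans; apply: integral_ge0 => t.
by rewrite /= in_itv /= => /andP[t0 _]; rewrite mule_ge0 ?D_ge0 // lee_fin expR_ge0.
Qed.

(** The bump on [[a - d, b + d]] is at least [ebump ((n + 1) d) ^+ 2] on [[a, b]];
    the factor disappears as [n] grows, the margin as [d] tends to [0]. *)
Let F_itv a b : 0 < a -> a < b ->
  (\int[mu]_(t in `[a, b]) F t <= (E0 * (b - a))%:E)%E.
Proof.
move=> a0 ab.
have sub : `[a, b] `<=` `[(0 : R), +oo[.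
  by move=> t /=; rewrite !in_itv /= andbT => /andP[+ _]; apply: le_trans; exact: ltW.
have I0 : (0 <= \int[mu]_(t in `[a, b]) F t)%E.
  by apply: integral_ge0 => t /sub /=; rewrite in_itv /= andbT; exact: F_ge0.
have step d : 0 < d -> d < a ->
    (\int[mu]_(t in `[a, b]) F t <= (E0 * (b - a + 2 * d))%:E)%E.
  move=> d0 da; apply: (ebump_square_le d0) => // n.
  have n0 : 0 < n.+1%:R :> R by [].
  have ad : 0 <= a - d by lra.
  have abd : a - d < b + d by lra.
  have [+ _] := bump_bound n0 ad abd.
  have -> : ((b + d - (a - d)) * E0)%:E = (E0 * (b - a + 2 * d))%:E.
    by congr EFin; ring.
  apply: le_trans.
  have mbF : measurable_fun `[(0 : R), +oo[
      (fun t => (itv_bump n.+1%:R (a - d) (b + d) t)%:E * F t)%E.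
    by apply: emeasurable_funM => //; apply: smooth_emeasurable; exact: smooth_itv_bump.
  rewrite -ge0_integralZl_EFin ?sqr_ge0 //; last 2 first.
    by move=> t /sub /=; rewrite in_itv /= andbT; exact: F_ge0.
    exact: measurable_funS mF.
  apply: (@le_trans _ _ (\int[mu]_(t in `[a, b])
      ((itv_bump n.+1%:R (a - d) (b + d) t)%:E * F t))%E).
    apply: ge0_le_integral => //.
    - move=> t /sub /=; rewrite in_itv /= andbT => t0.
      by rewrite mule_ge0 ?F_ge0 // lee_fin sqr_ge0.
    - by apply: emeasurable_funM => //; exact: measurable_funS mF.
    - exact: measurable_funS mbF.
    - move=> t /[dup] /sub /=; rewrite !in_itv /= andbT => t0 /andP[h1 h2].
      rewrite lee_wpmul2r ?F_ge0 // lee_fin expr2.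
      by rewrite ler_pM ?ebump_ge0 // ebump_homo // ler_wpM2l //; lra.
  apply: ge0_subset_integral => // t /=; rewrite in_itv /= andbT => t0.
  by rewrite mule_ge0 ?F_ge0 // lee_fin itv_bump_ge0.
apply/lee_addgt0Pr => e e0.
pose d := Num.min (a / 2) (e / (2 * E0 + 1)).
have E1 : 0 < 2 * E0 + 1 by have := E00; lra.
have d0 : 0 < d by rewrite lt_min !divr_gt0.
apply: le_trans (step d d0 _) _.
  by rewrite gt_min; apply/orP; left; lra.
rewrite -EFinD lee_fin mulrDr lerD2l.
have : d <= e / (2 * E0 + 1) by rewrite ge_min lexx orbT.
by rewrite ler_pdivlMr //; lra.
Qed.

(** The averages of [exp(t/2) E t] are at most [E0]. *)
Lemma energy_decay :
  {ae mu, forall t, 0 < t -> (E t <= (expR (- (t / 2)) * E0)%:E)%E}.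
Proof.
have := ae_le_of_itv_integrals mF F_ge0 F_itv.
apply: ae_imply => t Ht t0; have := Ht t0; rewrite /F => h.
by rewrite EFinM expRN lee_pdivlMl ?expR_gt0.
Qed.

(** The weight [exp(s/2)] of the dissipation is at least [exp(t/2)] after [t]. *)
Lemma dissipation_decay t : 0 < t ->
  (\int[mu]_(s in `]t, +oo[) D s <= (expR (- (t / 2)) * E0)%:E)%E.
Proof.
move=> t0.
have step (k : nat) : (\int[mu]_(s in `]t, (t + k%:R)%R]) D s <= (expR (- (t / 2)) * E0)%:E)%E.
  have a0 : 0 <= t + k%:R by rewrite addr_ge0 // ltW.
  have a1 : t + k%:R < t + k%:R + 1 by rewrite ltrDl.
  have [_ H] := bump_bound ltr01 a0 a1.
  have sub : `]t, t + k%:R] `<=` `[0, t + k%:R].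
    move=> s /=; rewrite !in_itv /= => /andP[ts ->]; rewrite andbT ltW //.
    exact: lt_trans t0 ts.
  have sub0 : `[0, t + k%:R] `<=` `[(0 : R), +oo[.
    by move=> s /=; rewrite !in_itv /= andbT => /andP[].
  have mDe : measurable_fun `[0, t + k%:R] (fun s => (expR (s / 2))%:E * D s)%E.
    by apply: measurable_funS (emeasurable_funM mexp mD).
  have subt : `]t, t + k%:R] `<=` `[(0 : R), +oo[ by apply: subset_trans sub0.
  rewrite EFinM expRN lee_pdivlMl ?expR_gt0 //; apply: le_trans H.
  rewrite -ge0_integralZl_EFin ?expR_ge0 //; last 2 first.
    by move=> s /subt /=; rewrite in_itv /= andbT; exact: D_ge0.
    exact: measurable_funS mD.
  apply: (@le_trans _ _ (\int[mu]_(s in `]t, (t + k%:R)%R]) ((expR (s / 2))%:E * D s))%E).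
    apply: ge0_le_integral => //.
    - move=> s /subt /=; rewrite in_itv /= andbT => s0.
      by rewrite mule_ge0 ?D_ge0 // lee_fin expR_ge0.
    - by apply: emeasurable_funM => //; exact: measurable_funS mD.
    - exact: measurable_funS mDe.
    - move=> s /[dup] /subt /=; rewrite !in_itv /= andbT => s0 /andP[ts _].
      by rewrite lee_wpmul2r ?D_ge0 // lee_fin ler_expR ler_wpM2r // ltW.
  apply: ge0_subset_integral => // s /sub0 /=; rewrite in_itv /= andbT => s0.
  by rewrite mule_ge0 ?D_ge0 // lee_fin expR_ge0.
have sub k : `]t, t + k%:R] `<=` `[(0 : R), +oo[.
  by move=> s /=; rewrite !in_itv /= andbT => /andP[/(lt_trans t0)/ltW].
have bigE : `]t, +oo[%classic = \bigcup_(k : nat) `]t, t + k%:R]%classic.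
  apply/seteqP; split=> s /=; last by move=> [k _] /=; rewrite !in_itv /= andbT => /andP[].
  rewrite in_itv /= andbT => ts; exists (Num.bound (s - t)) => //=.
  rewrite in_itv /= ts /= -lerBlDl ltW // archi_boundP // subr_ge0; exact: ltW.
have cv : (\int[mu]_(x in `]t, (t + k%:R)%R]) D x)%E @[k --> \oo] -->
    (\int[mu]_(x in \bigcup_(k : nat) `]t, (t + k%:R)%R]%classic) D x)%E.
  apply: ge0_nondecreasing_set_cvg_integral => //.
  - move=> m n mn; apply/subsetPset; apply: subset_itvl.
    by rewrite bnd_simp lerD2l ler_nat.
  - by move=> k; apply: measurable_funS (sub k) mD.
  - by move=> k s /sub /=; rewrite in_itv /= andbT; exact: D_ge0.
rewrite bigE -(cvg_lim _ cv) //; apply: lime_le; first by apply: cvgP cv.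
by near=> k; exact: step.
Unshelve. all: by end_near. Qed.

End decay_estimates.

(** * Integration over the half plane *)

Section half_plane_integrals.
Context {R : realType}.
Local Notation mu := (@lebesgue_measure R).
Local Notation mu2 := (@lebesgue_measure R \x @lebesgue_measure R)%E.
Local Notation T2 := (measurableTypeR R * measurableTypeR R)%type.

Lemma half_planeE : half_plane R = `[(0 : R), +oo[ `*` setT.
Proof.
by apply/seteqP; split=> x; rewrite /half_plane /= in_itv /= andbT; [|case].
Qed.

Lemma measurable_half_plane : measurable (half_plane R : set T2).
Proof. by rewrite half_planeE; apply: measurableX. Qed.
Hint Resolve measurable_half_plane : core.

Lemma half_plane_section (f : R * R -> \bar R) t :
  (\int[mu]_y (f \_ (half_plane R)) (t, y) =
   ((fun s => \int[mu]_y f (s, y)) \_ `[0%R, +oo[) t)%E.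
Proof.
rewrite patchE; case: ifPn => [|].
  rewrite inE /= in_itv /= andbT => t0; apply: eq_integral => y _.
  by rewrite patchE mem_set.
rewrite notin_setE /= in_itv /= andbT => t0.
rewrite integral0_eq // => y _; rewrite patchE memNset //.
Qed.

Lemma tonelli_half_plane (f : R * R -> \bar R) :
  measurable_fun (half_plane R : set T2) f ->
  (forall x, half_plane R x -> (0 <= f x)%E) ->
  measurable_fun `[(0 : R), +oo[ (fun t => \int[mu]_y f (t, y))%E /\
  (\int[mu2]_(x in half_plane R) f x =
   \int[mu]_(t in `[0%R, +oo[) \int[mu]_y f (t, y))%E.
Proof.
move=> mf f0.
have mf' : measurable_fun (setT : set T2) (f \_ (half_plane R)).
  by apply/(measurable_restrictT _ _).1.
have f0' x : (0 <= (f \_ (half_plane R)) x)%E.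
  by rewrite patchE; case: ifPn => // /[!inE]; exact: f0.
have mF := @measurable_fun_fubini_tonelli_F _ _ _ _ _ mu _ mf' f0'.
have eF : fubini_F mu (f \_ (half_plane R)) =
    ((fun s => \int[mu]_y f (s, y)) \_ `[0%R, +oo[)%E.
  by apply/funext => t; exact: half_plane_section.
split; first by apply/(measurable_restrictT _ _).2 => //; rewrite -eF.
rewrite integral_mkcond (@fubini_tonelli1 _ _ _ _ _ mu mu _ mf' f0').
by rewrite [RHS]integral_mkcond; apply: eq_integral => t _; exact: half_plane_section.
Qed.

Lemma measurable_integral_section (f : R * R -> \bar R) :
  measurable_fun (half_plane R : set T2) f ->
  measurable_fun `[(0 : R), +oo[ (fun t => \int[mu]_y f (t, y))%E.
Proof.
move=> mf; rewrite (_ : (fun t => _) = (fun t => \int[mu]_y f^\+ (t, y) - \int[mu]_y f^\- (t, y)))%E; last first.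
  by apply/funext => t; rewrite integralE; congr (_ - _)%E; apply: eq_integral => y _;
    rewrite ?funeposE ?funenegE.
apply: emeasurable_funB.
  by have [] := tonelli_half_plane (measurable_funepos mf) (fun x _ => funepos_ge0 _ x).
by have [] := tonelli_half_plane (measurable_funeneg mf) (fun x _ => funeneg_ge0 _ x).
Qed.

Lemma fubini_half_plane (f : R * R -> \bar R) :
  mu2.-integrable (half_plane R) f ->
  [/\ mu.-integrable `[(0 : R), +oo[ (fun t => \int[mu]_y f (t, y))%E,
   {ae mu, forall t, 0 <= t -> mu.-integrable setT (fun y => f (t, y))} &
  (\int[mu2]_(x in half_plane R) f x =
   \int[mu]_(t in `[0%R, +oo[) \int[mu]_y f (t, y))%E].
Proof.
move=> /(integrable_mkcond _ measurable_half_plane) fi.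
have eF : fubini_F mu (f \_ (half_plane R)) =
    ((fun s => \int[mu]_y f (s, y)) \_ `[0%R, +oo[)%E.
  by apply/funext => t; exact: half_plane_section.
split.
- apply/integrable_mkcond => //; rewrite -eF.
  exact: integrable_fubini_F.
- have := ae_integrable1 fi; apply: ae_imply => t + t0.
  congr (_.-integrable _ _); apply/funext => y /=.
  by rewrite patchE mem_set.
rewrite integral_mkcond -(integral12_prod_meas1 fi).
by rewrite [RHS]integral_mkcond; apply: eq_integral => t _; exact: half_plane_section.
Qed.

Lemma ae_section (P : R * R -> Prop) :
  {ae mu2, forall x, half_plane R x -> P x} ->
  {ae mu, forall t, 0 <= t -> {ae mu, forall y, P (t, y)}}.
Proof.
move=> [N [mN N0 sub]].
have mx : measurable_fun setT (mu \o xsection N) by exact: measurable_fun_xsection.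
have /(ae_eq_integral_abs _ measurableT mx) h : (\int[mu]_x `|(mu \o xsection N) x| = 0)%E.
  rewrite -[RHS]N0; apply: eq_integral => t _ /=.
  by rewrite gee0_abs.
apply: ae_imply h => t /(_ I) /= Nt t0.
exists (xsection N t); split => //; first exact: measurable_xsection.
move=> y /= nP; rewrite /xsection /= inE; apply: sub => /= h; apply: nP; exact: h.
Qed.

Definition box (M : R) : set T2 := `[0, M] `*` `[- M, M].

Lemma measurable_box M : measurable (box M).
Proof. exact: measurableX. Qed.

Lemma box_half_plane M : box M `<=` half_plane R.
Proof. by move=> x [/=]; rewrite in_itv /= => /andP[]. Qed.

(** Local integrability tested on boxes, which unlike general compact sets are
    measurable for the product structure by construction. *)
Definition L1box (f : R * R -> \bar R) :=
  measurable_fun (half_plane R : set T2) f /\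
  forall M, (\int[mu2]_(x in box M) `|f x| < +oo)%E.

Lemma L1loc_L1box f : L1loc_half_plane f -> L1box f.
Proof.
move=> [mf fK]; split=> // M; apply: fK; first exact: box_half_plane.
by apply: compact_setX; exact: segment_compact.
Qed.

Lemma L1box_integrable (chi : R * R -> R) (f : R * R -> \bar R) (M C : R) :
  L1box f -> measurable_fun (half_plane R : set T2) chi ->
  (forall x, half_plane R x -> `|chi x| <= C) ->
  (forall x, half_plane R x -> M < x.1 \/ M < `|x.2| -> chi x = 0) ->
  mu2.-integrable (half_plane R) (fun x => (chi x)%:E * f x)%E.
Proof.
move=> [mf fK] mchi chiC chiM.
pose K := box M.
have KH : K `<=` half_plane R by exact: box_half_plane.
have mK : measurable K by exact: measurable_box.
have mg : measurable_fun (half_plane R : set T2) (fun x => (chi x)%:E * f x)%E.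
  by apply: emeasurable_funM => //; exact/measurable_EFinP.
apply/integrableP; split => //.
have C0 : 0 <= C by apply: le_trans (chiC (0, 0) _); rewrite ?normr_ge0 // /half_plane /=.
rewrite (_ : \int[mu2]_(x in half_plane R) `|(chi x)%:E * f x| =
             \int[mu2]_(x in K) `|(chi x)%:E * f x|)%E; last first.
  rewrite [LHS]integral_mkcond [RHS]integral_mkcond; apply: eq_integral => x _.
  rewrite !patchE; case: ifPn => xH; case: ifPn => // xK.
    have {}xH : half_plane R x by move: xH; rewrite inE.
    rewrite chiM ?mul0e ?abse0 //.
    move: xK; rewrite notin_setE /K /box /= !in_itv /= xH /= => h.
    case: (leP x.1 M) => x1; last by left.
    right; rewrite ltNge; apply/negP; rewrite ler_norml => h2.
    by apply: h.
  by move: xK; rewrite inE => /KH xH'; rewrite mem_set in xH.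
apply: (@le_lt_trans _ _ (C%:E * \int[mu2]_(x in K) `|f x|)%E); last first.
  by rewrite lte_mul_pinfty // /K fK.
have mfK : measurable_fun (K : set T2) f by exact: measurable_funS mf.
rewrite -ge0_integralZl_EFin //; last exact: measurableT_comp.
apply: ge0_le_integral => //.
- by apply: measurableT_comp => //; exact: measurable_funS mg.
- by apply: emeasurable_funM => //; exact: measurableT_comp.
- by move=> x /KH xH; rewrite abseM lee_wpmul2r // lee_fin chiC.
Qed.

End half_plane_integrals.
#[export] Hint Resolve measurable_half_plane : core.

(** * Pressure and potential *)

Section calculus.
Context {R : realType}.

Lemma mvt (f df : R -> R) (a b : R) : a < b ->
  (forall x, a < x < b -> is_derive x 1 f (df x)) ->
  {within `[a, b], continuous f} ->
  exists2 c, a < c < b & f b - f a = df c * (b - a).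
Proof.
move=> ab fd fc.
have fd' x : x \in `]a, b[ -> is_derive x 1 f (df x) by rewrite in_itv /=; exact: fd.
have [c + ->] := MVT ab fd' fc.
by rewrite in_itv /= => abc; exists c.
Qed.

Lemma mvt_der (f df : R -> R) (a b : R) : a < b ->
  (forall x, a <= x <= b -> is_derive x 1 f (df x)) ->
  exists2 c, a < c < b & f b - f a = df c * (b - a).
Proof.
move=> ab fd; apply: mvt => //.
  by move=> x /andP[ax xb]; apply: fd; rewrite !ltW.
apply: derivable_within_continuous => x; rewrite in_itv /= => /fd d.
exact: der_derivable d.
Qed.

Lemma within_continuousW (f : R -> R) (D E : set R) : D `<=` E ->
  {within E, continuous f} -> {within D, continuous f}.
Proof. by move=> DE; exact: continuous_subspaceW. Qed.

Lemma bounded_on_segment (f : R -> R) (a b : R) : a <= b ->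
  {within `[a, b], continuous f} ->
  exists2 B : R, 0 <= B & forall x, a <= x <= b -> `|f x| <= B.
Proof.
move=> ab fc.
have [c _ Hc] := EVT_max ab fc; have [d _ Hd] := EVT_min ab fc.
exists (`|f c| + `|f d|); first by rewrite addr_ge0.
move=> x xab; have h1 : f x <= f c by apply: Hc; rewrite in_itv.
have h2 : f d <= f x by apply: Hd; rewrite in_itv.
have := ler_norm (f c); have := ler_norm (- f d); rewrite normrN => h3 h4.
by rewrite ler_norml; apply/andP; split; [have := normr_ge0 (f c)|have := normr_ge0 (f d)]; lra.
Qed.

End calculus.

Section potential.
Context {R : realType}.
Variables (p h : R -> R).
Hypothesis plaw : pressure_law p.
Hypothesis hpot : internal_potential p h.
Local Notation h1 := (derive1 h).
Local Notation h2 := (derive1 (derive1 h)).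

Lemma der_h (z : R) : 0 < z -> is_derive z 1 h (h1 z).
Proof. by case: hpot => _ /(_ z) + _ _ => /[apply] -[/derivable_der]. Qed.

Lemma der_h1 (z : R) : 0 < z -> is_derive z 1 h1 (h2 z).
Proof. by case: hpot => _ /(_ z) + _ _ => /[apply] -[_ /derivable_der]. Qed.

Lemma der_p (z : R) : 0 < z -> is_derive z 1 p (derive1 p z).
Proof. by case: plaw => _ /(_ z) + _ _ => /[apply] /derivable_der. Qed.

Lemma pE (z : R) : 0 < z -> p z = z * h1 z - h z.
Proof. by case: hpot => _ _ _ H; exact: H. Qed.

Lemma dpE (z : R) : 0 < z -> derive1 p z = z * h2 z.
Proof.
move=> z0.
have d1 := der_sub (der_mul (der_id z) (der_h1 z0)) (der_h z0).
have d2 : is_derive z 1 p (z * h2 z + h1 z * 1 - h1 z).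
  apply: near_eq_is_derive d1.
  near=> y; rewrite pE //; near: y; exact: lt_nbhsr.
by rewrite (der_derive1 d2) mulr1 addrK.
Unshelve. all: by end_near. Qed.

Lemma h2_gt0 (z : R) : 0 < z -> 0 < h2 z.
Proof.
move=> z0; rewrite -(pmulr_rgt0 _ z0) -dpE //.
by case: plaw => _ _ _; exact.
Qed.

Lemma h_cont (a b : R) : 0 <= a -> {within `[a, b], continuous h}.
Proof.
move=> a0; case: hpot => + _ _ _; apply: within_continuousW => x /=.
by rewrite !in_itv /= andbT => /andP[+ _]; exact: le_trans.
Qed.

Lemma p_cont (a b : R) : 0 <= a -> {within `[a, b], continuous p}.
Proof.
move=> a0; case: plaw => + _ _ _; apply: within_continuousW => x /=.
by rewrite !in_itv /= andbT => /andP[+ _]; exact: le_trans.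
Qed.

Lemma h1_lt (x y : R) : 0 < x -> x < y -> h1 x < h1 y.
Proof.
move=> x0 xy.
have [|c /andP[xc _] e] := @mvt_der _ h1 h2 _ _ xy.
  by move=> z /andP[xz _]; apply: der_h1; exact: lt_le_trans xz.
by rewrite -subr_gt0 e mulr_gt0 ?subr_gt0 // h2_gt0 // (lt_trans x0).
Qed.

Lemma h1_le (x y : R) : 0 < x -> x <= y -> h1 x <= h1 y.
Proof. by move=> x0; rewrite le_eqVlt => /predU1P[->//|/(h1_lt x0)/ltW]. Qed.

Lemma h_mvt (x y : R) : 0 <= x -> x < y ->
  exists2 c, x < c < y & h y - h x = h1 c * (y - x).
Proof.
move=> x0 xy; apply: mvt => //; last exact: h_cont.
by move=> z /andP[xz _]; apply: der_h; exact: le_lt_trans xz.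
Qed.

Lemma h_convex (r rb : R) : 0 <= r -> 0 < rb ->
  0 <= h r - h rb - h1 rb * (r - rb).
Proof.
move=> r0 rb0; have [rrb|rrb|->] := ltgtP r rb; last by rewrite !subrr mulr0 subr0.
  have [c /andP[rc cb] e] := h_mvt r0 rrb.
  have hc : h1 c <= h1 rb by apply: h1_le; [exact: le_lt_trans rc|exact: ltW].
  have : h1 c * (rb - r) <= h1 rb * (rb - r) by rewrite ler_wpM2r // subr_ge0 ltW.
  by rewrite -e; lra.
have [c /andP[rc cb] e] := h_mvt (ltW rb0) rrb.
have hc : h1 rb <= h1 c by apply: h1_le => //; exact: ltW.
have : h1 rb * (r - rb) <= h1 c * (r - rb) by rewrite ler_wpM2r // subr_ge0 ltW.
by rewrite -e; lra.
Qed.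

Lemma dpotential_gt0 (z : R) : 0 < z -> dpotential h z = (h1 z)%:E.
Proof. by rewrite /dpotential => ->. Qed.

(** [h'] is increasing, so it has a limit at the vacuum, possibly [-oo]. *)
Lemma dpotential0_cvg : (h1 z)%:E @[z --> 0^'+] --> dpotential h 0.
Proof.
rewrite /dpotential ltxx.
have H : {in Interval (BRight (0 : R)) (BLeft 1) &,
    {homo (fun z => (h1 z)%:E) : x y / x <= y >-> (x <= y)%E}}.
  move=> x y; rewrite !in_itv /= => /andP[x0 _] _ xy; rewrite lee_fin.
  exact: h1_le.
by have := nondecreasing_at_right_cvge _ (ltr01 : (BRight (0 : R) < BLeft 1)%O) H; exact: cvgP.
Qed.

Lemma dpotential0_le (z : R) : 0 < z -> (dpotential h 0 <= (h1 z)%:E)%E.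
Proof.
move=> z0; rewrite -(cvg_lim _ dpotential0_cvg) //.
apply: lime_le; first exact: cvgP dpotential0_cvg.
near=> y; rewrite lee_fin h1_le //.
by near: y; exact: nbhs_right_le.
Unshelve. all: by end_near. Qed.

Lemma dpotential0_chord (r : R) : 0 < r ->
  (dpotential h 0 * r%:E <= (h r - h 0)%:E)%E.
Proof.
move=> r0; have [c /andP[c0 _] ->] := h_mvt (lexx 0) r0.
rewrite subr0 EFinM; apply: lee_wpmul2r; last exact: dpotential0_le.
by rewrite lee_fin ltW.
Qed.

Lemma rel_potential_ge0 (r rb : R) : (0 <= rel_potential h r rb)%E.
Proof.
rewrite /rel_potential; case: ifPn => // /andP[r0]; rewrite le_eqVlt.
move=> /predU1P[<-|rb0]; last first.
  by rewrite dpotential_gt0 // -EFinM -!EFinB lee_fin h_convex.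
rewrite subr0; move: r0; rewrite le_eqVlt => /predU1P[<-|r0].
  by rewrite mule0 sube0 -EFinB subrr.
have := dpotential0_chord r0; case: (dpotential h 0) => [l| |].
- by rewrite -EFinM -!EFinB !lee_fin; lra.
- by rewrite gt0_mulye // lte_fin.
- by rewrite gt0_mulNye ?lte_fin //= addey.
Qed.

End potential.

Section flux_bound.
Context {R : realType}.
Local Notation mu := (@lebesgue_measure R).
Variables (p h : R -> R).
Hypothesis plaw : pressure_law p.
Hypothesis hpot : internal_potential p h.
Local Notation h1 := (derive1 h).
Local Notation h2 := (derive1 (derive1 h)).

Let der_h := der_h hpot.
Let der_h1 := der_h1 hpot.
Let der_p := der_p plaw.
Let pE := pE hpot.
Let dpE := dpE hpot.
Let h2_gt0 := h2_gt0 plaw hpot.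
Let h1_lt := h1_lt plaw hpot.
Let h1_le := h1_le plaw hpot.
Let h_mvt := h_mvt hpot.
Let h_convex := h_convex plaw hpot.

Definition rel (rb a r : R) := h r - h rb - a * (r - rb).

Lemma h2_bounded (a b : R) : 0 < a -> a <= b ->
  exists2 L : R, 0 <= L & forall x, a <= x <= b -> h2 x <= L.
Proof.
move=> a0 ab; case: hpot => _ _ h2c _.
have [|L L0 HL] := @bounded_on_segment R h2 a b ab.
  apply: continuous_in_subspaceT => x; rewrite inE /= in_itv /= => /andP[ax _].
  by apply: h2c; exact: lt_le_trans ax.
by exists L => // x /HL; apply: le_trans; exact: ler_norm.
Qed.

(** Near the reference state the squared increment of [h'] is controlled by
    the relative potential: both vanish there to second order, and the
    difference below is monotone on each side. *)
Lemma slope_sq_le (rb a b L : R) : 0 < a -> a <= rb -> rb <= b ->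
  (forall x, a <= x <= b -> h2 x <= L) ->
  forall r, a <= r <= b -> (h1 r - h1 rb) ^+ 2 <= 2 * L * rel rb (h1 rb) r.
Proof.
move=> a0 arb rbb HL r /andP[ar rb_].
pose G x := 2 * L * rel rb (h1 rb) x - (h1 x - h1 rb) * (h1 x - h1 rb).
pose dG x := 2 * (L - h2 x) * (h1 x - h1 rb).
have Gd (x : R) : 0 < x -> is_derive x 1 G (dG x).
  move=> x0.
  have d1 := der_sub (der_h1 x0) (der_cst (h1 rb) x).
  have d2 := der_mul (der_cst (h1 rb) x) (der_sub (der_id x) (der_cst rb x)).
  have d3 := der_sub (der_sub (der_h x0) (der_cst (h rb) x)) d2.
  have d4 := der_sub (der_mul (der_cst (2 * L) x) d3) (der_mul d1 d1).
  by apply: is_derive_eq d4 _; rewrite /dG; ring.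
have G0 : G rb = 0 by rewrite /G /rel !subrr; ring.
suff : 0 <= G r by rewrite /G -expr2 subr_ge0.
have [rrb|rrb|->] := ltgtP r rb; last by rewrite G0.
- have [|c /andP[rc cb] e] := @mvt_der _ G dG _ _ rrb.
    by move=> x /andP[rx _]; apply: Gd; rewrite (lt_le_trans a0) // (le_trans ar).
  have hc : h1 c <= h1 rb by apply: h1_le; [rewrite (lt_trans _ rc) // (lt_le_trans a0)|exact: ltW].
  have Lc : h2 c <= L by apply: HL; apply/andP; split; lra.
  have : dG c * (rb - r) <= 0.
    apply: mulr_le0_ge0; last by rewrite subr_ge0 ltW.
    by apply: mulr_ge0_le0; [rewrite mulr_ge0 // subr_ge0|rewrite subr_le0].
  by rewrite -e G0 sub0r oppr_le0.
- have [|c /andP[rc cb] e] := @mvt_der _ G dG _ _ rrb.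
    by move=> x /andP[rx _]; apply: Gd; rewrite (lt_le_trans a0) // (le_trans arb).
  have hc : h1 rb <= h1 c by apply: h1_le; [exact: lt_le_trans arb|exact: ltW].
  have Lc : h2 c <= L by apply: HL; apply/andP; split; lra.
  have : 0 <= dG c * (r - rb).
    apply: mulr_ge0; last by rewrite subr_ge0 ltW.
    by apply: mulr_ge0; [rewrite mulr_ge0 // subr_ge0|rewrite subr_ge0].
  by rewrite -e G0 subr0.
Qed.

Lemma rel_ge0 (rb r : R) : 0 < rb -> 0 <= r -> 0 <= rel rb (h1 rb) r.
Proof. by move=> rb0 r0; exact: h_convex. Qed.

(** Momentum times the increment of [h'] is a quadratic error: by Young's
    inequality near the reference state, and by the boundedness of [r h'(r)]
    where the relative potential is bounded from below. *)
Lemma flux_bound_pos (rb M : R) : 0 < rb -> 0 < M ->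
  exists2 C : R, 0 <= C & forall r m, 0 < r -> r <= M -> `|m| <= M * r ->
    `|m * (h1 r - h1 rb)| <= C * (m ^+ 2 / r + rel rb (h1 rb) r).
Proof.
move=> rb0 M0; pose b := Num.max M rb.
have bM : M <= b by rewrite le_max lexx.
have brb : rb <= b by rewrite le_max lexx orbT.
have a0 : 0 < rb / 2 by lra.
have arb : rb / 2 <= rb by lra.
have [L L0 HL] := h2_bounded a0 (le_trans arb brb).
have [|B B0 HB] := @bounded_on_segment R (fun r => p r + h r - h1 rb * r) 0 (rb / 2) (ltW a0).
  have hc := h_cont hpot (b := rb / 2) (lexx 0); have pc := p_cont plaw (b := rb / 2) (lexx 0).
  move=> x; apply: cvgB; first by apply: cvgD; [exact: pc|exact: hc].
  apply: cvgM; first exact: cvg_cst.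
  by apply: continuous_subspaceT => y; exact: cvg_id.
pose d := rel rb (h1 rb) (rb / 2).
have d0 : 0 < d.
  have [|c /andP[c1 c2] e] := h_mvt (ltW a0) (y := rb); first by lra.
  have h1c : h1 c < h1 rb by apply: h1_lt => //; lra.
  have : h1 c * (rb - rb / 2) < h1 rb * (rb - rb / 2) by rewrite ltr_pM2r //; lra.
  by rewrite -e /d /rel; lra.
have C10 : 0 <= M * B / d by rewrite divr_ge0 ?mulr_ge0 // ltW.
have ML0 : 0 <= M * L by rewrite mulr_ge0 // ltW.
exists (M * B / d + 1 + M * L); first lra.
move=> r m r0 rM mM.
have rel0 := rel_ge0 rb0 (ltW r0).
have mr0 : 0 <= m ^+ 2 / r by rewrite divr_ge0 ?sqr_ge0 // ltW.
have [rlt|rge] := ltP r (rb / 2).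
  have reld : d <= rel rb (h1 rb) r.
    have := h_convex (ltW r0) a0.
    have : 0 <= (h1 (rb / 2) - h1 rb) * (r - rb / 2).
      rewrite mulr_le0 ?subr_le0 //; last exact: ltW.
      by apply: h1_le => //; lra.
    by rewrite /d /rel; lra.
  apply: (@le_trans _ _ (M * B / d * rel rb (h1 rb) r)); last first.
    rewrite -subr_ge0.
    have -> : (M * B / d + 1 + M * L) * (m ^+ 2 / r + rel rb (h1 rb) r) -
      M * B / d * rel rb (h1 rb) r =
      (M * B / d + 1 + M * L) * (m ^+ 2 / r) + (1 + M * L) * rel rb (h1 rb) r by ring.
    by apply: addr_ge0; apply: mulr_ge0 => //; lra.
  apply: (@le_trans _ _ (M * B)); last first.
    rewrite -[leRHS]mulrA; apply: ler_peMr; first by rewrite mulr_ge0 // ltW.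
    by rewrite mulrC ler_pdivlMr // mul1r.
  rewrite normrM.
  apply: (@le_trans _ _ (M * r * `|h1 r - h1 rb|)); first by rewrite ler_wpM2r.
  rewrite -mulrA ler_pM2l // -{1}(gtr0_norm r0) -normrM.
  have -> : r * (h1 r - h1 rb) = p r + h r - h1 rb * r by rewrite pE //; ring.
  by apply: HB; rewrite !ltW.
have Hs := slope_sq_le a0 arb brb HL; have {}Hs := Hs r.
have {}Hs : (h1 r - h1 rb) ^+ 2 <= 2 * L * rel rb (h1 rb) r.
  by apply: Hs; rewrite rge (le_trans rM bM).
have young : 2 * `|m * (h1 r - h1 rb)| <= m ^+ 2 / r + r * (h1 r - h1 rb) ^+ 2.
  rewrite normrM; set k := h1 r - h1 rb; rewrite -(real_normK (num_real m)) -(real_normK (num_real k)).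
  rewrite -subr_ge0.
  have -> : `|m| ^+ 2 / r + r * `|k| ^+ 2 - 2 * (`|m| * `|k|) = (`|m| - r * `|k|) ^+ 2 / r.
    by field; rewrite gt_eqF.
  by rewrite divr_ge0 ?sqr_ge0 // ltW.
have rk : r * (h1 r - h1 rb) ^+ 2 <= M * (2 * L * rel rb (h1 rb) r).
  by rewrite ler_pM ?sqr_ge0 // ltW.
have h3 : 0 <= M * B / d * (m ^+ 2 / r + rel rb (h1 rb) r) by apply: mulr_ge0 => //; exact: addr_ge0.
have h4 : 0 <= M * L * (m ^+ 2 / r) by exact: mulr_ge0.
rewrite !mulrDl mul1r [M * L * (_ + _)]mulrDr; lra.
Qed.

(** The integrability of [p / z^2], the derivative of [h / z], bounds [h / z]
    near the vacuum. The growth condition makes [c h / z - h'] nondecreasing,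
    which bounds [h'] from below and, compared with the limit at the vacuum,
    gives the last estimate. *)
Lemma vacuum_slope : vacuum_condition p ->
  exists2 a : R, dpotential h 0 = a%:E &
  exists2 c : R, 0 < c & forall r, 0 < r -> r * (h1 r - a) <= c * rel 0 a r.
Proof.
move=> [[c c0 Hc] Hint].
have pd z : 0 < z -> 0 < derive1 p z by case: plaw => _ _ _; exact.
have p0 z : 0 < z -> 0 < p z.
  move=> z0; have := lt_le_trans (pd z z0) (Hc z z0).
  by rewrite pmulr_rgt0 // pmulr_lgt0 ?invr_gt0.
pose B z := h z / z; pose A z := c * B z - h1 z.
have dB (z : R) : 0 < z -> is_derive z 1 B (p z / z ^+ 2).
  move=> z0; have z1 : z != 0 by rewrite gt_eqF.
  apply: is_derive_eq (der_mul (der_h z0) (der_inv z1)) _.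
  by rewrite pE //; field.
have dA (z : R) : 0 < z -> is_derive z 1 A (c * (p z / z ^+ 2) - h2 z).
  move=> z0; apply: is_derive_eq (der_sub (der_mul (der_cst c z) (dB z z0)) (der_h1 z0)) _.
  by rewrite mulr0 addr0.
have A_le x y : 0 < x -> x <= y -> A x <= A y.
  move=> x0; rewrite le_eqVlt => /predU1P[->//|xy].
  have dA' (z : R) (H : x <= z <= y) := dA z (lt_le_trans x0 (proj1 (andP H))).
  have [d /andP[xd _] e] := mvt_der xy dA'.
  rewrite -subr_ge0 e mulr_ge0 ?subr_ge0 //; last exact: ltW.
  have d0 : 0 < d by exact: lt_trans xd.
  have := Hc d d0; rewrite dpE // -(ler_pM2l d0).
  by have -> : d * (c * (p d / d ^+ 2)) = c * (p d / d) by field; rewrite gt_eqF.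
have B_le x y : 0 < x -> x <= y -> B x <= B y.
  move=> x0; rewrite le_eqVlt => /predU1P[->//|xy].
  have dB' (z : R) (H : x <= z <= y) := dB z (lt_le_trans x0 (proj1 (andP H))).
  have [d /andP[xd _] e] := mvt_der xy dB'.
  rewrite -subr_ge0 e mulr_ge0 ?subr_ge0 //; last exact: ltW.
  by rewrite divr_ge0 ?sqr_ge0 // ltW // p0 // (lt_trans x0).
pose I := fine (\int[mu]_(z in `]0%R, 1%R[) (p z / z ^+ 2)%:E).
have q0 z : `]0%R, 1%R[%classic z -> (0 <= (p z / z ^+ 2)%:E)%E.
  by rewrite /= in_itv /= => /andP[z0 _]; rewrite lee_fin divr_ge0 ?sqr_ge0 // ltW // p0.
have qc z : 0 < z -> {for z, continuous (fun z => p z / z ^+ 2)}.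
  move=> z0; have z1 : z != 0 by rewrite gt_eqF.
  have pz : {for z, continuous p}.
    exact: der_continuous (der_p z0).
  apply: cvgM => //; apply: cvgV; first by rewrite expf_neq0.
  by apply: cvgM; exact: cvg_id.
have B_lb z : 0 < z -> z < 1 -> B 1 - B z <= I.
  move=> z0 z1.
  have e : (\int[mu]_(x in `[z, 1%R]) (p x / x ^+ 2)%:E = (B 1)%:E - (B z)%:E)%E.
    apply: continuous_FTC2 => //.
    - apply: continuous_in_subspaceT => x; rewrite inE /= in_itv /= => /andP[zx _].
      by apply: qc; exact: lt_le_trans zx.
    - have Bd x : 0 < x -> derivable B x 1.
        by move=> x0; exact: der_derivable (dB x x0).
      have Bc x : 0 < x -> {for x, continuous B}.
        by move=> x0; apply/differentiable_continuous/derivable1_diffP; exact: Bd.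
      split.
      + by move=> x; rewrite in_itv /= => /andP[zx _]; apply: Bd; exact: lt_trans zx.
      + by apply: cvg_at_right_filter; exact: Bc.
      + by apply: cvg_at_left_filter; exact: Bc.
    - by move=> x; rewrite in_itv /= => /andP[zx _]; exact: der_derive1 (dB x (lt_trans z0 zx)).
  rewrite -lee_fin EFinB -e /I fineK; last first.
    by rewrite ge0_fin_numE // integral_ge0.
  have mq (b : itv_bound R) : (BRight (0 : R) <= b)%O ->
      measurable_fun [set` Interval b (BLeft (1 : R))] (fun x => (p x / x ^+ 2)%:E).
    move=> b0; have m01 : measurable_fun (`]0, 1[ : set R) (fun x => (p x / x ^+ 2)%:E).
      apply/measurable_EFinP; apply: open_continuous_measurable_fun; first exact: interval_open.
      by move=> x; rewrite inE /= in_itv /= => /andP[x0 _]; exact: qc.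
    apply: measurable_funS m01; first exact: measurable_itv.
    exact: subset_itvr.
  rewrite -integral_itv_bndo_bndc; last by apply: mq; rewrite bnd_simp.
  apply: ge0_subset_integral => //; first by apply: mq; rewrite bnd_simp.
  by apply: subset_itvr; rewrite bnd_simp.
have h00 : h 0 = 0.
  have hc : h z @[z --> 0^'+] --> h 0.
    by have /(continuous_within_itvP _ ltr01)[_ + _] := h_cont hpot (lexx 0) (b := 1).
  apply: (cvg_unique _ hc) => //.
  pose K := `|B 1| + `|B 1 - I|.
  have K0 : 0 < K + 1 by rewrite ltr_wpDl // addr_ge0.
  apply/cvgr0Pnorm_le => e e0; near=> z.
  have z0 : 0 < z by near: z; exact: nbhs_right_gt.
  have z1 : z < 1 by near: z; exact: nbhs_right_lt.
  have ze : z <= e / (K + 1) by near: z; apply: nbhs_right_le; exact: divr_gt0.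
  have hz : h z = z * B z by rewrite /B mulrC divfK // gt_eqF.
  have Bz : `|B z| <= K.
    have u := B_le _ _ z0 (ltW z1); have l := B_lb _ z0 z1.
    have := ler_norm (B 1); have := ler_norm (- (B 1 - I)); rewrite normrN => n1 n2.
    have n3 := normr_ge0 (B 1); have n4 := normr_ge0 (B 1 - I).
    by rewrite ler_norml /K; apply/andP; split; lra.
  rewrite hz normrM gtr0_norm //.
  move: ze; rewrite ler_pdivlMr // => ze.
  by apply: le_trans ze; rewrite ler_pM2l //; lra.
have Lcv := dpotential0_cvg plaw hpot.
have [a aE] : exists a, dpotential h 0 = a%:E.
  have lb : ((c * (B 1 - I) - A 1)%:E <= dpotential h 0)%E.
    rewrite -(cvg_lim _ Lcv) //; apply: lime_ge; first exact: cvgP Lcv.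
    near=> z.
    have z0 : 0 < z by near: z; exact: nbhs_right_gt.
    have z1 : z < 1 by near: z; exact: nbhs_right_lt.
    have := A_le _ _ z0 (ltW z1); have := B_lb _ z0 z1; rewrite lee_fin /A => b1 b2.
    have : c * (B 1 - I) <= c * B z by rewrite ler_pM2l //; lra.
    lra.
  have := dpotential0_le plaw hpot (@ltr01 R).
  by move: lb; case: (dpotential h 0) => // r _ _; exists r.
exists a => //; exists c => // r r0.
have h1a z : 0 < z -> a <= h1 z.
  by move=> z0; have := dpotential0_le plaw hpot z0; rewrite aE lee_fin.
have Ba z : 0 < z -> a <= B z.
  move=> z0; have [d /andP[d0 _]] := h_mvt (lexx 0) z0.
  rewrite h00 !subr0 => e; rewrite /B e mulfK ?gt_eqF //; exact: h1a.
have hcv : h1 z @[z --> 0^'+] --> a by rewrite aE in Lcv; exact: fine_cvg Lcv.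
have key : c * a - a <= A r.
  have cv : c * a - h1 z @[z --> 0^'+] --> c * a - a by apply: cvgB => //; exact: cvg_cst.
  rewrite -(cvg_lim _ cv) //; apply: limr_le; first exact: cvgP cv.
  near=> z.
  have z0 : 0 < z by near: z; exact: nbhs_right_gt.
  have zr : z <= r by near: z; exact: nbhs_right_le.
  apply: le_trans (A_le _ _ z0 zr); rewrite /A lerD2r ler_pM2l //; exact: Ba.
have key2 : h1 r - a <= c * (B r - a) by move: key; rewrite /A; lra.
have key3 : r * (h1 r - a) <= r * (c * (B r - a)) by rewrite ler_pM2l.
apply: (le_trans key3).
rewrite /rel h00 !subr0 /B le_eqVlt; apply/orP; left; apply/eqP.
by field; rewrite gt_eqF.
Unshelve. all: by end_near. Qed.

Lemma flux_bound_vacuum (a c M : R) : 0 < M -> 0 < c ->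
  (forall r, 0 < r -> r * (h1 r - a) <= c * rel 0 a r) ->
  (forall r, 0 < r -> a <= h1 r) ->
  forall r m, 0 < r -> `|m| <= M * r ->
    `|m * (h1 r - a)| <= M * c * (m ^+ 2 / r + rel 0 a r).
Proof.
move=> M0 c0 H Ha r m r0 mM; rewrite normrM (ger0_norm (_ : 0 <= h1 r - a)); last first.
  by rewrite subr_ge0 Ha.
apply: (@le_trans _ _ (M * r * (h1 r - a))); first by rewrite ler_wpM2r // subr_ge0 Ha.
rewrite -!mulrA ler_pM2l //; apply: le_trans (H r r0) _.
have mr0 : 0 <= m ^+ 2 / r by rewrite divr_ge0 ?sqr_ge0 // ltW.
by rewrite ler_pM2l //; lra.
Qed.

(** The two admissible reference densities have in common a finite slope and
    a control of the entropy flux by the relative entropy. *)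
Lemma reference_slope (rb : R) : 0 < rb \/ rb = 0 /\ vacuum_condition p ->
  exists2 a : R, dpotential h rb = a%:E &
  [/\ 0 <= rb, forall r, 0 <= r -> 0 <= rel rb a r &
   forall M, 0 < M -> exists2 C : R, 0 <= C &
     forall r m, 0 < r -> r <= M -> `|m| <= M * r ->
     `|m * (h1 r - a)| <= C * (m ^+ 2 / r + rel rb a r)].
Proof.
move=> [rb0|[-> vac]].
  exists (h1 rb); first exact: dpotential_gt0.
  split; [exact: ltW|by move=> r; exact: rel_ge0|].
  by move=> M M0; have [C C0 HC] := flux_bound_pos rb0 M0; exists C.
have [a aE [c c0 H]] := vacuum_slope vac; exists a => //; split => //.
  move=> r r0; have := rel_potential_ge0 plaw hpot r 0.
  by rewrite /rel_potential r0 lexx /= aE -EFinM -!EFinB lee_fin.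
move=> M M0; exists (M * c); first by rewrite mulr_ge0 // ltW.
move=> r m r0 _; apply: flux_bound_vacuum => //.
by move=> z z0; have := dpotential0_le plaw hpot z0; rewrite aE lee_fin.
Qed.

End flux_bound.

(** * Total derivatives and the constant state *)

Section ftc_compact.
Context {R : realType}.
Local Notation mu := (@lebesgue_measure R).
Local Notation mu2 := (@lebesgue_measure R \x @lebesgue_measure R)%E.
Local Notation T2 := (measurableTypeR R * measurableTypeR R)%type.

Lemma ftc_itv (f df : R -> R) (a b : R) : a < b ->
  (forall x : R, is_derive x 1 f (df x)) -> continuous df ->
  (\int[mu]_(x in `[a, b]) (df x)%:E = (f b - f a)%:E)%E.
Proof.
move=> ab fd dfc; rewrite EFinB.
have fc x : {for x, continuous f}.
  exact: der_continuous (fd x).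
apply: continuous_FTC2 => //.
- exact: continuous_subspaceT.
- split.
  + by move=> x _; exact: der_derivable (fd x).
  + by apply: cvg_at_right_filter; exact: fc.
  + by apply: cvg_at_left_filter; exact: fc.
- by move=> x _; exact: der_derive1 (fd x).
Qed.

Lemma integral_restrict_itv (f : R -> \bar R) (D E : set R) :
  D `<=` E -> (forall x, E x -> ~ D x -> f x = 0%E) ->
  (\int[mu]_(x in E) f x = \int[mu]_(x in D) f x)%E.
Proof.
move=> DE f0; rewrite [LHS]integral_mkcond [RHS]integral_mkcond; apply: eq_integral => x _.
rewrite !patchE; case: ifPn => [|xE]; case: ifPn => //.
  by rewrite notin_setE => xD; rewrite inE => xE; rewrite f0.
by rewrite inE => /DE xE'; rewrite mem_set in xE.
Qed.

Lemma ftc_half_line (f df : R -> R) (T : R) :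
  (forall x : R, is_derive x 1 f (df x)) -> continuous df ->
  (forall x, T < x -> f x = 0) ->
  (\int[mu]_(x in `[0%R, +oo[) (df x)%:E = (- f 0%R)%:E)%E.
Proof.
move=> fd dfc fT; pose T' := `|T| + 1.
have T0 : 0 < T' by rewrite ltr_wpDl.
have TT : T < T' by rewrite (le_lt_trans (ler_norm _)) // ltrDl.
have df0 x : T < x -> df x = 0.
  move=> Tx; have d0 : is_derive x 1 f 0.
    apply: near_eq_is_derive (der_cst 0 x).
    by near=> y; rewrite fT //; near: y; exact: lt_nbhsr.
  by rewrite -(der_derive1 (fd x)) (der_derive1 d0).
rewrite (@integral_restrict_itv _ `[0, T']); last 2 first.
- by apply: subset_itvl.
- move=> x /=; rewrite !in_itv /= andbT => -> /= /negP; rewrite -ltNge => T'x.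
  by rewrite df0 //; exact: lt_trans T'x.
by rewrite (@ftc_itv f) // fT // sub0r.
Unshelve. all: by end_near. Qed.

Lemma ftc_line (f df : R -> R) (T : R) :
  (forall x : R, is_derive x 1 f (df x)) -> continuous df ->
  (forall x, T < `|x| -> f x = 0) ->
  (\int[mu]_x (df x)%:E = 0)%E.
Proof.
move=> fd dfc fT; pose T' := `|T| + 1.
have T0 : 0 < T' by rewrite ltr_wpDl.
have TT : T < T' by rewrite (le_lt_trans (ler_norm _)) // ltrDl.
have nb (x : R) : T < `|x| -> \forall y \near x, T < `|y|.
  by move=> Tx; apply: (cvgr_gt _ (cvg_norm (@cvg_id _ (nbhs x)))).
have df0 x : T < `|x| -> df x = 0.
  move=> Tx; have d0 : is_derive x 1 f 0.
    apply: near_eq_is_derive (der_cst 0 x).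
    by apply: filterS (nb x Tx) => y /fT ->.
  by rewrite -(der_derive1 (fd x)) (der_derive1 d0).
rewrite (@integral_restrict_itv _ `[- T', T']) //; last first.
  move=> x _ /=; rewrite in_itv /= -ler_norml => /negP; rewrite -ltNge => T'x.
  by rewrite df0 //; exact: lt_trans T'x.
rewrite (@ftc_itv f) //; last lra.
by rewrite !fT ?subrr // ?normrN gtr0_norm.
Qed.

Lemma half_plane_section2 (f : R * R -> \bar R) y :
  (\int[mu]_t (f \_ (half_plane R)) (t, y) = \int[mu]_(t in `[0%R, +oo[) f (t, y))%E.
Proof.
rewrite [RHS]integral_mkcond; apply: eq_integral => t _; rewrite !patchE.
congr (if _ then _ else _).
by apply/idP/idP; rewrite !inE /half_plane /= in_itv /= andbT.
Qed.

Lemma fubini_half_plane2 (f : R * R -> \bar R) :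
  mu2.-integrable (half_plane R) f ->
  (\int[mu2]_(x in half_plane R) f x =
   \int[mu]_y \int[mu]_(t in `[0%R, +oo[) f (t, y))%E.
Proof.
move=> /(integrable_mkcond _ measurable_half_plane) fi.
rewrite integral_mkcond -(integral21_prod_meas1 fi).
by apply: eq_integral => y _; exact: half_plane_section2.
Qed.

(** The constant density [1] at rest solves the scaled mass equation, because
    the integrand is the difference of an exact derivative in time and one in
    space. *)
Lemma constant_state (chi chit chiy : R * R -> R) (T : R) : 0 <= T ->
  (forall t y : R, is_derive t 1 (fun s => chi (s, y)) (chit (t, y))) ->
  (forall t y : R, is_derive y 1 (fun z => chi (t, z)) (chiy (t, y))) ->
  (forall y, continuous (fun s => chit (s, y))) ->
  (forall t, continuous (fun z => chiy (t, z))) ->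
  (forall t, continuous (fun z => chi (t, z))) ->
  (forall x, 0 <= x.1 -> T < x.1 \/ T < `|x.2| -> chi x = 0) ->
  mu2.-integrable (half_plane R) (fun x => (chit x)%:E) ->
  mu2.-integrable (half_plane R) (fun x => (chiy x * (x.2 / 2) + 2^-1 * chi x)%:E) ->
  (\int[mu2]_(x in half_plane R)
     (- chit x + chiy x * (x.2 / 2) + 2^-1 * chi x)%:E =
   \int[mu]_y (chi (0%R, y))%:E)%E.
Proof.
move=> T0 dt dy ct cy c0 supp it iy.
have -> : (\int[mu2]_(x in half_plane R)
     (- chit x + chiy x * (x.2 / 2) + 2^-1 * chi x)%:E =
   \int[mu2]_(x in half_plane R)
     ((fun x => (chiy x * (x.2 / 2) + 2^-1 * chi x)%:E) \- (fun x => (chit x)%:E)) x)%E.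
  apply: eq_integral => x _ /=; rewrite -EFinB; congr EFin; ring.
rewrite integralB //.
have -> : (\int[mu2]_(x in half_plane R) (chit x)%:E = - \int[mu]_y (chi (0%R, y))%:E)%E.
  rewrite (fubini_half_plane2 it).
  rewrite -integralN; last first.
    have h : mu.-integrable setT (EFin \o (fun y => chi (0, y))).
      apply: (@integrable_cts_supp _ _ T); [exact: measurableT|exact: c0|].
      by move=> y Ty; apply: supp => //=; right.
    exact: integrable_add_def h.
  apply: eq_integral => y _ /=.
  rewrite (@ftc_half_line (fun s => chi (s, y)) _ T) // => s Ts.
  by apply: supp => /=; [exact: le_trans (ltW Ts)|left].
rewrite oppeK -[RHS]add0e; congr (_ + _)%E.
have [_ _ ->] := fubini_half_plane iy.
rewrite integral0_eq // => t; rewrite /= in_itv /= andbT => t0.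
apply: (@ftc_line (fun y => chi (t, y) * (y / 2)) _ T).
- move=> y; have dy2 := der_mul (der_id y) (der_cst (2^-1) y).
  apply: is_derive_eq (der_mul (dy t y) dy2) _ => /=; ring.
- move=> y; apply: cvgD; last by apply: cvgM; [exact: cvg_cst|exact: c0].
  apply: cvgM; first exact: cy.
  by apply: cvgM; [exact: cvg_id|exact: cvg_cst].
- by move=> y Ty; rewrite supp ?mul0r //=; right.
Qed.

End ftc_compact.

Section measurability.
Context {R : realType}.

Lemma measurable_fun_ge0_ext (f : R -> R) (g : R -> \bar R) :
  {within `[0, +oo[, continuous f} ->
  (forall r, 0 <= r -> g r = (f r)%:E) -> (forall r, r < 0 -> g r = +oo%E) ->
  measurable_fun (setT : set R) g.
Proof.
move=> fc gf gy.
rewrite (_ : g = fun r => if 0 <= r then (f r)%:E else +oo%E); last first.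
  by apply/funext => r; case: ifPn => [/gf//|]; rewrite -ltNge => /gy.
apply: measurable_fun_if => //; first exact: measurable_fun_ler.
have mf : measurable_fun (`[0, +oo[ : set R) f.
  by apply: subspace_continuous_measurable_fun.
apply/measurable_EFinP; apply: measurable_funS mf => //.
by move=> r /= [_]; rewrite in_itv /= andbT.
Qed.

Lemma measurable_fun_gt0_cst (f : R -> R) (g : R -> \bar R) (c : \bar R) :
  (forall r, 0 < r -> {for r, continuous f}) ->
  (forall r, 0 < r -> g r = (f r)%:E) -> (forall r, r <= 0 -> g r = c) ->
  measurable_fun (setT : set R) g.
Proof.
move=> fc gf gy.
rewrite (_ : g = fun r => if 0 < r then (f r)%:E else c); last first.
  by apply/funext => r; case: ifPn => [/gf//|]; rewrite -leNgt => /gy.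
apply: measurable_fun_if => //; first exact: measurable_fun_ltr.
have mf : measurable_fun (`]0, +oo[ : set R) f.
  apply: open_continuous_measurable_fun; first exact: interval_open.
  by move=> r; rewrite inE /= in_itv /= andbT; exact: fc.
apply/measurable_EFinP; apply: measurable_funS mf => //.
by move=> r /= [_]; rewrite in_itv /= andbT.
Qed.

Lemma measurable_fun_invr : measurable_fun (setT : set R) (fun r : R => r^-1).
Proof.
rewrite (_ : (fun r => _) = fun r : R => if r == 0 then 0 else r^-1); last first.
  by apply/funext => r; case: eqP => // ->; rewrite invr0.
have mf : measurable_fun (~` [set (0 : R)]) (fun r : R => r^-1).
  apply: open_continuous_measurable_fun; first exact/closed_openC/closed_eq.
  by move=> r; rewrite inE /= => /eqP r0; exact: inv_continuous.
apply: measurable_fun_if => //; first exact: measurable_fun_eqr.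
apply: measurable_funS mf => //; first exact: measurableC.
by move=> r /= [_ /eqP].
Qed.

End measurability.

(** * Relative entropy *)

Section sections_of_functions.
Context {R : realType}.
Local Notation mu := (@lebesgue_measure R).
Local Notation mu2 := (@lebesgue_measure R \x @lebesgue_measure R)%E.
Local Notation T2 := (measurableTypeR R * measurableTypeR R)%type.

Lemma measurable_section (f : R * R -> \bar R) t : 0 <= t ->
  measurable_fun (half_plane R : set T2) f ->
  measurable_fun (setT : set R) (fun y => f (t, y)).
Proof.
move=> t0 mf.
have mf' : measurable_fun (setT : set T2) (f \_ (half_plane R)).
  by apply/(measurable_restrictT _ _).1.
have : measurable_fun setT ((f \_ (half_plane R)) \o (pair t : measurableTypeR R -> T2)).
  by apply: measurableT_comp => //; exact: measurable_pair1.
congr (measurable_fun _ _); apply/funext => y /=.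
by rewrite patchE mem_set.
Qed.

Lemma measurable_fst_comp (f : R -> R) (D : set T2) : continuous f ->
  measurable_fun D (fun x : T2 => f x.1).
Proof.
move=> cf; apply: measurable_funTS; apply: measurableT_comp => //.
exact: continuous_measurable_fun.
Qed.

Lemma measurable_snd_comp (f : R -> R) (D : set T2) : continuous f ->
  measurable_fun D (fun x : T2 => f x.2).
Proof.
move=> cf; apply: measurable_funTS; apply: measurableT_comp => //.
exact: continuous_measurable_fun.
Qed.

End sections_of_functions.

Section relative_entropy.
Context {R : realType}.
Implicit Types (h : R -> R) (t r m rb : R).

(** With reference momentum [0] the conventions for [0/0] in the two forms of
    the kinetic energy agree. *)
Lemma rel_kinetic0 r m rb : rel_kinetic r m rb 0 = sq_over m r.
Proof.
rewrite /rel_kinetic /sq_over eqxx andbF orbF mul0r subr0.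
have [->|r0] /= := eqVneq r 0; first by case: eqP => //= _; rewrite mul0r.
rewrite real_normK ?num_real // expr_div_n; congr EFin; by field.
Qed.

Lemma rel_entropy0 h t r m rb :
  rel_entropy h t r m rb 0 =
  ((expR (- t) / 2)%:E * sq_over m r + rel_potential h r rb)%E.
Proof. by rewrite /rel_entropy rel_kinetic0. Qed.

Lemma sq_over_ge0 m r : 0 <= r -> (0 <= sq_over m r)%E.
Proof.
rewrite /sq_over; case: ifPn => [_ _|_ r0]; first by case: ifP; rewrite ?leey.
by rewrite lee_fin divr_ge0 ?sqr_ge0.
Qed.

Lemma sq_over_norm m r : sq_over `|m| r = sq_over m r.
Proof. by rewrite /sq_over normr_eq0 real_normK ?num_real. Qed.

Lemma rel_entropy_ge0 p h t r m rb : pressure_law p -> internal_potential p h ->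
  (0 <= rel_entropy h t r m rb 0)%E.
Proof.
move=> pl hp; rewrite rel_entropy0; have [r0|r0] := leP 0 r.
  apply: adde_ge0; last exact: rel_potential_ge0 pl hp _ _.
  by apply: mule_ge0; [rewrite lee_fin divr_ge0 ?expR_ge0|exact: sq_over_ge0].
rewrite /rel_potential (leNgt 0 r) r0 /= /sq_over lt_eqF //.
by rewrite -EFinM addey.
Qed.

Lemma rel_potentialE h r rb (a : R) : 0 <= r -> 0 <= rb -> dpotential h rb = a%:E ->
  rel_potential h r rb = (h r - h rb - a * (r - rb))%:E.
Proof. by move=> r0 rb0 e; rewrite /rel_potential r0 rb0 e -EFinM -!EFinB. Qed.

Lemma rel_potential_lt0 h r rb : r < 0 -> rel_potential h r rb = +oo%E.
Proof. by move=> r0; rewrite /rel_potential (leNgt 0 r) r0. Qed.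

Lemma measurable_rel_potential h rb (a : R) : {within `[0, +oo[, continuous h} ->
  0 <= rb -> dpotential h rb = a%:E ->
  measurable_fun (setT : set R) (fun r => rel_potential h r rb).
Proof.
move=> hc rb0 aE.
apply: (@measurable_fun_ge0_ext _ (fun r => h r - h rb - a * (r - rb))).
- have ct (f : R -> R) : continuous f -> {within `[0, +oo[, continuous f}.
    exact: continuous_subspaceT.
  move=> x; apply: cvgB; first apply: cvgB; [exact: hc|exact: cvg_cst|].
  apply: (@ct (fun r => a * (r - rb))) => y; apply: cvgM; first exact: cvg_cst.
  by apply: cvgB; [exact: cvg_id|exact: cvg_cst].
- by move=> r r0; exact: rel_potentialE.
- by move=> r; exact: rel_potential_lt0.
Qed.

End relative_entropy.

Section conclusion.
Context {R : realType}.
Local Notation mu := (@lebesgue_measure R).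
Local Notation mu2 := (@lebesgue_measure R \x @lebesgue_measure R)%E.
Local Notation T2 := (measurableTypeR R * measurableTypeR R)%type.
Variables (alpha rhohat a : R) (p h : R -> R) (rho n : R * R -> R).
Hypothesis alpha_ge0 : 0 <= alpha.
Hypothesis plaw : pressure_law p.
Hypothesis hpot : internal_potential p h.
Hypothesis rhohat_ge0 : 0 <= rhohat.
Hypothesis aE : dpotential h rhohat = a%:E.
Hypothesis mrho : measurable_fun (half_plane R : set T2) rho.
Let sq x := sq_over (n x) (rho x).
Hypothesis msq : measurable_fun (half_plane R : set T2) sq.
Hypothesis rho_ge0 : {ae mu2, forall x, half_plane R x -> 0 <= rho x}.

Definition rel_entropy_at (x : R * R) := rel_entropy h x.1 (rho x) (n x) rhohat 0.

Lemma measurable_rel_entropy_at :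
  measurable_fun (half_plane R : set T2) rel_entropy_at.
Proof.
rewrite /rel_entropy_at; under eq_fun do rewrite rel_entropy0.
apply: emeasurable_funD.
  apply: emeasurable_funM => //; apply/measurable_EFinP.
  apply: (@measurable_fst_comp _ (fun t => expR (- t) / 2)); apply: smooth_cont.
  apply: smoothM; last exact: smooth_cst.
  apply: (@smooth_comp _ _ _ expR); last exact: smooth_expR.
  by apply: smoothN; exact: smooth_id.
case: hpot => hc _ _ _.
exact: (measurableT_comp (measurable_rel_potential hc rhohat_ge0 aE) mrho).
Qed.

Let E t := rel_energy h t (fun y => rho (t, y)) (fun y => n (t, y)) (cst rhohat) (cst 0).
Let D t := (alpha%:E * \int[mu]_y sq^\+ (t, y))%E.

Let mE : measurable_fun `[(0 : R), +oo[ E.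
Proof.
exact: measurable_integral_section measurable_rel_entropy_at.
Qed.

Let msqp : measurable_fun (half_plane R : set T2) sq^\+%E.
Proof. exact: measurable_funepos. Qed.

Let mDp : measurable_fun `[(0 : R), +oo[ (fun t => \int[mu]_y sq^\+ (t, y))%E.
Proof. exact: measurable_integral_section. Qed.

Lemma dissipation_sectionE :
  {ae mu, forall t, 0 <= t -> (\int[mu]_y sq (t, y) = \int[mu]_y sq^\+ (t, y))%E}.
Proof.
have := ae_section rho_ge0; apply: ae_imply => t + t0 => /(_ t0) ht.
apply: ae_eq_integral => //.
- exact: measurable_section.
- exact: measurable_section.
- apply: ae_imply ht => y r0 _.
  by rewrite funeposE; apply/esym/max_idPl; exact: sq_over_ge0.
Qed.

(** Both claims reduce to one inequality, integrated against nonincreasing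
    cutoffs in time, that the two entropy conditions have in common. *)
Lemma decay_conclusion (E0 : R) :
  (forall psi : R -> R, test_function psi ->
    (forall t, 0 <= t -> 0 <= psi t) -> (forall t, 0 <= t -> derive1 psi t <= 0) ->
    (\int[mu]_(t in `[0%R, +oo[) ((expR (t / 2))%:E *
       ((- derive1 psi t)%:E * E t + (psi t)%:E * D t)) <= (psi 0%R * E0)%:E)%E) ->
  {ae mu, forall t, 0 < t -> (E t <= (expR (- (t / 2)))%:E * E0%:E)%E} /\
  {ae mu, forall t, 0 < t ->
     (alpha%:E * \int[mu]_(s in `]t, +oo[)
        \int[mu]_y sq_over `|n (s, y)| (rho (s, y))
      <= (expR (- (t / 2)))%:E * E0%:E)%E}.
Proof.
move=> H.
have E_ge0 t : 0 <= t -> (0 <= E t)%E.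
  by move=> _; apply: integral_ge0 => y _; exact: rel_entropy_ge0 plaw hpot.
have D_ge0 t : 0 <= t -> (0 <= D t)%E.
  by move=> _; rewrite mule_ge0 ?lee_fin // integral_ge0.
have mD : measurable_fun `[(0 : R), +oo[ D by apply: measurable_funeM.
split; first exact: energy_decay mE mD E_ge0 D_ge0 H.
apply/aeW => t t0; apply: le_trans (dissipation_decay mE mD E_ge0 D_ge0 H t0).
have sub : `]t, +oo[ `<=` `[(0 : R), +oo[.
  by move=> s /=; rewrite !in_itv /= !andbT => /(lt_trans t0)/ltW.
rewrite ge0_integralZl_EFin //; last 2 first.
- by move=> s _; exact: integral_ge0.
- exact: measurable_funS mDp.
rewrite le_eqVlt; apply/orP; left; apply/eqP; congr (_ * _)%E.
apply: ae_eq_integral => //.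
- have -> : (fun s => \int[mu]_y sq_over `|n (s, y)| (rho (s, y)))%E =
      (fun s => \int[mu]_y sq (s, y))%E.
    by apply/funext => s; apply: eq_integral => y _; rewrite sq_over_norm.
  by apply: measurable_funS (measurable_integral_section msq).
- exact: measurable_funS mDp.
- apply: ae_imply dissipation_sectionE => s Hs /sub /=; rewrite in_itv /= andbT => s0.
  by rewrite -Hs //; apply: eq_integral => y _; rewrite sq_over_norm.
Qed.

End conclusion.

(** * A cutoff moving inwards *)

Section box_bounds.
Context {R : realType}.
Local Notation T2 := (measurableTypeR R * measurableTypeR R)%type.

Lemma bounded_on_box (f : R * R -> R) (M : R) : continuous f ->
  exists2 C : R, 0 <= C & forall x, `|x.1| <= M -> `|x.2| <= M -> `|f x| <= C.
Proof.
move=> cf; have cK : compact (`[- M, M] `*` `[- M, M] : set (R * R)).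
  by apply: compact_setX; exact: segment_compact.
have : compact (f @` (`[- M, M] `*` `[- M, M])).
  apply: continuous_compact => //; exact: continuous_subspaceT.
move=> /compact_bounded[N [Nr HN]]; exists (`|N| + 1); first by rewrite addr_ge0.
move=> x x1 x2; apply: (HN (`|N| + 1)).
  by rewrite (le_lt_trans (ler_norm _)) // ltrDl.
by exists x => //; split; rewrite /= in_itv /= -ler_norml.
Qed.

Lemma dtimeE (f df : R * R -> R) :
  (forall t y : R, is_derive t 1 (fun s => f (s, y)) (df (t, y))) -> dtime f = df.
Proof.
move=> d; apply/funext => -[t y].
rewrite -(@derive_val _ _ _ _ _ _ _ (d t y)) /dtime /derive.
have -> // : (fun s : R => s^-1 *: (f (s *: (1, 0) + (t, y)) - f (t, y))) =
  (fun s : R => s^-1 *: (f (s *: (1 : R) + t, y) - f (t, y))).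
by apply/funext => s; rewrite [s *: (1, 0) + _](_ : _ = (s *: (1 : R) + t, y)) //;
  congr (_, _); rewrite /= ?scaler0 ?add0r.
Qed.

Lemma dspaceE (f df : R * R -> R) :
  (forall t y : R, is_derive y 1 (fun z => f (t, z)) (df (t, y))) -> dspace f = df.
Proof.
move=> d; apply/funext => -[t y].
rewrite -(@derive_val _ _ _ _ _ _ _ (d t y)) /dspace /derive.
have -> // : (fun s : R => s^-1 *: (f (s *: (0, 1) + (t, y)) - f (t, y))) =
  (fun s : R => s^-1 *: (f (t, s *: (1 : R) + y) - f (t, y))).
by apply/funext => s; rewrite [s *: (0, 1) + _](_ : _ = (t, s *: (1 : R) + y)) //;
  congr (_, _); rewrite /= ?scaler0 ?add0r.
Qed.

Lemma smooth_dtime (f : R * R -> R) : smooth f -> continuous (dtime f).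
Proof. by move=> /(_ 1%N)[_ /(_ (1, 0))]. Qed.

Lemma smooth_dspace (f : R * R -> R) : smooth f -> continuous (dspace f).
Proof. by move=> /(_ 1%N)[_ /(_ (0, 1))]. Qed.

Lemma cont_slice1 (f : R * R -> R) y : continuous f -> continuous (fun s => f (s, y)).
Proof.
move=> cf s; have h : (s', y) @[s' --> s] --> (s, y).
  exact: (@cvg_pair _ _ _ (nbhs s) (nbhs s) (nbhs y) _ _ _ id (fun=> y) cvg_id (cvg_cst y)).
exact: (cvg_comp _ _ h (@cf (s, y))).
Qed.

Lemma cont_slice2 (f : R * R -> R) t : continuous f -> continuous (fun z => f (t, z)).
Proof.
move=> cf z; have h : (t, z') @[z' --> z] --> (t, z).
  exact: (@cvg_pair _ _ _ (nbhs z) (nbhs t) (nbhs z) _ _ _ (fun=> t) id (cvg_cst t) cvg_id).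
exact: (cvg_comp _ _ h (@cf (t, z))).
Qed.

End box_bounds.

Section shrinking_cutoff.
Context {R : realType}.
Local Notation T2 := (measurableTypeR R * measurableTypeR R)%type.
Variables (psi : R -> R) (T k L : R).
Hypothesis tpsi : test_function psi.
Hypothesis psiT : forall t, T < `|t| -> psi t = 0.
Hypothesis T0 : 0 < T.
Hypothesis k0 : 0 <= k.
Hypothesis L0 : 0 <= L.

(** The interval [|y| < k exp(-t/2) - L] moves inwards faster than the drift
    of the scaled equations, with a surplus that absorbs the entropy flux. *)
Definition rad (t : R) : R := k * expR (- (t / 2)) - L.
Definition wedge (x : R * R) : R := ebump (rad x.1 + x.2) * ebump (rad x.1 - x.2).
Definition wedgeP (x : R * R) : R := ebump' (rad x.1 + x.2) * ebump (rad x.1 - x.2).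
Definition wedgeQ (x : R * R) : R := ebump (rad x.1 + x.2) * ebump' (rad x.1 - x.2).

Definition cutoff (x : R * R) : R := expR (x.1 / 2) * psi x.1 * wedge x.
Definition cutoff_t (x : R * R) : R := expR (x.1 / 2) *
  (2^-1 * psi x.1 * wedge x + derive1 psi x.1 * wedge x -
   psi x.1 * (k / 2 * expR (- (x.1 / 2))) * (wedgeP x + wedgeQ x)).
Definition cutoff_y (x : R * R) : R :=
  expR (x.1 / 2) * psi x.1 * (wedgeP x - wedgeQ x).

Let spsi : smooth psi. Proof. exact: test_function_smooth. Qed.

Lemma smooth_rad : smooth rad.
Proof.
apply: smoothB; last exact: smooth_cst.
apply: smoothM; first exact: smooth_cst.
apply: (@smooth_comp _ _ _ expR); last exact: smooth_expR.
by apply: smoothN; apply: smoothM; [exact: smooth_id|exact: smooth_cst].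
Qed.

Lemma der_half (t : R) : is_derive t 1 (fun t : R => t / 2) (2^-1).
Proof. by apply: is_derive_eq (der_mul (der_id t) (der_cst (2^-1) t)) _; rewrite mulr0 add0r mulr1. Qed.

Lemma der_rad (t : R) : is_derive t 1 rad (- (k / 2 * expR (- (t / 2)))).
Proof.
have d := @der_comp _ expR _ _ _ _ (is_derive_expR _) (der_opp (der_half t)).
apply: is_derive_eq (der_sub (der_mul (der_cst k t) d) (der_cst L t)) _.
by ring.
Qed.

Lemma smooth_wedge : smooth wedge.
Proof.
have s1 : smooth (fun x : R * R => rad x.1).
  by apply: (@smooth_comp _ _ fst rad); [exact: smooth_fst|exact: smooth_rad].
apply: smoothM; apply: (@smooth_comp _ _ _ ebump); try exact: smooth_ebump.
  by apply: smoothD => //; exact: smooth_snd.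
by apply: smoothB => //; exact: smooth_snd.
Qed.

Lemma smooth_cutoff : smooth cutoff.
Proof.
apply: smoothM; last exact: smooth_wedge.
apply: smoothM.
  by apply: (@smooth_comp _ _ fst (fun t => expR (t / 2))); [exact: smooth_fst|exact: smooth_exp_half].
by apply: (@smooth_comp _ _ fst psi); [exact: smooth_fst|].
Qed.

Lemma der_cutoff_t (t y : R) : is_derive t 1 (fun s => cutoff (s, y)) (cutoff_t (t, y)).
Proof.
have dr := der_rad t.
have dA := @der_comp _ ebump _ _ _ _ (der_ebump _) (der_add dr (der_cst y t)).
have dB := @der_comp _ ebump _ _ _ _ (der_ebump _) (der_sub dr (der_cst y t)).
have dE := @der_comp _ expR _ _ _ _ (is_derive_expR _) (der_half t).
have dp := derivable_der (smooth_derivable (x := t) spsi).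
apply: is_derive_eq (der_mul (der_mul dE dp) (der_mul dA dB)) _.
rewrite /cutoff_t /wedge /wedgeP /wedgeQ /=; ring.
Qed.

Lemma der_cutoff_y (t y : R) : is_derive y 1 (fun z => cutoff (t, z)) (cutoff_y (t, y)).
Proof.
have dA := @der_comp _ ebump _ _ _ _ (der_ebump _) (der_add (der_cst (rad t) y) (der_id y)).
have dB := @der_comp _ ebump _ _ _ _ (der_ebump _) (der_sub (der_cst (rad t) y) (der_id y)).
apply: is_derive_eq (der_mul (der_cst (expR (t / 2) * psi t) y) (der_mul dA dB)) _.
rewrite /cutoff_y /wedgeP /wedgeQ /=; ring.
Qed.

Lemma dtime_cutoff : dtime cutoff = cutoff_t.
Proof. exact: dtimeE der_cutoff_t. Qed.

Lemma dspace_cutoff : dspace cutoff = cutoff_y.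
Proof. exact: dspaceE der_cutoff_y. Qed.

Definition cutoff_size := T + k * expR (T / 2).

Let size_ge0 : 0 <= k * expR (T / 2).
Proof. by rewrite mulr_ge0 ?expR_ge0. Qed.

Lemma wedge_out (x : R * R) : `|x.1| <= T -> k * expR (T / 2) < `|x.2| ->
  [/\ wedge x = 0, wedgeP x = 0 & wedgeQ x = 0].
Proof.
move=> x1 x2.
have rT : rad x.1 <= k * expR (T / 2).
  rewrite /rad lerBlDr; apply: (@le_trans _ _ (k * expR (T / 2))); last by rewrite lerDl.
  rewrite ler_wpM2l // ler_expR.
  by have := ler_norm (- x.1); rewrite normrN; lra.
move: x2; rewrite ltr_normr /wedge /wedgeP /wedgeQ => /orP[h|h].
  have B0 : rad x.1 - x.2 <= 0 by lra.
  by rewrite (ebump_le0 B0) (ebump'_le0 B0) !mulr0.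
have A0 : rad x.1 + x.2 <= 0 by lra.
by rewrite (ebump_le0 A0) (ebump'_le0 A0) !mul0r.
Qed.

Lemma derive1_out t : T < `|t| -> derive1 psi t = 0.
Proof.
move=> Tt; apply: der_derive1; apply: near_eq_is_derive (der_cst 0 t).
have : \forall y \near t, T < `|y|.
  exact: (cvgr_gt _ (cvg_norm (@cvg_id _ (nbhs t)))).
by apply: filterS => y /psiT ->.
Qed.

Lemma cutoff_out x : cutoff_size < `|x.1| \/ cutoff_size < `|x.2| ->
  [/\ cutoff x = 0, cutoff_t x = 0 & cutoff_y x = 0].
Proof.
move=> h; have [Tx|xT] := ltP T `|x.1|.
  rewrite /cutoff /cutoff_t /cutoff_y (psiT Tx) (derive1_out Tx).
  by rewrite !(mulr0, mul0r, addr0, subr0).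
have x2 : k * expR (T / 2) < `|x.2|.
  have s0 : 0 <= k * expR (T / 2) by exact: size_ge0.
  move: h; rewrite /cutoff_size => -[h|h]; last by apply: le_lt_trans h; rewrite lerDr ltW.
  by move: (lt_le_trans h xT); rewrite gtrDl ltNge s0.
have [w1 w2 w3] := wedge_out xT x2.
by rewrite /cutoff /cutoff_t /cutoff_y w1 w2 w3 !(mulr0, mul0r, addr0, subr0).
Qed.

Lemma test_cutoff : test_function cutoff.
Proof.
apply: (@test_function2 _ _ cutoff_size); first exact: smooth_cutoff.
by move=> x /cutoff_out[].
Qed.

Lemma wedge_ge0 x : 0 <= wedge x.
Proof. by rewrite mulr_ge0 ?ebump_ge0. Qed.

Lemma wedge_le1 x : wedge x <= 1.
Proof. by rewrite mulr_ile1 ?ebump_ge0 ?ebump_le1. Qed.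

Let m1 (f : R -> R) : smooth f -> measurable_fun (setT : set T2) (fun x : T2 => f x.1).
Proof. by move=> sf; apply: measurable_fst_comp; exact: smooth_cont. Qed.

Let m2 (f : R -> R) : smooth f -> measurable_fun (setT : set T2) (fun x : T2 => f x.2).
Proof. by move=> sf; apply: measurable_snd_comp; exact: smooth_cont. Qed.

Let mE (f : R -> R) (g : T2 -> R) : smooth f -> measurable_fun setT g ->
  measurable_fun (setT : set T2) (fun x : T2 => f (g x)).
Proof.
move=> sf mg; apply: (measurableT_comp (f := f)) => //.
by apply: continuous_measurable; exact: smooth_cont.
Qed.

Let mA : measurable_fun (setT : set T2) (fun x : T2 => rad x.1 + x.2).
Proof. by apply: measurable_funD; [apply: m1; exact: smooth_rad|exact: measurable_snd]. Qed.

Let mB : measurable_fun (setT : set T2) (fun x : T2 => rad x.1 - x.2).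
Proof. by apply: measurable_funB; [apply: m1; exact: smooth_rad|exact: measurable_snd]. Qed.

Let s1 : smooth (@ebump R). Proof. exact: smooth_ebump. Qed.
Let s2 : smooth (@ebump' R). Proof. exact: smooth_flatp. Qed.

Lemma measurable_wedge : measurable_fun (setT : set T2) (wedge : T2 -> R).
Proof. by apply: measurable_funM; exact: mE. Qed.

Let measurable_wedgeP : measurable_fun (setT : set T2) (wedgeP : T2 -> R).
Proof. by apply: measurable_funM; exact: mE. Qed.

Let measurable_wedgeQ : measurable_fun (setT : set T2) (wedgeQ : T2 -> R).
Proof. by apply: measurable_funM; exact: mE. Qed.

Lemma measurable_cutoff : measurable_fun (setT : set T2) (cutoff : T2 -> R).
Proof.
apply: measurable_funM; last exact: measurable_wedge.
by apply: measurable_funM; [exact: (m1 (@smooth_exp_half R))|exact: (m1 spsi)].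
Qed.

Lemma measurable_cutoff_y : measurable_fun (setT : set T2) (cutoff_y : T2 -> R).
Proof.
apply: measurable_funM; last exact: measurable_funB.
by apply: measurable_funM; [exact: (m1 (@smooth_exp_half R))|exact: (m1 spsi)].
Qed.

Lemma measurable_cutoff_t : measurable_fun (setT : set T2) (cutoff_t : T2 -> R).
Proof.
apply: measurable_funM; first exact: (m1 (@smooth_exp_half R)).
have mp := m1 spsi; have mp' := m1 (smooth_derive1 spsi); have mw := measurable_wedge.
apply: measurable_funB.
  apply: measurable_funD; apply: measurable_funM => //.
  by apply: measurable_funM => //; exact: measurable_cst.
apply: measurable_funM; last exact: measurable_funD.
apply: measurable_funM => //; apply: (m1 (f := fun t => k / 2 * expR (- (t / 2)))).
apply: smoothM; first exact: smooth_cst.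
apply: (@smooth_comp _ _ _ expR); last exact: smooth_expR.
by apply: smoothN; apply: smoothM; [exact: smooth_id|exact: smooth_cst].
Qed.

(** On the support of the cutoff the inward speed exceeds the transport speed
    by [L / 2], so a flux bounded by [L / 2] times the entropy is absorbed. *)
Lemma cutoff_absorbs_flux x (e q s : R) : 0 <= e -> `|q| <= L / 2 * e -> 0 <= psi x.1 ->
  expR (x.1 / 2) * (- derive1 psi x.1 * wedge x * e + psi x.1 * wedge x * s) <=
  - cutoff_t x * e + cutoff_y x * (x.2 / 2 * e - q) + cutoff x * (2^-1 * e + s).
Proof.
move=> e0 qe p0; rewrite -subr_ge0.
set E := expR (- (x.1 / 2)).
have -> : - cutoff_t x * e + cutoff_y x * (x.2 / 2 * e - q) + cutoff x * (2^-1 * e + s) -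
   expR (x.1 / 2) * (- derive1 psi x.1 * wedge x * e + psi x.1 * wedge x * s) =
   expR (x.1 / 2) * psi x.1 * (wedgeP x * ((k * E + x.2) / 2 * e - q) +
                               wedgeQ x * ((k * E - x.2) / 2 * e + q)).
  by rewrite /cutoff_t /cutoff_y /cutoff -/E; field.
have [q1 q2] : - (L / 2 * e) <= q /\ q <= L / 2 * e.
  by move: qe; rewrite ler_norml => /andP[].
apply: mulr_ge0; first by rewrite mulr_ge0 ?expR_ge0.
apply: addr_ge0.
  rewrite /wedgeP; have [A0|A0] := leP (rad x.1 + x.2) 0; first by rewrite (ebump'_le0 A0) !mul0r.
  rewrite mulr_ge0 //; first by rewrite mulr_ge0 ?ebump_ge0 ?ebump'_ge0.
  have : L / 2 * e <= (k * E + x.2) / 2 * e by rewrite ler_wpM2r //; move: A0; rewrite /rad -/E; lra.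
  lra.
rewrite /wedgeQ; have [A0|A0] := leP (rad x.1 - x.2) 0; first by rewrite (ebump'_le0 A0) mulr0 !mul0r.
rewrite mulr_ge0 //; first by rewrite mulr_ge0 ?ebump_ge0 ?ebump'_ge0.
have : L / 2 * e <= (k * E - x.2) / 2 * e by rewrite ler_wpM2r //; move: A0; rewrite /rad -/E; lra.
lra.
Qed.

End shrinking_cutoff.

(** * Local integrability *)

Section L1box_algebra.
Context {R : realType}.
Local Notation mu := (@lebesgue_measure R).
Local Notation mu2 := (@lebesgue_measure R \x @lebesgue_measure R)%E.
Local Notation T2 := (measurableTypeR R * measurableTypeR R)%type.
Local Notation H := (half_plane R).
Implicit Types (f g c : R * R -> R).

Lemma L1box_box_integrable (f : R * R -> \bar R) M : L1box f -> mu2.-integrable (box M) f.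
Proof.
move=> [mf fM]; apply/integrableP; split; last exact: fM.
by apply: measurable_funS mf => //; exact: box_half_plane.
Qed.

Lemma L1boxP (f : R * R -> \bar R) : measurable_fun (H : set T2) f ->
  (forall M, mu2.-integrable (box M) f) -> L1box f.
Proof. by move=> mf fi; split=> // M; case/integrableP : (fi M). Qed.

Lemma L1box_ae (f g : R * R -> \bar R) : L1box f -> measurable_fun (H : set T2) g ->
  {ae mu2, forall x, H x -> f x = g x} -> L1box g.
Proof.
move=> [mf fM] mg fg; split=> // M.
have BH := @box_half_plane R M; have mB := @measurable_box R M.
have -> : (\int[mu2]_(x in box M) `|g x| = \int[mu2]_(x in box M) `|f x|)%E.
  apply: ge0_ae_eq_integral => //.
  - by apply: measurableT_comp => //; exact: measurable_funS mg.
  - by apply: measurableT_comp => //; exact: measurable_funS mf.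
  - by apply: ae_imply fg => x fgx /BH /fgx ->.
exact: fM.
Qed.

Lemma L1boxD f g : L1box (EFin \o f) -> L1box (EFin \o g) ->
  L1box (EFin \o (fun x => f x + g x)).
Proof.
move=> fi gi; apply: L1boxP.
  apply/measurable_EFinP; apply: measurable_funD.
    by apply/measurable_EFinP; case: fi.
  by apply/measurable_EFinP; case: gi.
move=> M.
have := integrableD (@measurable_box R M) (L1box_box_integrable M fi) (L1box_box_integrable M gi).
by [].
Qed.

Lemma L1boxM c f : continuous c -> measurable_fun (H : set T2) c ->
  L1box (EFin \o f) -> L1box (EFin \o (fun x => c x * f x)).
Proof.
move=> cc mc fi; have mf : measurable_fun (H : set T2) f by apply/measurable_EFinP; case: fi.
apply: L1boxP; first by apply/measurable_EFinP; exact: measurable_funM.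
move=> M; have [C C0 HC] := bounded_on_box M cc.
have fiM := integrableZl (@measurable_box R M) C (L1box_box_integrable M fi).
apply: (le_integrable (@measurable_box R M)) fiM.
  apply/measurable_EFinP; apply: measurable_funS (measurable_funM mc mf) => //.
  exact: box_half_plane.
move=> x [/=]; rewrite !in_itv /= => /andP[x10 x1M] x2.
rewrite lee_fin !normrM ler_wpM2r // (ger0_norm C0).
by apply: HC; [rewrite ger0_norm|rewrite ler_norml].
Qed.

Lemma L1box_cst (k : R) : L1box (EFin \o (fun=> k)).
Proof.
apply: L1boxP; first by apply/measurable_EFinP; exact: measurable_cst.
move=> M; apply/integrableP; split; first by apply/measurable_EFinP; exact: measurable_cst.
rewrite (_ : (fun x => _) = cst `|k|%:E) // integral_cst; last exact: measurable_box.
have boxE : (mu2 (box M) = mu `[0%R, M] * mu `[(- M)%R, M])%E.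
  by apply: product_measure1E; exact: measurable_itv.
rewrite lte_mul_pinfty //.
apply: (@le_lt_trans _ _ (mu `[0%R, M] * mu `[(- M)%R, M])%E); first by rewrite -boxE.
rewrite !lebesgue_measure_itv /=.
by do 2 case: ifP => _; rewrite -?EFinB -?EFinM ?mule0 ?mul0e ?ltry.
Qed.

Lemma L1box_test c f (M : R) : continuous c -> measurable_fun (setT : set T2) c ->
  (forall x, M < `|x.1| \/ M < `|x.2| -> c x = 0) ->
  L1box (EFin \o f) -> mu2.-integrable H (EFin \o (fun x => c x * f x)).
Proof.
move=> cc mc cM fi; have [C C0 HC] := bounded_on_box M cc.
have := @L1box_integrable R c (EFin \o f) M C fi.
apply; first exact: measurable_funTS.
  move=> x _; have [x1|x1] := leP `|x.1| M; last by rewrite cM ?normr0 //; left.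
  have [x2|x2] := leP `|x.2| M; last by rewrite cM ?normr0 //; right.
  exact: HC.
by move=> x x0 h; apply: cM; case: h => h; [left; rewrite ger0_norm|right].
Qed.

End L1box_algebra.

Section measurability_of_potentials.
Context {R : realType}.

Lemma measurable_dpotential (p h : R -> R) : internal_potential p h ->
  measurable_fun (setT : set R) (dpotential h).
Proof.
case=> _ dh _ _; apply: (@measurable_fun_gt0_cst _ (derive1 h) _ (dpotential h 0)).
- move=> r r0; apply/differentiable_continuous/derivable1_diffP.
  by have [] := dh r r0.
- by move=> r; exact: dpotential_gt0.
- by move=> r r0; rewrite /dpotential ltxx ltNge r0.
Qed.

Lemma measurable_potential (p h : R -> R) : internal_potential p h ->
  measurable_fun (setT : set R) (potential h).
Proof.
case=> hc _ _ _; apply: (measurable_fun_ge0_ext hc) => r r0; first by rewrite /potential r0.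
by rewrite /potential leNgt r0.
Qed.

End measurability_of_potentials.

Section real_integrals.
Context d (T : measurableType d) {R : realType} (mu : {measure set T -> \bar R}).
Variable D : set T.
Hypothesis mD : measurable D.
Implicit Types f g : T -> R.

Lemma intD f g : mu.-integrable D (EFin \o f) -> mu.-integrable D (EFin \o g) ->
  mu.-integrable D (EFin \o (fun x => f x + g x)).
Proof. by move=> fi gi; have := integrableD mD fi gi. Qed.

Lemma intB f g : mu.-integrable D (EFin \o f) -> mu.-integrable D (EFin \o g) ->
  mu.-integrable D (EFin \o (fun x => f x - g x)).
Proof. by move=> fi gi; have := integrableB mD fi gi. Qed.

Lemma intZ (k : R) f : mu.-integrable D (EFin \o f) ->
  mu.-integrable D (EFin \o (fun x => k * f x)).
Proof. by move=> fi; have := integrableZl mD k fi. Qed.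

Lemma int_eq f g : {in D, f =1 g} -> mu.-integrable D (EFin \o f) ->
  mu.-integrable D (EFin \o g).
Proof. by move=> fg; apply: eq_integrable => // x xD /=; rewrite fg. Qed.

Lemma int_dom f g : measurable_fun D f -> (forall x, D x -> `|f x| <= `|g x|) ->
  mu.-integrable D (EFin \o g) -> mu.-integrable D (EFin \o f).
Proof.
move=> mf fg; apply: (le_integrable mD); first exact/measurable_EFinP.
by move=> x Dx; rewrite lee_fin fg.
Qed.

Lemma int_measurable f : mu.-integrable D (EFin \o f) -> measurable_fun D f.
Proof. by case/integrableP => /measurable_EFinP. Qed.

Lemma RintE f : mu.-integrable D (EFin \o f) ->
  (\int[mu]_(x in D) (f x)%:E = (\int[mu]_(x in D) f x)%:E)%E.
Proof. by move=> fi; rewrite /Rintegral fineK //; exact: integrable_fin_num. Qed.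

End real_integrals.

Section line.
Context {R : realType}.
Local Notation mu := (@lebesgue_measure R).

(** Segments centred at the origin exhaust the compact sets and carry the
    supports of test functions. *)
Definition L1seg (f : R -> R) := forall M, mu.-integrable `[- M, M] (EFin \o f).

Lemma locally_integrable_L1seg (f : R -> R) : locally_integrable setT f -> L1seg f.
Proof.
move=> [mf _ fK] M; apply/integrableP; split.
  by apply/measurable_EFinP; exact: measurable_funTS.
by apply: fK => //; exact: segment_compact.
Qed.

Lemma cts_L1seg (f : R -> R) : continuous f -> L1seg f.
Proof. by move=> cf M; exact: continuous_integrable_itv. Qed.

Lemma L1seg_mul (c f : R -> R) : continuous c -> L1seg f -> L1seg (fun x => c x * f x).
Proof.
move=> cc fi M.
have [M0|M0] := leP 0 M; last first.
  rewrite set_itv_ge ?bnd_simp -?ltNge; last lra.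
  exact: integrable_set0.
have MM : - M <= M by lra.
have cw : {within `[- M, M], continuous c} by exact: continuous_subspaceT.
have [C C0 HC] := bounded_on_segment MM cw.
have mI : measurable (`[- M, M] : set R) by exact: measurable_itv.
apply: (@int_dom _ _ _ mu _ mI _ (fun x => C * f x)) => //.
- by apply: measurable_funM; [exact: continuous_measurable|exact: int_measurable (fi M)].
- by move=> x; rewrite /= in_itv /= => xM; rewrite !normrM ler_wpM2r // (ger0_norm C0) HC.
- by apply: intZ.
Qed.

Lemma L1seg_supp (f : R -> R) M : L1seg f -> (forall x, M < `|x| -> f x = 0) ->
  mu.-integrable setT (EFin \o f).
Proof.
by move=> fi fM; apply: (@integrable_supp _ _ M) => [x /fM /= ->//|]; exact: fi.
Qed.

End line.

Section initial_data.
Context {R : realType}.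
Local Notation mu := (@lebesgue_measure R).

Lemma measurable_sq_over d (T : measurableType d) (m r : T -> R) :
  measurable_fun setT m -> measurable_fun setT r ->
  measurable_fun setT (fun x => sq_over (m x) (r x)).
Proof.
move=> mm mr.
have m1 : measurable_fun (setT : set (R * R)) (fst : R * R -> R) by [].
have m2 : measurable_fun (setT : set (R * R)) (snd : R * R -> R) by [].
have mg : measurable_fun (setT : set (R * R)) (fun x : R * R => sq_over x.1 x.2).
  rewrite /sq_over; apply: measurable_fun_ifT; first exact: measurable_fun_eqr.
    by apply: measurable_fun_ifT => //; exact: measurable_fun_eqr.
  apply/measurable_EFinP; apply: measurable_funM; first exact: measurable_funX.
  by apply: (measurableT_comp (f := fun r : R => r^-1)) => //; exact: measurable_fun_invr.
exact: (measurableT_comp mg (measurable_fun_pair mm mr)).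
Qed.

Variables (p h : R -> R) (rhohat a : R) (rho0 n0 : R -> R).
Hypothesis plaw : pressure_law p.
Hypothesis hpot : internal_potential p h.
Hypothesis rhohat_ge0 : 0 <= rhohat.
Hypothesis aE : dpotential h rhohat = a%:E.
Hypothesis rho0_loc : locally_integrable setT rho0.
Hypothesis n0_loc : locally_integrable setT n0.
Hypothesis energy0_fin :
  (rel_energy h 0 rho0 n0 (cst rhohat) (cst 0%R) < +oo)%E.

Definition rel_entropy_init (y : R) : R := fine (rel_entropy h 0 (rho0 y) (n0 y) rhohat 0).

Let mr : measurable_fun (setT : set R) rho0. Proof. by case: rho0_loc. Qed.
Let mn : measurable_fun (setT : set R) n0. Proof. by case: n0_loc. Qed.

Lemma measurable_rel_entropy_init :
  measurable_fun (setT : set R) (fun y => rel_entropy h 0 (rho0 y) (n0 y) rhohat 0).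
Proof.
under eq_fun do rewrite rel_entropy0.
apply: emeasurable_funD.
  by apply: emeasurable_funM => //; exact: measurable_sq_over.
case: hpot => hc _ _ _.
exact: (measurableT_comp (measurable_rel_potential hc rhohat_ge0 aE) mr).
Qed.

Lemma rel_entropy_init_integrable0 :
  mu.-integrable setT (fun y => rel_entropy h 0 (rho0 y) (n0 y) rhohat 0).
Proof.
apply/integrableP; split; first exact: measurable_rel_entropy_init.
rewrite (_ : (fun y => _) = (fun y => rel_entropy h 0 (rho0 y) (n0 y) rhohat 0)) //.
by apply/funext => y; rewrite gee0_abs //; exact: rel_entropy_ge0 plaw hpot.
Qed.

Lemma rel_entropy_init_integrable : mu.-integrable setT (EFin \o rel_entropy_init).
Proof. exact: integrable_fine_comp rel_entropy_init_integrable0. Qed.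

Lemma rel_entropy_init_ge0 y : 0 <= rel_entropy_init y.
Proof. by rewrite fine_ge0 //; exact: rel_entropy_ge0 plaw hpot. Qed.

Lemma rel_energy_initE :
  rel_energy h 0 rho0 n0 (cst rhohat) (cst 0) = (\int[mu]_y rel_entropy_init y)%:E.
Proof.
rewrite -RintE //; last exact: rel_entropy_init_integrable.
apply: ae_eq_integral => //.
- exact: measurable_rel_entropy_init.
- by case/integrableP: rel_entropy_init_integrable.
- apply: ae_imply (integrable_ae measurableT rel_entropy_init_integrable0) => y + _.
  by move=> /(_ I) yfin; rewrite /rel_entropy_init fineK.
Qed.

(** The relative entropy is the entropy minus an affine function of the
    density. *)
Lemma rel_entropy_fin t r m : rel_entropy h t r m rhohat 0 \is a fin_num ->
  [/\ 0 <= r, (r = 0 -> m = 0) & entropy h t r m =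
    (fine (rel_entropy h t r m rhohat 0) + (a * r + (h rhohat - a * rhohat)))%:E].
Proof.
rewrite rel_entropy0; have [r0|r0] := leP 0 r; last first.
  by rewrite rel_potential_lt0 // /sq_over lt_eqF // -EFinM addey.
rewrite (rel_potentialE r0 rhohat_ge0 aE) /entropy /potential r0 /sq_over.
have e2 : 0 < expR (- t) / 2 by rewrite divr_gt0 ?expR_gt0.
have [->|rn] := eqVneq r 0; last first.
  by move=> _; split => // [r0'|]; [rewrite r0' eqxx in rn|rewrite -!EFinM -!EFinD /=; congr EFin; ring].
have [->|mn0] := eqVneq m 0; last by rewrite gt0_muley ?lte_fin.
by move=> _; split => //; rewrite !mule0 !add0e /=; congr EFin; ring.
Qed.

Lemma entropy_init_ae (c : R -> R) : continuous c ->
  (\int[mu]_y ((c y)%:E * entropy h 0 (rho0 y) (n0 y)) =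
   \int[mu]_y (c y * (rel_entropy_init y + (a * rho0 y + (h rhohat - a * rhohat))))%:E)%E.
Proof.
move=> cc; have mc : measurable_fun (setT : set R) c by exact: continuous_measurable.
apply: ae_eq_integral => //.
- apply: emeasurable_funM; first exact/measurable_EFinP.
  apply: emeasurable_funD.
    by apply: emeasurable_funM => //; exact: measurable_sq_over.
  exact: (measurableT_comp (measurable_potential hpot) mr).
- apply/measurable_EFinP; apply: measurable_funM => //; apply: measurable_funD.
    by case/integrableP: rel_entropy_init_integrable => /measurable_EFinP.
  by apply: measurable_funD => //; apply: measurable_funM.
- apply: ae_imply (integrable_ae measurableT rel_entropy_init_integrable0) => y + _.
  by move=> /(_ I) /rel_entropy_fin[_ _ ->].
Qed.

End initial_data.

(** * The local entropy inequality *)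

Section local_case.
Context {R : realType}.
Local Notation mu := (@lebesgue_measure R).
Local Notation mu2 := (@lebesgue_measure R \x @lebesgue_measure R)%E.
Local Notation T2 := (measurableTypeR R * measurableTypeR R)%type.
Local Notation H := (half_plane R).
Variables (alpha rhohat a : R) (p h : R -> R) (rho0 n0 : R -> R) (rho n : R * R -> R).
Hypothesis alpha_ge0 : 0 <= alpha.
Hypothesis plaw : pressure_law p.
Hypothesis hpot : internal_potential p h.
Hypothesis rhohat_ge0 : 0 <= rhohat.
Hypothesis aE : dpotential h rhohat = a%:E.
Hypothesis relpos : forall r, 0 <= r -> 0 <= rel h rhohat a r.
Hypothesis rho0_loc : locally_integrable setT rho0.
Hypothesis n0_loc : locally_integrable setT n0.
Hypothesis energy0_fin :
  (rel_energy h 0 rho0 n0 (cst rhohat) (cst 0%R) < +oo)%E.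
Hypothesis sol : weak_solution alpha p rho0 n0 rho n.
Hypothesis Lpot : L1loc_half_plane (fun x => potential h (rho x)).
Hypothesis EI : forall chi : R * R -> R, test_function chi ->
        (forall x, half_plane R x -> 0 <= chi x) ->
        let eta x := entropy h x.1 (rho x) (n x) in
        let q x := entropy_flux h x.1 (rho x) (n x) in
        (\int[lebR2 R]_(x in half_plane R)
           ((- dtime chi x)%:E * eta x
            + (dspace chi x)%:E * ((x.2 / 2)%:E * eta x - q x)
            + (chi x)%:E * (2^-1%:E * eta x
                            + alpha%:E * sq_over (n x) (rho x)))
         <= \int[lebR R]_y ((chi (0%R, y))%:E * entropy h 0 (rho0 y) (n0 y)))%E.

Variables (T M C : R).
Hypothesis T0 : 0 < T.
Hypothesis M0 : 0 < M.
Hypothesis C0 : 0 <= C.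
Hypothesis fluxC : forall r m, 0 < r -> r <= M -> `|m| <= M * r ->
     `|m * (derive1 h r - a)| <= C * (m ^+ 2 / r + rel h rhohat a r).
Variable N : set T2.
Hypothesis mN : measurable N.
Hypothesis N0 : mu2 N = 0%E.
Hypothesis good : forall x, ~ N x -> H x ->
  [/\ 0 <= rho x, rho x = 0 -> n x = 0 &
      x.1 <= T -> rho x <= M /\ `|n x| <= M * rho x].

Let ind (x : R * R) : R := \1_(~` N) x.
(* The solution is set to the vacuum on the exceptional null set, where it
   need not satisfy the pointwise bounds. *)
Let rr x := ind x * rho x.
Let nn x := ind x * n x.

Let indN x : N x -> ind x = 0. Proof. by move=> Nx; rewrite /ind indicE memNset. Qed.
Let indC x : ~ N x -> ind x = 1. Proof. by move=> Nx; rewrite /ind indicE mem_set. Qed.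

Let goodr x : H x -> [/\ 0 <= rr x, rr x = 0 -> nn x = 0 &
      x.1 <= T -> rr x <= M /\ `|nn x| <= M * rr x].
Proof.
move=> Hx; have [Nx|Nx] := pselect (N x).
  by rewrite /rr /nn indN // !mul0r mulr0 normr0; split => // _; split => //; exact: ltW.
by rewrite /rr /nn indC // !mul1r; exact: good.
Qed.

Let ae_off (P : R * R -> Prop) : (forall x, ~ N x -> P x) -> {ae mu2, forall x, P x}.
Proof. by move=> HP; exists N; split => // x /= nP; apply: contrapT => /HP. Qed.

Let mrho : measurable_fun (H : set T2) rho.
Proof. by case: sol => -[[/measurable_EFinP]]. Qed.

Let mn : measurable_fun (H : set T2) n.
Proof. by case: sol => -[_ [/measurable_EFinP]]. Qed.

Let mind : measurable_fun (H : set T2) ind.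
Proof. by apply: measurable_funTS; apply: measurable_indic; exact: measurableC. Qed.

Let mrr : measurable_fun (H : set T2) rr. Proof. exact: measurable_funM. Qed.
Let mnn : measurable_fun (H : set T2) nn. Proof. exact: measurable_funM. Qed.

Let hr x := fine (potential h (rr x)).
Let dr x := fine (dpotential h (rr x)).
Let sqr x := nn x ^+ 2 / rr x.
Let b := h rhohat - a * rhohat.
Let er x := expR (- x.1) / 2 * sqr x + hr x.
Let eh x := expR (- x.1) / 2 * sqr x + (hr x - a * rr x - b).
Let qr x := expR (- x.1) * (nn x ^+ 3 / (2 * rr x ^+ 2)) + nn x * dr x.

Let hrE x : H x -> hr x = h (rr x).
Proof. by move=> /goodr[r0 _ _]; rewrite /hr /potential r0. Qed.

Let msqr : measurable_fun (H : set T2) sqr.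
Proof.
apply: measurable_funM; first exact: measurable_funX.
exact: (measurableT_comp measurable_fun_invr mrr).
Qed.

Let mhr : measurable_fun (H : set T2) hr.
Proof.
apply: (measurableT_comp (f := fine)); first exact: fine_measurable.
exact: (measurableT_comp (measurable_potential hpot) mrr).
Qed.

Let mdr : measurable_fun (H : set T2) dr.
Proof.
apply: (measurableT_comp (f := fine)); first exact: fine_measurable.
exact: (measurableT_comp (measurable_dpotential hpot) mrr).
Qed.

Let sexpN : smooth (fun t : R => expR (- t) / 2).
Proof.
apply: smoothM; last exact: smooth_cst.
apply: (@smooth_comp _ _ _ expR); last exact: smooth_expR.
by apply: smoothN; exact: smooth_id.
Qed.

Let cfst (f : R -> R) : smooth f -> continuous (fun x : R * R => f x.1).
Proof.
move=> sf; apply: smooth_cont.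
by apply: (@smooth_comp _ _ fst f) => //; exact: smooth_fst.
Qed.

Let csnd (f : R -> R) : smooth f -> continuous (fun x : R * R => f x.2).
Proof.
move=> sf; apply: smooth_cont.
by apply: (@smooth_comp _ _ snd f) => //; exact: smooth_snd.
Qed.

Let shalf : smooth (fun y : R => y / 2).
Proof. by apply: smoothM; [exact: smooth_id|exact: smooth_cst]. Qed.

Let Lrr : L1box (EFin \o rr).
Proof.
case: sol => -[Lr0 _ _ _] _ _ _; have Lr := L1loc_L1box Lr0; apply: (L1box_ae Lr).
  exact/measurable_EFinP.
by apply: ae_off => x Nx _ /=; rewrite /rr indC // mul1r.
Qed.

Let Lnn : L1box (EFin \o nn).
Proof.
case: sol => -[_ Lr0 _ _] _ _ _; have Lr := L1loc_L1box Lr0; apply: (L1box_ae Lr).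
  exact/measurable_EFinP.
by apply: ae_off => x Nx _ /=; rewrite /nn indC // mul1r.
Qed.

Let sq_good x : ~ N x -> H x -> sq_over (n x) (rho x) = (sqr x)%:E.
Proof.
move=> Nx Hx; have [_ r0 _] := good Nx Hx.
rewrite /sq_over /sqr /rr /nn indC // !mul1r; case: ifPn => // /eqP r00.
by rewrite r0 // eqxx r00 invr0 mulr0.
Qed.

Let Lsqr : L1box (EFin \o sqr).
Proof.
case: sol => -[_ _ Lr0 _] _ _ _; have Lr := L1loc_L1box Lr0; apply: (L1box_ae Lr).
  exact/measurable_EFinP.
by apply: ae_off => x Nx Hx /=; exact: sq_good.
Qed.

Let pot_good x : ~ N x -> H x -> potential h (rho x) = (hr x)%:E.
Proof.
move=> Nx Hx; have [r0 _ _] := good Nx Hx.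
by rewrite /hr /rr indC // mul1r /potential r0.
Qed.

Let Lhr : L1box (EFin \o hr).
Proof.
apply: (L1box_ae (L1loc_L1box Lpot)); first exact/measurable_EFinP.
by apply: ae_off => x Nx Hx /=; exact: pot_good.
Qed.

Let Lkin : L1box (EFin \o (fun x => expR (- x.1) / 2 * sqr x)).
Proof.
apply: (L1boxM (c := fun x => expR (- x.1) / 2)) => //; first exact: (cfst sexpN).
by apply: (@measurable_fst_comp _ (fun t => expR (- t) / 2)); exact: smooth_cont.
Qed.

Let LZ (k : R) (f : R * R -> R) : L1box (EFin \o f) -> L1box (EFin \o (fun x => k * f x)).
Proof.
move=> Lf; apply: (L1boxM (c := fun=> k)) => //; move=> x; exact: cvg_cst.
Qed.

Let Ler : L1box (EFin \o er). Proof. exact: L1boxD. Qed.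

Let Leh : L1box (EFin \o eh).
Proof.
have := L1boxD (L1boxD Ler (LZ (- a) Lrr)) (L1box_cst (- b)).
by congr (L1box _); apply/funext => x /=; congr EFin; rewrite /er /eh; ring.
Qed.

Let eh_ge0 x : H x -> 0 <= eh x.
Proof.
move=> Hx; have [r0 _ _] := goodr Hx.
have := relpos r0; rewrite /eh hrE // /rel /b => h1.
have : 0 <= expR (- x.1) / 2 * sqr x.
  by rewrite mulr_ge0 ?divr_ge0 ?expR_ge0 ?sqr_ge0.
lra.
Qed.

Definition flux_const := M + 2 * C * expR T + C.

(** The kinetic part of the flux is the kinetic energy times the velocity; the
    internal part is controlled by [fluxC]. *)
Let flux_bound x : H x -> x.1 <= T -> `|qr x - a * nn x| <= flux_const * eh x.
Proof.
move=> Hx xT; have [r0 rn rM] := goodr Hx; have [r1 r2] := rM xT.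
have e0 := eh_ge0 Hx.
have c0 : 0 <= flux_const.
  rewrite /flux_const; have := expR_ge0 T => eT.
  by rewrite !addr_ge0 ?mulr_ge0 // ltW.
move: r0; rewrite le_eqVlt => /predU1P[r00|r0].
  rewrite /qr rn // !mul0r !mulr0 expr0n /= mul0r mulr0 addr0 subr0 normr0.
  exact: mulr_ge0.
have x10 : 0 <= x.1 by exact: Hx.
have sq0 : 0 <= sqr x by rewrite divr_ge0 ?sqr_ge0 // ltW.
set k := expR (- x.1) / 2 * sqr x.
have k0 : 0 <= k by rewrite mulr_ge0 // divr_ge0 ?expR_ge0.
have relE : hr x - a * rr x - b = rel h rhohat a (rr x) by rewrite hrE // /rel /b; ring.
have rel0 : 0 <= rel h rhohat a (rr x) by apply: relpos; exact: ltW.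
have ehE : eh x = k + rel h rhohat a (rr x) by rewrite /eh relE.
have drE : dr x = derive1 h (rr x) by rewrite /dr dpotential_gt0.
have -> : qr x - a * nn x = k * (nn x / rr x) + nn x * (derive1 h (rr x) - a).
  rewrite /qr drE /k /sqr; field; by rewrite gt_eqF.
apply: le_trans (ler_normD _ _) _.
have b1 : `|k * (nn x / rr x)| <= M * k.
  rewrite normrM (ger0_norm k0) mulrC ler_wpM2r // normrM normfV (gtr0_norm r0).
  by rewrite ler_pdivrMr.
have b2 := fluxC r0 r1 r2.
have b3 : nn x ^+ 2 / rr x <= 2 * expR T * k.
  rewrite -[leLHS]/(sqr x) /k mulrA -[leLHS]mul1r ler_wpM2r //.
  have -> : 2 * expR T * (expR (- x.1) / 2) = expR (T - x.1) by rewrite expRD; field.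
  by rewrite -expR0 ler_expR; lra.
have b4 : C * (nn x ^+ 2 / rr x + rel h rhohat a (rr x)) <=
          C * (2 * expR T * k + rel h rhohat a (rr x)) by rewrite ler_wpM2l // lerD2r.
apply: le_trans (lerD b1 (le_trans b2 b4)) _.
rewrite ehE /flux_const -subr_ge0.
have -> : (M + 2 * C * expR T + C) * (k + rel h rhohat a (rr x)) -
  (M * k + C * (2 * expR T * k + rel h rhohat a (rr x))) =
  C * k + (M + 2 * C * expR T) * rel h rhohat a (rr x) by ring.
have eT := expR_ge0 T.
have t1 : 0 <= M + 2 * C * expR T by rewrite addr_ge0 ?mulr_ge0 // ltW.
by apply: addr_ge0; apply: mulr_ge0.
Qed.

Let ent_good x : ~ N x -> H x -> entropy h x.1 (rho x) (n x) = (er x)%:E.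
Proof. by move=> Nx Hx; rewrite /entropy sq_good // pot_good // -EFinM -EFinD. Qed.

Let flux_good x : ~ N x -> H x -> entropy_flux h x.1 (rho x) (n x) = (qr x)%:E.
Proof.
move=> Nx Hx; have [r0 rn _] := good Nx Hx.
rewrite /entropy_flux /qr /dr /rr /nn indC // !mul1r; move: r0; rewrite le_eqVlt.
move=> /predU1P[r0|r0]; first by rewrite rn // mul0e mul0r -EFinD.
by rewrite dpotential_gt0.
Qed.

Let rel_good x : ~ N x -> H x -> rel_entropy h x.1 (rho x) (n x) rhohat 0 = (eh x)%:E.
Proof.
move=> Nx Hx; have [r0 _ _] := good Nx Hx.
rewrite rel_entropy0 sq_good // (rel_potentialE r0 rhohat_ge0 aE) -EFinM -EFinD.
congr EFin; rewrite /eh hrE // /b /rr indC // mul1r; ring.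
Qed.

Let sq_ge0 x : H x -> 0 <= sqr x.
Proof. by move=> Hx; have [r0 _ _] := goodr Hx; rewrite divr_ge0 ?sqr_ge0. Qed.

Variable psi : R -> R.
Hypothesis tpsi : test_function psi.
Hypothesis psi_ge0 : forall t, 0 <= t -> 0 <= psi t.
Hypothesis dpsi_le0 : forall t, 0 <= t -> derive1 psi t <= 0.
Hypothesis psiT : forall t, T < `|t| -> psi t = 0.

Let L := 2 * flux_const.

Let fc_ge0 : 0 <= flux_const.
Proof.
rewrite /flux_const; have := expR_ge0 T => eT.
by rewrite !addr_ge0 ?mulr_ge0 // ltW.
Qed.

Let L0 : 0 <= L. Proof. by rewrite mulr_ge0. Qed.

Section fixed_radius.
Variable k : R.
Hypothesis k0 : 0 <= k.

Let c := cutoff psi k L.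
Let ct := cutoff_t psi k L.
Let cy := cutoff_y psi k L.
Let S := cutoff_size T k.

Let sc : smooth c. Proof. exact: smooth_cutoff. Qed.
Let cc : continuous c. Proof. exact: smooth_cont. Qed.
Let cct : continuous ct.
Proof. by rewrite /ct -dtime_cutoff //; exact: smooth_dtime. Qed.
Let ccy : continuous cy.
Proof. by rewrite /cy -dspace_cutoff //; exact: smooth_dspace. Qed.

Let cout x : S < `|x.1| \/ S < `|x.2| -> [/\ c x = 0, ct x = 0 & cy x = 0].
Proof. exact: cutoff_out. Qed.

Let Ic (f : R * R -> R) : L1box (EFin \o f) -> mu2.-integrable H (EFin \o (fun x => c x * f x)).
Proof.
apply: (@L1box_test _ _ _ S) => //; first exact: measurable_cutoff.
by move=> x /cout[].
Qed.

Let Ict (f : R * R -> R) : L1box (EFin \o f) -> mu2.-integrable H (EFin \o (fun x => ct x * f x)).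
Proof.
apply: (@L1box_test _ _ _ S) => //; first exact: measurable_cutoff_t.
by move=> x /cout[].
Qed.

Let Icy (f : R * R -> R) : L1box (EFin \o f) -> mu2.-integrable H (EFin \o (fun x => cy x * f x)).
Proof.
apply: (@L1box_test _ _ _ S) => //; first exact: measurable_cutoff_y.
by move=> x /cout[].
Qed.

Let late x : T < x.1 -> [/\ c x = 0, ct x = 0 & cy x = 0].
Proof.
move=> Tx; have Tx' : T < `|x.1| by exact: lt_le_trans (ler_norm _).
rewrite /c /ct /cy /cutoff /cutoff_t /cutoff_y (psiT Tx') (derive1_out psiT Tx').
by rewrite !(mulr0, mul0r, addr0, subr0).
Qed.

Let mqr : measurable_fun (H : set T2) qr.
Proof.
apply: measurable_funD; last exact: measurable_funM.
apply: measurable_funM.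
  apply: (@measurable_fst_comp _ (fun t => expR (- t))); apply: smooth_cont.
  apply: (@smooth_comp _ _ _ expR); last exact: smooth_expR.
  by apply: smoothN; exact: smooth_id.
apply: measurable_funM; first exact: measurable_funX.
apply: (measurableT_comp measurable_fun_invr).
by apply: measurable_funM => //; exact: measurable_funX.
Qed.

Let Iq : mu2.-integrable H (EFin \o (fun x => cy x * qr x)).
Proof.
have i1 := integrable_norm (Icy (LZ flux_const Leh)).
have i2 := integrable_norm (Icy (LZ a Lnn)).
have i3 := intD measurable_half_plane i1 i2.
apply: (@int_dom _ _ _ mu2 _ measurable_half_plane _ _ _ _ i3).
  by apply: measurable_funM => //; apply: measurable_funTS; exact: measurable_cutoff_y.
move=> x Hx /=; have [xT|/late[_ _ ->]] := leP x.1 T; last by rewrite !mul0r normr0 addr0.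
rewrite (ger0_norm (_ : 0 <= _ + _)) ?addr_ge0 // !(normrM (cy x)) -mulrDr ler_wpM2l //.
have fb := le_trans (flux_bound Hx xT) (ler_norm _).
have -> : qr x = (qr x - a * nn x) + a * nn x by rewrite subrK.
exact: le_trans (ler_normD _ _) (lerD fb (lexx _)).
Qed.

(** Integrands of the entropy inequality, of the mass equation and of the mass
    equation of the constant state. The relative entropy balance is the
    combination of the three that occurs in [Gr_le]; [Gr] is what survives of it
    once the flux is absorbed. *)
Let Fr x := - ct x * er x + cy x * (x.2 / 2 * er x - qr x) + c x * (2^-1 * er x + alpha * sqr x).
Let Mr x := ct x * rr x + cy x * (- (x.2 / 2) * rr x + nn x) - 2^-1 * c x * rr x.
Let Kr x := - ct x + cy x * (x.2 / 2) + 2^-1 * c x.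
Let Gr x := expR (x.1 / 2) *
  (- derive1 psi x.1 * wedge k L x * eh x + psi x.1 * wedge k L x * (alpha * sqr x)).

Let msnd : measurable_fun (H : set T2) (fun x : T2 => x.2 / 2).
Proof. by apply: (@measurable_snd_comp _ (fun y => y / 2)); exact: smooth_cont. Qed.

Let Lyer : L1box (EFin \o (fun x => x.2 / 2 * er x)).
Proof. by apply: (L1boxM (c := fun x => x.2 / 2)) => //; exact: (csnd shalf). Qed.

Let IF : mu2.-integrable H (EFin \o Fr).
Proof.
have mH := @measurable_half_plane R.
have i := intD mH (intB mH (intB mH (Icy Lyer) (Ict Ler)) Iq) (Ic (L1boxD (LZ 2^-1 Ler) (LZ alpha Lsqr))).
by apply: (int_eq mH) i => x _; rewrite /Fr; ring.
Qed.

Let IM : mu2.-integrable H (EFin \o Mr).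
Proof.
have mH := @measurable_half_plane R.
have Lyr : L1box (EFin \o (fun x => x.2 / 2 * rr x)).
  by apply: (L1boxM (c := fun x => x.2 / 2)) => //; exact: (csnd shalf).
have i := intB mH (intD mH (intB mH (Ict Lrr) (Icy Lyr)) (Icy Lnn)) (Ic (LZ 2^-1 Lrr)).
by apply: (int_eq mH) i => x _; rewrite /Mr; ring.
Qed.

Let L1 : L1box (EFin \o (fun=> (1 : R))). Proof. exact: L1box_cst. Qed.

Let ict : mu2.-integrable H (EFin \o ct).
Proof. by apply: (int_eq (@measurable_half_plane R)) (Ict L1) => x _; rewrite mulr1. Qed.

Let Ly : L1box (EFin \o (fun x : R * R => x.2 / 2)).
Proof.
have := L1boxM (csnd shalf) msnd L1.
by congr (L1box _); apply/funext => x /=; rewrite mulr1.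
Qed.

Let icy : mu2.-integrable H (EFin \o (fun x => cy x * (x.2 / 2) + 2^-1 * c x)).
Proof.
have mH := @measurable_half_plane R.
have i := intD mH (Icy Ly) (Ic (L1box_cst 2^-1)).
by apply: (int_eq mH) i => x _ /=; rewrite (mulrC (c x)).
Qed.

Let IK : mu2.-integrable H (EFin \o Kr).
Proof.
have mH := @measurable_half_plane R.
by apply: (int_eq mH) (intB mH icy ict) => x _ /=; rewrite /Kr; ring.
Qed.

Let Gr_ge0 x : H x -> 0 <= Gr x.
Proof.
move=> Hx; have x0 : 0 <= x.1 by exact: Hx.
rewrite mulr_ge0 ?expR_ge0 // addr_ge0 //; apply: mulr_ge0.
- by rewrite mulr_ge0 ?wedge_ge0 // oppr_ge0 dpsi_le0.
- exact: eh_ge0.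
- by rewrite mulr_ge0 ?wedge_ge0 // psi_ge0.
- by rewrite mulr_ge0 // sq_ge0.
Qed.

Let Gr_le x : H x -> Gr x <= Fr x + a * Mr x - b * Kr x.
Proof.
move=> Hx; have x0 : 0 <= x.1 by exact: Hx.
have -> : Fr x + a * Mr x - b * Kr x = - ct x * eh x +
    cy x * (x.2 / 2 * eh x - (qr x - a * nn x)) + c x * (2^-1 * eh x + alpha * sqr x).
  by rewrite /Fr /Mr /Kr /er /eh; ring.
have [xT|Tx] := leP x.1 T.
  apply: cutoff_absorbs_flux; [exact: eh_ge0| |exact: psi_ge0].
  have -> : L / 2 = flux_const by rewrite /L; field.
  exact: flux_bound.
have [-> -> ->] := late Tx; have Tx' : T < `|x.1| by exact: lt_le_trans (ler_norm _).
by rewrite /Gr (psiT Tx') (derive1_out psiT Tx') !(mulr0, mul0r, addr0, subr0, oppr0).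
Qed.

Let cslice : continuous (fun y => c (0, y)). Proof. exact: cont_slice2. Qed.

Let c_out y : S < `|y| -> c (0, y) = 0.
Proof. by move=> Sy; have [] := @cout (0, y) (or_intror Sy). Qed.

Let I0 (f : R -> R) : L1seg f -> mu.-integrable setT (EFin \o (fun y => c (0, y) * f y)).
Proof.
move=> fi; apply: (@L1seg_supp _ _ S); first exact: L1seg_mul.
by move=> y /c_out ->; rewrite mul0r.
Qed.

Let mass_identity : \int[mu2]_(x in H) Mr x = - \int[mu]_y (c (0, y) * rho0 y).
Proof.
case: sol => _ _ /(_ c) mass _.
have tc : test_function c by exact: (test_cutoff (T := T)).
have Ir0 := I0 (locally_integrable_L1seg rho0_loc).
have := mass tc; rewrite (RintE measurableT Ir0).
have mc : measurable_fun (H : set T2) c by apply: measurable_funTS; exact: measurable_cutoff.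
have mct : measurable_fun (H : set T2) ct by apply: measurable_funTS; exact: measurable_cutoff_t.
have mcy : measurable_fun (H : set T2) cy by apply: measurable_funTS; exact: measurable_cutoff_y.
have -> : (\int[mu2]_(x in H) (dtime c x * rho x + dspace c x * (- (x.2 / 2) * rho x + n x) -
    2^-1 * c x * rho x)%:E = \int[mu2]_(x in H) (Mr x)%:E)%E.
  rewrite dtime_cutoff // dspace_cutoff //; apply: ae_eq_integral => //.
  - apply/measurable_EFinP; apply: measurable_funB; last first.
      by apply: measurable_funM => //; exact: measurable_funM.
    apply: measurable_funD; first exact: measurable_funM.
    apply: measurable_funM => //; apply: measurable_funD => //; apply: measurable_funM => //.
    exact: measurableT_comp.
  - by case/integrableP: IM.
  - by apply: ae_off => x Nx Hx; rewrite /Mr /rr /nn indC // !mul1r.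
by rewrite (RintE (@measurable_half_plane R) IM) -EFinN => -[] <-; rewrite opprK.
Qed.

Let constant_identity : \int[mu2]_(x in H) Kr x = \int[mu]_y c (0, y).
Proof.
have cst_state := @constant_state R c ct cy S.
have S0 : 0 <= S by rewrite /S /cutoff_size addr_ge0 ?mulr_ge0 ?expR_ge0 // ltW.
have i0 : mu.-integrable setT (EFin \o (fun y => c (0, y))).
  exact: (@integrable_cts_supp _ _ S).
apply/EFin_inj; rewrite -(RintE (@measurable_half_plane R) IK) -(RintE measurableT i0).
apply: cst_state => //.
- by move=> t y; exact: der_cutoff_t.
- by move=> t y; exact: der_cutoff_y.
- by move=> y; exact: cont_slice1.
- by move=> t; exact: cont_slice2.
- by move=> t; exact: cont_slice2.
- move=> x x0 hx; have [] // := @cout x _.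
  by case: hx => hx; [left; rewrite ger0_norm|right].
Qed.

Let eh0 := rel_entropy_init h rhohat rho0 n0.

Let entropy_inequality : \int[mu2]_(x in H) Fr x <=
  \int[mu]_y (c (0, y) * eh0 y) +
  (a * \int[mu]_y (c (0, y) * rho0 y) + b * \int[mu]_y c (0, y)).
Proof.
have tc : test_function c by exact: (test_cutoff (T := T)).
have c0 x : H x -> 0 <= c x.
  by move=> Hx; rewrite mulr_ge0 ?wedge_ge0 // mulr_ge0 ?expR_ge0 // psi_ge0.
have mc : measurable_fun (H : set T2) c by apply: measurable_funTS; exact: measurable_cutoff.
have mct : measurable_fun (H : set T2) ct by apply: measurable_funTS; exact: measurable_cutoff_t.
have mcy : measurable_fun (H : set T2) cy by apply: measurable_funTS; exact: measurable_cutoff_y.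
have msq : measurable_fun (H : set T2) (fun x => sq_over (n x) (rho x)).
  by case: sol => -[_ _ []].
have meta : measurable_fun (H : set T2) (fun x => entropy h x.1 (rho x) (n x)).
  apply: emeasurable_funD; last exact: (measurableT_comp (measurable_potential hpot) mrho).
  apply: emeasurable_funM => //; apply/measurable_EFinP.
  by apply: (@measurable_fst_comp _ (fun t => expR (- t) / 2)); exact: smooth_cont.
have mq : measurable_fun (H : set T2) (fun x => entropy_flux h x.1 (rho x) (n x)).
  apply: emeasurable_funD; last first.
    apply: emeasurable_funM; first exact/measurable_EFinP.
    exact: (measurableT_comp (measurable_dpotential hpot) mrho).
  apply/measurable_EFinP; apply: measurable_funM.
    apply: (@measurable_fst_comp _ (fun t => expR (- t))); apply: smooth_cont.
    apply: (@smooth_comp _ _ _ expR); last exact: smooth_expR.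
    by apply: smoothN; exact: smooth_id.
  apply: measurable_funM; first exact: measurable_funX.
  apply: (measurableT_comp measurable_fun_invr).
  by apply: measurable_funM => //; exact: measurable_funX.
have := EI tc c0; cbv zeta.
have -> : (\int[mu2]_(x in H)
   ((- dtime c x)%:E * entropy h x.1 (rho x) (n x) +
    (dspace c x)%:E * ((x.2 / 2)%:E * entropy h x.1 (rho x) (n x) -
        entropy_flux h x.1 (rho x) (n x)) +
    (c x)%:E * (2^-1%:E * entropy h x.1 (rho x) (n x) +
       alpha%:E * sq_over (n x) (rho x))) = \int[mu2]_(x in H) (Fr x)%:E)%E.
  rewrite dtime_cutoff // dspace_cutoff //; apply: ae_eq_integral => //.
  - apply: emeasurable_funD; first apply: emeasurable_funD.
    + apply: emeasurable_funM => //; apply/measurable_EFinP.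
      exact: measurableT_comp.
    + apply: emeasurable_funM; first exact/measurable_EFinP.
      by apply: emeasurable_funB => //; apply: emeasurable_funM => //; exact/measurable_EFinP.
    + apply: emeasurable_funM; first exact/measurable_EFinP.
      by apply: emeasurable_funD; exact: measurable_funeM.
  - by case/integrableP: IF.
  - apply: ae_off => x Nx Hx.
    by rewrite ent_good // flux_good // sq_good // -!EFinM -!EFinB -!EFinM -!EFinD -!EFinM.
rewrite (RintE (@measurable_half_plane R) IF).
have Ie : mu.-integrable setT (EFin \o eh0).
  exact: rel_entropy_init_integrable plaw hpot rhohat_ge0 aE rho0_loc n0_loc energy0_fin.
have Le : L1seg eh0.
  by move=> m; apply: integrableS Ie => //; exact: measurable_itv.
rewrite (entropy_init_ae plaw hpot rhohat_ge0 aE rho0_loc n0_loc energy0_fin cslice).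
have Lr0 := locally_integrable_L1seg rho0_loc.
have j1 := I0 Le; have j2 := I0 Lr0.
have j3 : mu.-integrable setT (EFin \o (fun y => c (0, y))).
  exact: (@integrable_cts_supp _ _ S).
have k1 := intZ measurableT a j2; have k2 := intZ measurableT b j3.
have k3 := intD measurableT k1 k2.
have j4 := intD measurableT j1 k3.
have -> : (\int[mu]_y (c (0%R, y) * (rel_entropy_init h rhohat rho0 n0 y +
    (a * rho0 y + (h rhohat - a * rhohat))))%:E =
    \int[mu]_y (c (0, y) * eh0 y + (a * (c (0, y) * rho0 y) + b * c (0, y)))%:E)%E.
  by apply: eq_integral => y _; congr EFin; rewrite /eh0 /b; ring.
rewrite (RintE measurableT j4) lee_fin; congr (_ <= _).
by rewrite RintegralD // RintegralD // !RintegralZl.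
Qed.

Lemma localized_bound : (\int[mu2]_(x in H) (Gr x)%:E <=
  (psi 0%R * \int[mu]_y eh0 y)%:E)%E.
Proof.
have mH := @measurable_half_plane R.
have i1 := intZ mH a IM; have i2 := intZ mH b IK.
have i3 := intD mH IF i1; have i4 := intB mH i3 i2.
have mGr : measurable_fun (H : set T2) Gr.
  have mw : measurable_fun (H : set T2) (wedge k L) by apply: measurable_funTS; exact: measurable_wedge.
  have sp : smooth psi by exact: test_function_smooth.
  apply: measurable_funM.
    by apply: (@measurable_fst_comp _ (fun t => expR (t / 2))); apply: smooth_cont; exact: smooth_exp_half.
  apply: measurable_funD; apply: measurable_funM.
  - apply: measurable_funM => //; apply: (@measurable_fst_comp _ (fun t => - derive1 psi t)).
    by apply: smooth_cont; apply: smoothN; exact: smooth_derive1.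
  - by case: Leh => /measurable_EFinP.
  - by apply: measurable_funM => //; apply: measurable_fst_comp; exact: smooth_cont.
  - exact: measurable_funM.
apply: (@le_trans _ _ (\int[mu2]_(x in H) (Fr x + a * Mr x - b * Kr x)%:E)%E).
  apply: ge0_le_integral => //.
  - exact/measurable_EFinP.
  - by case/integrableP: i4.
rewrite (RintE mH i4) lee_fin RintegralB // RintegralD // !RintegralZl //.
rewrite mass_identity constant_identity.
have Ie : mu.-integrable setT (EFin \o eh0).
  exact: rel_entropy_init_integrable plaw hpot rhohat_ge0 aE rho0_loc n0_loc energy0_fin.
have e0 y : 0 <= eh0 y by apply: rel_entropy_init_ge0; [exact: plaw|exact: hpot].
have Le : L1seg eh0.
  by move=> m; apply: integrableS Ie => //; exact: measurable_itv.
have : \int[mu]_y (c (0, y) * eh0 y) <= psi 0 * \int[mu]_y eh0 y.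
  rewrite -RintegralZl //; apply: le_Rintegral => //; first exact: I0.
    exact: intZ.
  move=> y _; rewrite ler_wpM2r // /c /cutoff /= mul0r expR0 mul1r ler_piMr ?psi_ge0 //.
  exact: wedge_le1.
have := entropy_inequality; lra.
Qed.

End fixed_radius.

Let Ginf x := expR (x.1 / 2) *
  (- derive1 psi x.1 * eh x + psi x.1 * (alpha * sqr x)).

Let Gk (k : nat) x := (expR (x.1 / 2) * (- derive1 psi x.1 * wedge k%:R L x * eh x +
  psi x.1 * wedge k%:R L x * (alpha * sqr x)))%:E.

Let GkE k x : Gk k x = (wedge k%:R L x * Ginf x)%:E.
Proof. by rewrite /Gk /Ginf; congr EFin; ring. Qed.

Let Ginf_ge0 x : H x -> 0 <= Ginf x.
Proof.
move=> Hx; have x0 : 0 <= x.1 by exact: Hx.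
rewrite mulr_ge0 ?expR_ge0 // addr_ge0 //; apply: mulr_ge0.
- by rewrite oppr_ge0 dpsi_le0.
- exact: eh_ge0.
- exact: psi_ge0.
- by rewrite mulr_ge0 // sq_ge0.
Qed.

Let mGinf : measurable_fun (H : set T2) Ginf.
Proof.
have sp : smooth psi by exact: test_function_smooth.
apply: measurable_funM.
  by apply: (@measurable_fst_comp _ (fun t => expR (t / 2))); apply: smooth_cont; exact: smooth_exp_half.
apply: measurable_funD; apply: measurable_funM.
- apply: (@measurable_fst_comp _ (fun t => - derive1 psi t)).
  by apply: smooth_cont; apply: smoothN; exact: smooth_derive1.
- by case: Leh => /measurable_EFinP.
- by apply: measurable_fst_comp; exact: smooth_cont.
- exact: measurable_funM.
Qed.

Let mGk k : measurable_fun (H : set T2) (Gk k).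
Proof.
rewrite (_ : Gk k = fun x => (wedge k%:R L x * Ginf x)%:E).
  apply/measurable_EFinP; apply: measurable_funM => //.
  by apply: measurable_funTS; exact: measurable_wedge.
by apply/funext => x; exact: GkE.
Qed.

Let wedge_cvg x : wedge k%:R L x @[k --> \oo] --> (1 : R).
Proof.
have cvy (s : R) : k%:R * expR (- (x.1 / 2)) - L + s @[k --> \oo] --> +oo.
  have e0 := expR_gt0 (- (x.1 / 2)).
  apply/cvgryPge => A; near=> k.
  rewrite -lerBlDr lerBrDr -ler_pdivrMr //.
  by near: k; exact: nbhs_infty_ger.
rewrite -[X in _ --> X]mulr1 /wedge /rad; apply: cvgM.
  exact: (@ebump_cvg _ (fun k => k%:R * expR (- (x.1 / 2)) - L + x.2) (cvy _)).
exact: (@ebump_cvg _ (fun k => k%:R * expR (- (x.1 / 2)) - L - x.2) (cvy _)).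
Unshelve. all: by end_near. Qed.

Let limit_bound : (\int[mu2]_(x in H) (Ginf x)%:E <=
  (psi 0%R * \int[mu]_y rel_entropy_init h rhohat rho0 n0 y)%:E)%E.
Proof.
have mH := @measurable_half_plane R.
have G0 k x : H x -> (0 <= Gk k x)%E.
  move=> Hx; rewrite GkE lee_fin mulr_ge0 ?Ginf_ge0 //; exact: wedge_ge0.
have Gh x : H x -> {homo Gk^~ x : m q / (m <= q)%N >-> (m <= q)%E}.
  move=> Hx m q mq; rewrite !GkE lee_fin ler_wpM2r ?Ginf_ge0 //.
  have rmq : rad m%:R L x.1 <= rad q%:R L x.1.
    by rewrite /rad lerD2r ler_wpM2r ?expR_ge0 // ler_nat.
  by rewrite /wedge ler_pM ?ebump_ge0 // ebump_homo // lerD2r.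
have cv := @cvg_monotone_convergence _ _ R mu2 _ mH Gk mGk G0 Gh.
have Gl x : H x -> limn (Gk^~ x) = (Ginf x)%:E.
  move=> Hx; apply/cvg_lim => //.
  rewrite (_ : Gk^~ x = fun k => (wedge k%:R L x * Ginf x)%:E); last first.
    by apply/funext => k; exact: GkE.
  apply: cvg_EFin; first by near=> k.
  rewrite -[X in _ --> X]mul1r; apply: cvgM; last exact: cvg_cst.
  exact: wedge_cvg.
have -> : (\int[mu2]_(x in H) (Ginf x)%:E = \int[mu2]_(x in H) limn (Gk^~ x))%E.
  by apply: eq_integral => x; rewrite inE => Hx; rewrite Gl.
rewrite -(cvg_lim _ cv) //; apply: lime_le; first exact: cvgP cv.
by near=> k; apply: localized_bound.
Unshelve. all: by end_near. Qed.

Let sq x := sq_over (n x) (rho x).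

(** The cutoff in space is removed by monotone convergence as its radius grows. *)
Lemma local_time_inequality :
  (\int[mu]_(t in `[0%R, +oo[) ((expR (t / 2))%:E * ((- derive1 psi t)%:E *
     rel_energy h t (fun y => rho (t, y)) (fun y => n (t, y)) (cst rhohat) (cst 0%R) +
     (psi t)%:E * (alpha%:E * \int[mu]_y sq^\+ (t, y)))) <=
   (psi 0%R * \int[mu]_y rel_entropy_init h rhohat rho0 n0 y)%:E)%E.
Proof.
have mH := @measurable_half_plane R.
have sp : smooth psi by exact: test_function_smooth.
have msq : measurable_fun (H : set T2) sq by case: sol => -[_ _ []].
have msqp : measurable_fun (H : set T2) sq^\+%E by exact: measurable_funepos.
have mrel := measurable_rel_entropy_at hpot rhohat_ge0 aE mrho msq.
pose re x := rel_entropy_at rhohat h rho n x.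
have re0 x : (0 <= re x)%E by exact: rel_entropy_ge0 plaw hpot.
pose f x := ((expR (x.1 / 2))%:E * ((- derive1 psi x.1)%:E * re x +
   (psi x.1)%:E * (alpha%:E * sq^\+ x)))%E.
have f0 x : H x -> (0 <= f x)%E.
  move=> Hx; have x0 : 0 <= x.1 by exact: Hx.
  rewrite mule_ge0 ?lee_fin ?expR_ge0 // adde_ge0 // !mule_ge0 ?lee_fin ?psi_ge0 //.
  by rewrite oppr_ge0 dpsi_le0.
have mf : measurable_fun (H : set T2) f.
  apply: emeasurable_funM.
    apply/measurable_EFinP; apply: (@measurable_fst_comp _ (fun t => expR (t / 2))).
    by apply: smooth_cont; exact: smooth_exp_half.
  apply: emeasurable_funD; apply: emeasurable_funM => //.
  - apply/measurable_EFinP; apply: (@measurable_fst_comp _ (fun t => - derive1 psi t)).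
    by apply: smooth_cont; apply: smoothN; exact: smooth_derive1.
  - by apply/measurable_EFinP; apply: measurable_fst_comp; exact: smooth_cont.
  - exact: measurable_funeM.
have fG : (\int[mu2]_(x in H) f x = \int[mu2]_(x in H) (Ginf x)%:E)%E.
  apply: ge0_ae_eq_integral => //; first exact/measurable_EFinP.
  apply: ae_off => x Nx Hx; rewrite /f /re /rel_entropy_at rel_good // funeposE /sq sq_good //.
  rewrite (_ : maxe _ 0 = (sqr x)%:E)%E; last first.
    by apply/max_idPl; rewrite lee_fin sq_ge0.
  by rewrite -!EFinM.
apply: le_trans limit_bound; rewrite -fG.
have [_ ->] := tonelli_half_plane mf f0.
rewrite le_eqVlt; apply/orP; left; apply/eqP; apply: eq_integral => t.
rewrite inE /= in_itv /= andbT => t0.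
have mre_t := measurable_section t0 mrel.
have msq_t := measurable_section t0 msqp.
rewrite /f /= ge0_integralZl_EFin ?expR_ge0 //; last 2 first.
- move=> y _; rewrite adde_ge0 // !mule_ge0 ?lee_fin ?psi_ge0 //.
  by rewrite oppr_ge0 dpsi_le0.
- apply: emeasurable_funD; apply: measurable_funeM => //.
  exact: measurable_funeM.
congr (_ * _)%E; rewrite ge0_integralD //; last 4 first.
- by move=> y _; rewrite mule_ge0 // lee_fin oppr_ge0 dpsi_le0.
- exact: measurable_funeM.
- by move=> y _; rewrite !mule_ge0 ?lee_fin ?psi_ge0.
- by apply: measurable_funeM; exact: measurable_funeM.
congr (_ + _)%E.
  by rewrite ge0_integralZl_EFin // oppr_ge0 dpsi_le0.
rewrite ge0_integralZl_EFin ?psi_ge0 //; last 2 first.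
- by move=> y _; rewrite mule_ge0 ?lee_fin.
- exact: measurable_funeM.
by rewrite ge0_integralZl_EFin.
Qed.

End local_case.

Section local_conclusion.
Context {R : realType}.
Local Notation mu := (@lebesgue_measure R).
Local Notation mu2 := (@lebesgue_measure R \x @lebesgue_measure R)%E.
Local Notation T2 := (measurableTypeR R * measurableTypeR R)%type.
Local Notation H := (half_plane R).

Lemma L1box_fin (f : R * R -> \bar R) : L1box f ->
  {ae mu2, forall x, H x -> f x \is a fin_num}.
Proof.
move=> Lf.
have fk (k : nat) : {ae mu2, forall x, box k%:R x -> f x \is a fin_num}.
  by have := integrable_ae (@measurable_box R k%:R) (L1box_box_integrable k%:R Lf).
apply: ae_imply (ae_foralln fk) => x fx Hx; apply: (fx (Num.bound (`|x.1| + `|x.2|))).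
have b0 : 0 <= `|x.1| + `|x.2| by rewrite addr_ge0.
have := archi_boundP b0; set K := Num.bound _ => hK.
have x10 : 0 <= x.1 by exact: Hx.
have h1 : `|x.1| <= K%:R by apply: ltW; apply: le_lt_trans hK; rewrite lerDl.
have h2 : `|x.2| <= K%:R by apply: ltW; apply: le_lt_trans hK; rewrite lerDr.
split; rewrite /= in_itv /=; last by rewrite -ler_norml.
by rewrite x10 (le_trans (ler_norm _) h1).
Qed.

Lemma sq_over_fin (m r : R) : sq_over m r \is a fin_num -> r = 0 -> m = 0.
Proof. by rewrite /sq_over => + r0; rewrite r0 eqxx; case: eqP. Qed.

Variables (alpha rhohat a : R) (p h : R -> R) (rho0 n0 : R -> R) (rho n : R * R -> R).
Hypothesis alpha_ge0 : 0 <= alpha.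
Hypothesis plaw : pressure_law p.
Hypothesis hpot : internal_potential p h.
Hypothesis rhohat_ge0 : 0 <= rhohat.
Hypothesis aE : dpotential h rhohat = a%:E.
Hypothesis relpos : forall r, 0 <= r -> 0 <= rel h rhohat a r.
Hypothesis fluxC : forall M, 0 < M -> exists2 C : R, 0 <= C &
     forall r m, 0 < r -> r <= M -> `|m| <= M * r ->
     `|m * (derive1 h r - a)| <= C * (m ^+ 2 / r + rel h rhohat a r).
Hypothesis rho0_loc : locally_integrable setT rho0.
Hypothesis n0_loc : locally_integrable setT n0.
Hypothesis energy0_fin :
  (rel_energy h 0 rho0 n0 (cst rhohat) (cst 0%R) < +oo)%E.
Hypothesis sol : weak_solution alpha p rho0 n0 rho n.
Let sq x := sq_over (n x) (rho x).

(** For a given cutoff in time, the bounds on density and velocity up to the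
    end of its support give one exceptional null set outside of which all
    pointwise estimates hold. *)
Lemma local_energy_inequality : local_entropy_inequality alpha h rho0 n0 rho n ->
  forall psi : R -> R, test_function psi ->
    (forall t, 0 <= t -> 0 <= psi t) -> (forall t, 0 <= t -> derive1 psi t <= 0) ->
  (\int[mu]_(t in `[0%R, +oo[) ((expR (t / 2))%:E * ((- derive1 psi t)%:E *
     rel_energy h t (fun y => rho (t, y)) (fun y => n (t, y)) (cst rhohat) (cst 0%R) +
     (psi t)%:E * (alpha%:E * \int[mu]_y sq^\+ (t, y)))) <=
   (psi 0%R * \int[mu]_y rel_entropy_init h rhohat rho0 n0 y)%:E)%E.
Proof.
move=> [Lrho Lvel Lpot EI] psi tpsi psi0 dpsi0.
have [T T0 psiT] := test_function_supp tpsi.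
have [M1 HM1] := Lrho T; have [M2 HM2] := Lvel T.
pose M := `|M1| + `|M2| + 1.
have M0 : 0 < M by rewrite ltr_wpDl // addr_ge0.
have M1M : M1 <= M.
  by have := ler_norm M1; have := normr_ge0 M2; rewrite /M; lra.
have M2M : M2 <= M.
  by have := ler_norm M2; have := normr_ge0 M1; rewrite /M; lra.
have [C C0 HC] := fluxC M0.
have [[_ _ Lsq _] rho_ge0 _ _] := sol.
have sqfin := L1box_fin (L1loc_L1box Lsq).
have g1 := ae_imply2 (fun x A B => conj A B) rho_ge0 sqfin.
have g2 := ae_imply2 (fun x A B => conj A B) HM1 HM2.
have [N [mN N0 HN]] := ae_imply2 (fun x A B => conj A B) g1 g2.
apply: (local_time_inequality alpha_ge0 plaw hpot rhohat_ge0 aE relpos rho0_loc n0_loc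
  energy0_fin sol Lpot EI T0 M0 C0 HC mN N0 _ tpsi psi0 dpsi0 psiT).
move=> x Nx Hx.
have [[P1 P2] [P3 P4]] : ((H x -> 0 <= rho x) /\ (H x -> sq_over (n x) (rho x) \is a fin_num)) /\
    ((0 <= x.1 <= T -> `|rho x| <= M1) /\ (0 <= x.1 <= T -> `|n x / rho x| <= M2)).
  by apply: contrapT => nP; apply: Nx; exact: HN.
have r0 := P1 Hx; have rn := sq_over_fin (P2 Hx); split => // xT.
have x0 : 0 <= x.1 by exact: Hx.
have xx : 0 <= x.1 <= T by rewrite x0.
split; first exact: le_trans (le_trans (ler_norm _) (P3 xx)) M1M.
move: r0; rewrite le_eqVlt => /predU1P[r0|r0].
  by rewrite rn // -r0 mulr0 normr0.
have := P4 xx; rewrite normrM normfV (gtr0_norm r0) ler_pdivrMr // => /le_trans; apply.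
by rewrite ler_wpM2r // ltW.
Qed.

End local_conclusion.

(** * Weak derivatives and mollification *)

Section du_bois_reymond.
Context {R : realType}.
Local Notation mu := (@lebesgue_measure R).

Lemma integral_bump_cvg (f : R -> R) (a b c d : R) :
  mu.-integrable `[a, b] (EFin \o f) -> a <= c -> c < d -> d <= b ->
  \int[mu]_(x in `[a, b]) (itv_bump k.+1%:R c d x * f x) @[k --> \oo] -->
  \int[mu]_(x in `]c, d]) f x.
Proof.
move=> fi ac cd db.
have mI : measurable (`[a, b] : set R) by exact: measurable_itv.
have mJ : measurable (`]c, d[ : set R) by exact: measurable_itv.
have mf : measurable_fun (`[a, b] : set R) f by exact: int_measurable fi.
have JI : `]c, d[ `<=` `[a, b].
  move=> x /=; rewrite !in_itv /= => /andP[h1 h2].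
  by rewrite (le_trans ac (ltW h1)) (le_trans (ltW h2) db).
pose fk (k : nat) x := (itv_bump k.+1%:R c d x * f x)%:E.
pose fl x := ((f \_ `]c, d[) x)%:E.
have mfk k : measurable_fun `[a, b] (fk k).
  apply/measurable_EFinP; apply: measurable_funM => //.
  by apply: continuous_measurable; apply: smooth_cont; exact: smooth_itv_bump.
have mfl : measurable_fun `[a, b] fl.
  apply/measurable_EFinP; apply/measurable_restrict => //.
  by apply: measurable_funS mf => // x [].
have nfi : mu.-integrable `[a, b] (EFin \o (fun x => `|f x|)) by exact: integrable_norm.
have cvf x : `[a, b]%classic x -> fk k x @[k --> \oo] --> fl x.
  move=> xI; apply: cvg_EFin; first by near=> k.
  rewrite /fl patchE; case: ifPn => xJ.
    rewrite -[X in _ --> X]mul1r; apply: cvgM; last exact: cvg_cst.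
    by apply: itv_bump_cvg; move: xJ; rewrite inE /= in_itv.
  rewrite (_ : _ \o _ = fun=> 0 : R); last first.
    apply/funext => k; rewrite /fk /= itv_bump_out ?mul0r //.
    move: xJ; rewrite notin_setE /= in_itv /= => /negP; rewrite negb_and -!leNgt.
    by move=> /orP[]; [left|right].
  exact: cvg_cst.
have [] := @dominated_convergence _ _ R mu _ mI fk fl (EFin \o (fun x => `|f x|)) mfk mfl _ nfi.
- exact/aeW.
- apply/aeW => x k xI; rewrite lee_fin normrM ger0_norm ?itv_bump_ge0 //.
  by rewrite ler_piMl // itv_bump_le1.
move=> fli _ cv.
have -> : \int[mu]_(x in `]c, d]) f x = fine (\int[mu]_(x in `[a, b]) fl x).
  have fiJ : mu.-integrable `]c, d[ (EFin \o f) by exact: integrableS fi.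
  rewrite -Rintegral_itv_bndo_bndc // /Rintegral; congr fine.
  rewrite [RHS]integral_mkcond [LHS]integral_mkcond; apply: eq_integral => x _.
  rewrite /fl !patchE; case: ifPn => xJ.
    by rewrite mem_set //; apply: JI; rewrite inE in xJ.
  by case: ifPn.
apply: fine_cvg; rewrite fineK //; exact: integrable_fin_num.
Unshelve. all: by end_near. Qed.

(** The bumps approximate the indicators of subintervals, so the averages of
    such a function vanish. *)
Lemma ae_eq0_of_bumps (f : R -> R) (a b : R) :
  mu.-integrable `[a, b] (EFin \o f) ->
  (forall (k : nat) c d, a <= c -> c < d -> d <= b ->
     \int[mu]_(x in `[a, b]) (itv_bump k.+1%:R c d x * f x) = 0) ->
  {ae mu, forall x, a < x < b -> f x = 0}.
Proof.
move=> fi H0.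
have mI : measurable (`[a, b] : set R) by exact: measurable_itv.
have avg c d : a <= c -> c < d -> d <= b -> \int[mu]_(x in `]c, d]) f x = 0.
  move=> ac cd db; have cv := integral_bump_cvg fi ac cd db.
  apply: (cvg_unique _ cv) => //.
  rewrite (_ : (fun k => _) = fun=> 0); first exact: cvg_cst.
  by apply/funext => k; exact: H0.
have fiN : mu.-integrable `[a, b] (EFin \o (fun x => -1 * f x)) by exact: intZ.
have h1 : {ae mu, forall x, a < x < b -> f x <= 0}.
  by apply: (ae_le_of_averages fi) => c d ac cd db; rewrite avg // mul0r.
have h2 : {ae mu, forall x, a < x < b -> -1 * f x <= 0}.
  apply: (ae_le_of_averages fiN) => c d ac cd db.
  have fic : mu.-integrable `]c, d] (EFin \o f).
    apply: integrableS fi => //.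
    move=> x /=; rewrite !in_itv /= => /andP[x1 x2].
    by rewrite (le_trans ac (ltW x1)) (le_trans x2 db).
  rewrite RintegralZl //.
  by rewrite avg // mulr0 mul0r.
apply: ae_imply2 h1 h2 => x P Q xab.
by apply/le_anti; rewrite P //= -oppr_le0 -mulN1r Q.
Qed.

(** The bumps on intervals are test functions. *)
Lemma ae_eq_of_test (f g : R -> R) : L1seg f -> L1seg g ->
  (forall theta, test_function theta ->
     \int[mu]_x (f x * theta x) = \int[mu]_x (g x * theta x)) ->
  {ae mu, forall x, f x = g x}.
Proof.
move=> fi gi H.
have seg (k : nat) : {ae mu, forall x, - k%:R < x < k%:R -> f x - g x = 0}.
  have fgi : mu.-integrable `[- k%:R, k%:R] (EFin \o (fun x => f x - g x)).
    by apply: intB; [exact: measurable_itv|exact: fi|exact: gi].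
  apply: (ae_eq0_of_bumps fgi) => m c d kc cd dk.
  pose th := itv_bump m.+1%:R c d.
  have th_out x : ~ `[- k%:R, k%:R]%classic x -> th x = 0.
    move=> /= /negP; rewrite in_itv /= negb_and -!ltNge => /orP[h|h].
      by apply: itv_bump_out => //; left; lra.
    by apply: itv_bump_out => //; right; lra.
  have tth : test_function th.
    apply: (@test_function1 _ _ k%:R); first exact: smooth_itv_bump.
    by move=> x kx; apply: th_out; rewrite /= in_itv /= -ler_norml; apply/negP; rewrite -ltNge.
  have cth : continuous th by apply: smooth_cont; exact: smooth_itv_bump.
  have loc (q : R -> R) : \int[mu]_x (q x * th x) = \int[mu]_(x in `[- k%:R, k%:R]) (th x * q x).
    rewrite [RHS]Rintegral_mkcond; apply: eq_Rintegral => x _.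
    rewrite patchE; case: ifPn => [_|]; first exact: mulrC.
    by rewrite notin_setE => /th_out ->; rewrite mulr0.
  have := H th tth; rewrite !loc => e.
  have i1 := L1seg_mul cth fi k%:R; have i2 := L1seg_mul cth gi k%:R.
  have -> : \int[mu]_(x in `[- k%:R, k%:R]) (th x * (f x - g x)) =
    \int[mu]_(x in `[- k%:R, k%:R]) (th x * f x - th x * g x).
    by apply: eq_Rintegral => x _; rewrite mulrBr.
  by rewrite RintegralB // e subrr.
apply: ae_imply (ae_foralln seg) => x Hx.
have : - (Num.bound `|x|)%:R < x < (Num.bound `|x|)%:R.
  by rewrite -ltr_norml; exact: archi_boundP.
by move=> /Hx /eqP; rewrite subr_eq0 => /eqP.
Qed.

End du_bois_reymond.

Section convolution.
Context {R : realType}.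
Local Notation mu := (@lebesgue_measure R).

Lemma test_bounded (e : R -> R) : test_function e ->
  exists2 C : R, 0 <= C & forall x, `|e x| <= C.
Proof.
move=> te; have [A A0 eA] := test_function_supp te.
have AA : - A <= A by lra.
have ce : {within `[- A, A], continuous e}.
  by apply: continuous_subspaceT; apply: smooth_cont; exact: test_function_smooth.
have [C C0 HC] := bounded_on_segment AA ce.
exists C => // x; have [xA|xA] := leP `|x| A; last by rewrite eA ?normr0.
by apply: HC; rewrite -ler_norml.
Qed.

Lemma test_derive1 (e : R -> R) : test_function e -> test_function (derive1 e).
Proof.
move=> te; have [A A0 eA] := test_function_supp te.
apply: (@test_function1 _ _ A); first exact/smooth_derive1/test_function_smooth.
by move=> x; exact: (derive1_out eA).
Qed.

Variables (f : R -> R) (K : R).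
Hypothesis cf : continuous f.
Hypothesis K0 : 0 < K.

Definition conv (e : R -> R) (x : R) : R := \int[mu]_(u in `[- K, K]) (f u * e (x - u)).

Let mI : measurable (`[- K, K] : set R). Proof. exact: measurable_itv. Qed.

Lemma cont_reflect (e : R -> R) (x : R) : continuous e -> continuous (fun u => e (x - u)).
Proof.
move=> ce u; have cr : {for u, continuous (fun u => x - u)}.
  by apply: cvgB; [exact: cvg_cst|exact: cvg_id].
exact: (cvg_comp _ _ cr (@ce (x - u))).
Qed.

Lemma conv_integrand (e : R -> R) (x : R) : continuous e ->
  mu.-integrable `[- K, K] (EFin \o (fun u => f u * e (x - u))).
Proof.
move=> ce; apply: continuous_integrable_itv => u.
by apply: cvgM; [exact: cf|exact: cont_reflect].
Qed.

Lemma der_shift (e : R -> R) (x u : R) : smooth e ->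
  is_derive x 1 (fun x => e (x - u)) (derive1 e (x - u)).
Proof.
move=> se; have d := der_sub (der_id x) (der_cst u x).
have de := derivable_der (smooth_derivable (x := x - u) se).
by apply: is_derive_eq (@der_comp _ e (fun y => y - u) _ _ _ de d) _; rewrite subr0 mulr1.
Qed.

Lemma der_conv (e : R -> R) (x : R) : test_function e ->
  is_derive x 1 (conv e) (conv (derive1 e) x).
Proof.
move=> te; have se : smooth e by exact: test_function_smooth.
have ce : continuous e by exact: smooth_cont.
have [C C0 HC] := test_bounded (test_derive1 te).
pose F z u := f u * e (z - u).
have dF (z u : R) : is_derive z 1 (fun z => F z u) (f u * derive1 e (z - u)).
  by apply: is_derive_eq (der_mul (der_cst (f u) z) (der_shift z u se)) _; rewrite mulr0 addr0.
have xI : `]x - 1, x + 1[%classic x by rewrite /= in_itv /=; lra.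
have intF z : `]x - 1, x + 1[%classic z -> mu.-integrable `[- K, K] (EFin \o F z).
  by move=> _; exact: conv_integrand.
have derF z u : `]x - 1, x + 1[%classic z -> `[- K, K]%classic u -> derivable (F ^~ u) z 1.
  by move=> _ _; exact: der_derivable (dF z u).
pose G u := `|f u| * C.
have G0 u : 0 <= G u by rewrite mulr_ge0.
have intG : mu.-integrable `[- K, K] (EFin \o G).
  apply: continuous_integrable_itv => u; apply: cvgM; last exact: cvg_cst.
  exact: (cvg_norm (@cf u)).
have pE z u : partial1of2 F z u = f u * derive1 e (z - u).
  by rewrite /partial1of2 (der_derive1 (dF z u)).
have G_ub z u : `]x - 1, x + 1[%classic z -> `[- K, K]%classic u -> `|partial1of2 F z u| <= G u.
  by move=> _ _; rewrite pE normrM ler_wpM2l.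
have d1 := @derivable_under_integral R _ _ mu F _ mI x _ _ xI intF derF G G0 intG G_ub.
have d2 := @differentiation_under_integral R _ _ mu F _ mI x _ _ xI intF derF G G0 intG G_ub.
apply: DeriveDef; first exact: d1.
rewrite -derive1E; transitivity (\int[mu]_(u in `[- K, K]) partial1of2 F x u).
  exact: d2.
by apply: eq_Rintegral => u _; exact: pE.
Qed.

(** The test function takes all the derivatives. *)
Lemma smooth_conv (e : R -> R) : test_function e -> smooth (conv e).
Proof.
move=> te k; elim: k e te => [|k IH] e te.
  move=> x; exact: der_continuous (der_conv x te).
apply: is_Ck_derive1 => [x|].
  exact: der_derivable (der_conv x te).
rewrite (_ : derive1 _ = conv (derive1 e)); first by apply: IH; exact: test_derive1.
by apply/funext => x; exact: der_derive1 (der_conv x te).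
Qed.

End convolution.

Section mollification.
Context {R : realType}.
Local Notation mu := (@lebesgue_measure R).

Let b := itv_bump (1 : R) (-1) 1.
Let I := \int[mu]_x b x.
Let I0 : 0 < I. Proof. by apply: itv_bump_int_gt0; lra. Qed.
Let sb : smooth b. Proof. exact: smooth_itv_bump. Qed.
Let cb : continuous b. Proof. exact: smooth_cont. Qed.
Let b_out x : x <= -1 \/ 1 <= x -> b x = 0. Proof. exact: itv_bump_out. Qed.

Definition mollifier (j : nat) (x : R) : R :=
  (\int[mu]_x itv_bump (1 : R) (-1) 1 x)^-1 * j.+1%:R * itv_bump 1 (-1) 1 (j.+1%:R * x).

Lemma mollifier_ge0 j x : 0 <= mollifier j x.
Proof.
apply: mulr_ge0; last exact: itv_bump_ge0.
by apply: mulr_ge0 => //; rewrite invr_ge0; exact: ltW I0.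
Qed.

Lemma mollifier_out j x : j.+1%:R^-1 <= `|x| -> mollifier j x = 0.
Proof.
move=> jx; have j0 : 0 < j.+1%:R :> R by [].
have h : 1 <= j.+1%:R * `|x| by rewrite mulrC -ler_pdivrMr // mul1r.
have hh : j.+1%:R * x <= -1 \/ 1 <= j.+1%:R * x.
  have : 1 <= `|j.+1%:R * x| by rewrite normrM (gtr0_norm j0).
  by rewrite ler_normr => /orP[]; [right|left; lra].
by have := b_out hh; rewrite /b /mollifier => ->; rewrite mulr0.
Qed.

Lemma smooth_mollifier j : smooth (mollifier j).
Proof.
have sx : smooth (fun x : R => j.+1%:R * x).
  by apply: smoothM; [exact: smooth_cst|exact: smooth_id].
have sc := smooth_comp sx sb.
rewrite /mollifier; apply: smoothM; first exact: smooth_cst.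
exact: sc.
Qed.

Lemma test_mollifier j : test_function (mollifier j).
Proof.
apply: (@test_function1 _ _ 1); first exact: smooth_mollifier.
move=> x x1; apply: mollifier_out; apply: le_trans (ltW x1).
by rewrite invf_le1 // ler1n.
Qed.

Let Phi := primitive b.

(** The mass is computed with a primitive of the bump, which spares a change of
    variables in the integral. *)
Lemma mollifier_mass (K : R) j x : 0 < K ->
  \int[mu]_(u in `[- K, K]) mollifier j (x - u) =
  I^-1 * (Phi (j.+1%:R * (x + K)) - Phi (j.+1%:R * (x - K))).
Proof.
move=> K0; pose P u := - (I^-1 * Phi (j.+1%:R * (x - u))).
have dP (u : R) : is_derive u 1 P (mollifier j (x - u)).
  have d1 := der_mul (der_cst j.+1%:R u) (der_sub (der_cst x u) (der_id u)).
  have d2 := @der_comp _ Phi _ _ _ _ (der_primitive cb b_out _) d1.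
  apply: is_derive_eq (der_opp (der_mul (der_cst I^-1 u) d2)) _.
  by rewrite /mollifier -/b -/I; ring.
have cm : continuous (fun u => mollifier j (x - u)).
  by apply: cont_reflect; apply: smooth_cont; exact: smooth_mollifier.
have KK : - K < K by lra.
transitivity (P K - P (- K)); first by rewrite {1}/Rintegral (ftc_itv KK dP cm).
by rewrite /P !opprK; ring.
Qed.

Lemma mollifier_mass_le1 (K : R) j x : 0 < K ->
  \int[mu]_(u in `[- K, K]) mollifier j (x - u) <= 1.
Proof.
move=> K0; rewrite mollifier_mass // mulrC ler_pdivrMr // mul1r.
have b0 y : 0 <= b y by exact: itv_bump_ge0.
have h1 : Phi (j.+1%:R * (x + K)) <= I by exact: (primitive_le_int cb b_out).
have h2 : 0 <= Phi (j.+1%:R * (x - K)) by apply: Rintegral_ge0.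
lra.
Qed.

Lemma mollifier_mass1 (K : R) j x : 0 < K -> `|x| <= K - 1 ->
  \int[mu]_(u in `[- K, K]) mollifier j (x - u) = 1.
Proof.
move=> K0; rewrite ler_norml => /andP[x1 x2]; rewrite mollifier_mass //.
have j1 : 1 <= j.+1%:R :> R by rewrite ler1n.
have h1 : 1 <= j.+1%:R * (x + K) by rewrite -[leLHS]mulr1 ler_pM //; lra.
have h2 : 1 <= j.+1%:R * (K - x) by rewrite -[leLHS]mulr1 ler_pM //; lra.
rewrite /Phi (primitive_ge b_out h1) (primitive_le b_out); last first.
  by rewrite -opprB mulrN lerN2.
by rewrite subr0 mulVf // gt_eqF.
Qed.

Lemma conv_bound (f : R -> R) (K B : R) j x : continuous f -> 0 < K -> 0 <= B ->
  (forall u, `|f u| <= B) -> `|conv f K (mollifier j) x| <= B.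
Proof.
move=> cf K0 B0 fB; have cm : continuous (mollifier j) by apply: smooth_cont; exact: smooth_mollifier.
have mI : measurable (`[- K, K] : set R) by exact: measurable_itv.
have im : mu.-integrable `[- K, K] (EFin \o (fun u => mollifier j (x - u))).
  by apply: continuous_integrable_itv; exact: cont_reflect.
have ifm := conv_integrand K cf x cm.
apply: le_trans (le_normr_Rintegral _ _) _ => //.
apply: le_trans (_ : \int[mu]_(u in `[- K, K]) (B * mollifier j (x - u)) <= _).
  apply: le_Rintegral => //; [exact: integrable_norm|exact: intZ|].
  by move=> u _; rewrite normrM (ger0_norm (mollifier_ge0 _ _)) ler_wpM2r ?mollifier_ge0.
by rewrite RintegralZl // ler_piMr // mollifier_mass_le1.
Qed.

Lemma conv_cvg (f : R -> R) (K : R) x : continuous f -> 0 < K ->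
  `|x| <= K - 1 -> conv f K (mollifier j) x @[j --> \oo] --> f x.
Proof.
move=> cf K0 xK; apply/cvgrPdist_le => e e0.
have /cvgrPdist_le/(_ e e0) := @cf x.
move=> /nbhs_ballP[d /= d0 Hd].
near=> j.
have jd : j.+1%:R^-1 < d.
  near: j; exact: (near_infty_natSinv_lt (PosNum d0)).
have cm : continuous (mollifier j) by apply: smooth_cont; exact: smooth_mollifier.
have mI : measurable (`[- K, K] : set R) by exact: measurable_itv.
have cmr : continuous (fun u => mollifier j (x - u)) by exact: cont_reflect.
have im : mu.-integrable `[- K, K] (EFin \o (fun u => mollifier j (x - u))).
  exact: continuous_integrable_itv.
have ifm := conv_integrand K cf x cm.
have -> : f x = \int[mu]_(u in `[- K, K]) (f x * mollifier j (x - u)).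
  by rewrite RintegralZl // mollifier_mass1 // mulr1.
rewrite /conv -RintegralB //; last exact: intZ.
have idiff : mu.-integrable `[- K, K] (EFin \o (fun u => f x * mollifier j (x - u) - f u * mollifier j (x - u))).
  by apply: intB => //; exact: intZ.
apply: le_trans (le_normr_Rintegral _ _) _ => //.
apply: le_trans (_ : \int[mu]_(u in `[- K, K]) (e * mollifier j (x - u)) <= _).
  apply: le_Rintegral => //; [exact: integrable_norm|exact: intZ|].
  move=> u _; rewrite -mulrBl normrM (ger0_norm (mollifier_ge0 _ _)).
  have [xu|xu] := ltP `|x - u| j.+1%:R^-1; last by rewrite mollifier_out // !mulr0.
  rewrite ler_wpM2r ?mollifier_ge0 //; apply: Hd.
  by rewrite /ball /= (lt_trans xu).
by rewrite RintegralZl // mollifier_mass1 // mulr1.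
Unshelve. all: by end_near. Qed.

(** The mass equation only admits smooth factors; this extends it to factors of
    class C^1, the uniform bounds being those that dominated convergence needs. *)
Lemma mollify (g dg : R -> R) (r : R) : 0 < r ->
  (forall x : R, is_derive x 1 g (dg x)) -> continuous dg ->
  (forall x, r < `|x| -> g x = 0) ->
  exists (G : nat -> R -> R) (B : R),
    [/\ forall j, test_function (G j),
        forall j x, r + 1 < `|x| -> G j x = 0,
        forall j x, `|G j x| <= B /\ `|derive1 (G j) x| <= B,
        forall x, G j x @[j --> \oo] --> g x &
        forall x, derive1 (G j) x @[j --> \oo] --> dg x].
Proof.
move=> r0 gd dgc gr; pose K := r + 2; have K0 : 0 < K by rewrite /K; lra.
have cg : continuous g.
  move=> x; exact: der_continuous (gd x).
have dgr x : r < `|x| -> dg x = 0.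
  by move=> rx; rewrite -(der_derive1 (gd x)) (derive1_out gr).
have rr : - r <= r by lra.
have bnd (f : R -> R) : continuous f -> (forall x, r < `|x| -> f x = 0) ->
    exists2 B : R, 0 <= B & forall x, `|f x| <= B.
  move=> cf fr; have cw : {within `[- r, r], continuous f} by exact: continuous_subspaceT.
  have [B B0 HB] := bounded_on_segment rr cw; exists B => // x.
  by have [xr|xr] := leP `|x| r; [apply: HB; rewrite -ler_norml|rewrite fr ?normr0].
have [B1 B10 HB1] := bnd g cg gr; have [B2 B20 HB2] := bnd dg dgc dgr.
pose G j := conv g K (mollifier j).
have dG j x : derive1 (G j) x = conv dg K (mollifier j) x.
  rewrite (der_derive1 (der_conv K cg x (test_mollifier j))).
  have sm := @smooth_mollifier j; have cm : continuous (mollifier j) by exact: smooth_cont.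
  have cm' : continuous (derive1 (mollifier j)) by apply: smooth_cont; exact: smooth_derive1.
  pose F u := g u * mollifier j (x - u).
  have dF (u : R) : is_derive u 1 F (dg u * mollifier j (x - u) - g u * derive1 (mollifier j) (x - u)).
    have d1 := der_sub (der_cst x u) (der_id u).
    have d2 := @der_comp _ _ (fun u => x - u) _ _ _ (derivable_der (smooth_derivable (x := x - u) sm)) d1.
    by apply: is_derive_eq (der_mul (gd u) d2) _; ring.
  have i1 := conv_integrand K dgc x cm; have i2 := conv_integrand K cg x cm'.
  have cF : continuous (fun u => dg u * mollifier j (x - u) - g u * derive1 (mollifier j) (x - u)).
    move=> u; apply: cvgB; apply: cvgM; [exact: dgc|exact: cont_reflect|exact: cg|exact: cont_reflect].
  have KK : - K < K by lra.
  have mI : measurable (`[- K, K] : set R) by exact: measurable_itv.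
  have e0 : \int[mu]_(u in `[- K, K]) (dg u * mollifier j (x - u) - g u * derive1 (mollifier j) (x - u)) = 0.
    rewrite /Rintegral (ftc_itv KK dF cF) /= /F !gr ?mul0r ?subrr //.
      by rewrite normrN gtr0_norm // /K; lra.
    by rewrite gtr0_norm // /K; lra.
  by move: e0; rewrite RintegralB // => /eqP; rewrite subr_eq0 => /eqP.
have out (f : R -> R) j x : (forall x, r < `|x| -> f x = 0) -> r + 1 < `|x| ->
    conv f K (mollifier j) x = 0.
  move=> fr rx; rewrite /conv (_ : \int[mu]_(u in _) _ = \int[mu]_(u in `[- K, K]) 0).
    by rewrite Rintegral_cst ?mul0r //; exact: measurable_itv.
  apply: eq_Rintegral => u _; have [ur|ur] := leP `|u| r; last by rewrite fr // mul0r.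
  rewrite mollifier_out ?mulr0 //.
  have j1 : j.+1%:R^-1 <= 1 :> R by rewrite invf_le1 // ler1n.
  by apply: (le_trans j1); have := ler_normD (x - u) u; rewrite subrK; lra.
exists G, (B1 + B2); split.
- move=> j; apply: (@test_function1 _ _ (r + 1)).
    by apply: smooth_conv => //; exact: test_mollifier.
  by move=> x; exact: out.
- by move=> j x; exact: out.
- move=> j x; rewrite dG; split.
    by apply: le_trans (conv_bound _ _ cg K0 B10 HB1) _; rewrite lerDl.
  by apply: le_trans (conv_bound _ _ dgc K0 B20 HB2) _; rewrite lerDr.
- move=> x; have [xr|xr] := leP `|x| (r + 1).
    by apply: conv_cvg => //; rewrite /K; lra.
  rewrite gr; last lra.
  rewrite (_ : (fun j => _) = fun=> 0); first exact: cvg_cst.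
  by apply/funext => j; exact: out.
- move=> x; rewrite (_ : (fun j => _) = fun j => conv dg K (mollifier j) x); last first.
    by apply/funext => j; exact: dG.
  have [xr|xr] := leP `|x| (r + 1).
    by apply: conv_cvg => //; rewrite /K; lra.
  rewrite dgr; last lra.
  rewrite (_ : (fun j => _) = fun=> 0); first exact: cvg_cst.
  by apply/funext => j; exact: out.
Qed.

End mollification.

(** * Truncation *)

Section truncation.
Context {R : realType}.

(** A substitute of class C^1 for the positive part: it is within [e] of it and
    its slope lies between [0] and [1]. *)
Definition soft_pos (e u : R) : R := if 0 < u then u ^+ 2 / (u + e) else 0.
Definition dsoft_pos (e u : R) : R := if 0 < u then 1 - (e / (u + e)) ^+ 2 else 0.

Lemma soft_pos_le0 e u : u <= 0 -> soft_pos e u = 0.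
Proof. by rewrite /soft_pos ltNge => ->. Qed.

Lemma dsoft_pos_le0 e u : u <= 0 -> dsoft_pos e u = 0.
Proof. by rewrite /dsoft_pos ltNge => ->. Qed.

Section fixed_width.
Variable e : R.
Hypothesis e0 : 0 < e.

Lemma soft_pos_bounds u : 0 <= u -> u - e <= soft_pos e u <= u.
Proof.
have e_gt0 := e0.
rewrite /soft_pos; case: ifPn => [u0 _|]; last by rewrite -leNgt => h1 h2; apply/andP; split; lra.
have ue : 0 < u + e by lra.
by rewrite ler_pdivlMr // ler_pdivrMr //; apply/andP; split; nra.
Qed.

Lemma dsoft_pos_bounds u : 0 <= dsoft_pos e u <= 1.
Proof.
have e_gt0 := e0.
rewrite /dsoft_pos; case: ifPn => [u0|_]; last by rewrite lexx ler01.
have ue : 0 < u + e by lra.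
have h0 : 0 <= e / (u + e) by rewrite divr_ge0 ?ltW.
have h1 : e / (u + e) <= 1 by rewrite ler_pdivrMr // mul1r; lra.
by apply/andP; split; nra.
Qed.

Lemma dsoft_pos_lip u : 0 <= dsoft_pos e u <= 2 / e * `|u|.
Proof.
have e_gt0 := e0.
rewrite /dsoft_pos; case: ifPn => [u0|_]; last by rewrite lexx mulr_ge0 // divr_ge0 // ltW.
have ue : 0 < u + e by lra.
rewrite gtr0_norm //.
have -> : 1 - (e / (u + e)) ^+ 2 = u * (u + 2 * e) / (u + e) ^+ 2.
  by field; exact: lt0r_neq0.
apply/andP; split.
  by rewrite divr_ge0 ?exprn_ge0 //; [nra|lra].
rewrite ler_pdivrMr ?exprn_gt0 //.
rewrite (_ : 2 / e * u * _ = u * (2 * (u + e) ^+ 2 / e)); last by field; exact: lt0r_neq0.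
rewrite ler_pM2l // ler_pdivlMr //; nra.
Qed.

(** Hence the slope tends to [1] at fixed [u > 0] when [e] tends to [0]. *)
Lemma dsoft_pos_ge u u0 : 0 < u0 -> u0 <= u -> 1 - dsoft_pos e u <= e / u0.
Proof.
have e_gt0 := e0.
move=> u00 uu; rewrite /dsoft_pos (lt_le_trans u00 uu).
have ue : 0 < u + e by lra.
have h0 : 0 <= e / (u + e) by rewrite divr_ge0 ?ltW.
have h1 : e / (u + e) <= 1 by rewrite ler_pdivrMr // mul1r; lra.
have h2 : e / (u + e) <= e / u0.
  by rewrite ler_pM2l // lef_pV2 ?posrE //; lra.
nra.
Qed.

Lemma der_soft_pos (u : R) : is_derive u 1 (soft_pos e) (dsoft_pos e u).
Proof.
have e_gt0 := e0.
have [u0|u0|->] := ltgtP u 0.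
- rewrite dsoft_pos_le0 ?ltW //; apply: near_eq_is_derive (der_cst 0 u).
  by near=> y; rewrite soft_pos_le0 // ltW //; near: y; exact: lt_nbhsl.
- have ue : u + e != 0 by rewrite gt_eqF //; lra.
  have d1 := der_add (der_id u) (der_cst e u).
  have d2 := @der_comp _ (fun y : R => y^-1) (fun y => y + e) _ _ _ (der_inv ue) d1.
  have d3 := der_mul (der_mul (der_id u) (der_id u)) d2.
  have d4 : is_derive u 1 (fun y => y * y * (y + e)^-1) (dsoft_pos e u).
    by apply: is_derive_eq d3 _; rewrite /dsoft_pos u0; field.
  apply: near_eq_is_derive d4.
  near=> y; rewrite /soft_pos ifT ?expr2 //.
  by near: y; exact: lt_nbhsr.
- rewrite dsoft_pos_le0 //; apply: (@der0_sq _ _ e^-1); first by rewrite invr_ge0 ltW.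
  move=> x _; rewrite /soft_pos; case: ifPn => [x0|_]; last first.
    by rewrite normr0 mulr_ge0 ?sqr_ge0 // invr_ge0 ltW.
  have xe : 0 < x + e by lra.
  rewrite ger0_norm; last by rewrite divr_ge0 ?sqr_ge0 // ltW.
  rewrite [leLHS]mulrC; apply: ler_wpM2r; first exact: sqr_ge0.
  by rewrite lef_pV2 ?posrE //; lra.
Unshelve. all: by end_near. Qed.

Lemma dsoft_pos_cont : continuous (dsoft_pos e).
Proof.
have e_gt0 := e0.
move=> u; have [u0|u0|->] := ltgtP u 0.
- rewrite /continuous_at dsoft_pos_le0 ?ltW //.
  have c0 : (fun=> 0 : R) x @[x --> u] --> (0 : R) by exact: cvg_cst.
  apply: (cvg_trans _ c0); apply: near_eq_cvg.
  by near=> y; rewrite dsoft_pos_le0 // ltW //; near: y; exact: lt_nbhsl.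
- have ue : u + e != 0 by rewrite gt_eqF //; lra.
  rewrite /continuous_at {2}/dsoft_pos u0.
  have c1 : (fun y => 1 - (e / (y + e)) ^+ 2) x @[x --> u] --> 1 - (e / (u + e)) ^+ 2.
    apply: cvgB; first exact: cvg_cst.
    have c2 : e / (y + e) @[y --> u] --> e / (u + e).
      apply: cvgM; first exact: cvg_cst.
      by apply: cvgV => //; apply: cvgD; [exact: cvg_id|exact: cvg_cst].
    by rewrite expr2; under eq_fun do rewrite expr2; exact: cvgM.
  apply: (cvg_trans _ c1); apply: near_eq_cvg.
  by near=> y; rewrite /dsoft_pos ifT //; near: y; exact: lt_nbhsr.
- rewrite /continuous_at dsoft_pos_le0 //; apply/cvgr0Pnorm_le => d d0.
  near=> x; have /andP[h1 h2] := dsoft_pos_lip x.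
  rewrite ger0_norm //; apply: (le_trans h2).
  rewrite -ler_pdivlMl ?divr_gt0 //.
  near: x; apply: (@nbhs0_le _ R^o); rewrite mulr_gt0 // invr_gt0 divr_gt0 //.
Unshelve. all: by end_near. Qed.

End fixed_width.

Variables (f df : R -> R).
Hypothesis fd : forall z : R, 0 < z -> is_derive z 1 f (df z).
Hypothesis dfc : forall z : R, 0 < z -> {for z, continuous df}.
Hypothesis df_gt0 : forall z : R, 0 < z -> 0 < df z.

Lemma incr_on_pos (x y : R) : 0 < x -> x < y -> f x < f y.
Proof.
move=> x0 xy; have [|c /andP[xc _] e] := @mvt_der _ f df _ _ xy.
  by move=> z /andP[xz _]; apply: fd; exact: lt_le_trans xz.
by rewrite -subr_gt0 e mulr_gt0 ?subr_gt0 // df_gt0 // (lt_trans x0).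
Qed.

Lemma nondecr_on_pos (x y : R) : 0 < x -> x <= y -> f x <= f y.
Proof. by move=> x0; rewrite le_eqVlt => /predU1P[->//|/(incr_on_pos x0)/ltW]. Qed.

(** [f] levelled off below [1/(k+1)], shifted by [f (1/(k+1))]: this removes
    a possible singularity of [f] at [0] and stays of class C^1. *)
Definition trunc (k : nat) (z : R) : R :=
  if k.+1%:R^-1 < z then soft_pos k.+1%:R^-1 (f z - f k.+1%:R^-1) else 0.
Definition dtrunc (k : nat) (z : R) : R :=
  if k.+1%:R^-1 < z then dsoft_pos k.+1%:R^-1 (f z - f k.+1%:R^-1) * df z else 0.

Let ek (k : nat) : 0 < k.+1%:R^-1 :> R. Proof. by rewrite invr_gt0. Qed.

Lemma truncE k z : 0 < z -> trunc k z = soft_pos k.+1%:R^-1 (f z - f k.+1%:R^-1).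
Proof.
move=> z0; rewrite /trunc; case: ifPn => //; rewrite -leNgt => zk.
by rewrite soft_pos_le0 // subr_le0 nondecr_on_pos.
Qed.

Lemma dtruncE k z : 0 < z ->
  dtrunc k z = dsoft_pos k.+1%:R^-1 (f z - f k.+1%:R^-1) * df z.
Proof.
move=> z0; rewrite /dtrunc; case: ifPn => //; rewrite -leNgt => zk.
by rewrite dsoft_pos_le0 ?mul0r // subr_le0 nondecr_on_pos.
Qed.

Lemma trunc_le0 k z : z <= 0 -> trunc k z = 0.
Proof. by move=> z0; rewrite /trunc ltNge (le_trans z0) // ltW. Qed.

Lemma dtrunc_le0 k z : z <= 0 -> dtrunc k z = 0.
Proof. by move=> z0; rewrite /dtrunc ltNge (le_trans z0) // ltW. Qed.

Lemma der_trunc k (z : R) : is_derive z 1 (trunc k) (dtrunc k z).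
Proof.
have [z0|zk] := ltP 0 z; last first.
  rewrite dtrunc_le0 //; apply: near_eq_is_derive (der_cst 0 z).
  near=> y; rewrite /trunc ltNge ltW //.
  by near: y; apply: lt_nbhsl; exact: le_lt_trans zk _.
rewrite dtruncE //.
have d1 := der_sub (fd z0) (der_cst (f k.+1%:R^-1) z).
have d2 := @der_comp _ _ (fun y => f y - f k.+1%:R^-1) _ _ _ (der_soft_pos (ek k) _) d1.
rewrite subr0 in d2; apply: near_eq_is_derive d2.
by near=> y; rewrite truncE //; near: y; exact: lt_nbhsr.
Unshelve. all: by end_near. Qed.

Lemma dtrunc_cont k : continuous (dtrunc k).
Proof.
move=> z; have [z0|zk] := ltP 0 z; last first.
  rewrite /continuous_at dtrunc_le0 //.
  have c0 : (fun=> 0 : R) x @[x --> z] --> (0 : R) by exact: cvg_cst.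
  apply: (cvg_trans _ c0); apply: near_eq_cvg.
  near=> y; rewrite /dtrunc [in RHS]ltNge ltW //.
  by near: y; apply: lt_nbhsl; exact: le_lt_trans zk _.
rewrite /continuous_at dtruncE //.
have fc : {for z, continuous f}.
  exact: der_continuous (fd z0).
have c1 : f y - f k.+1%:R^-1 @[y --> z] --> f z - f k.+1%:R^-1.
  by apply: cvgB; [exact: fc|exact: cvg_cst].
have c2 : dsoft_pos k.+1%:R^-1 (f y - f k.+1%:R^-1) * df y @[y --> z] -->
    dsoft_pos k.+1%:R^-1 (f z - f k.+1%:R^-1) * df z.
  by apply: cvgM; [exact: (cvg_comp _ _ c1 (@dsoft_pos_cont _ (ek k) _))|exact: dfc].
apply: (cvg_trans _ c2); apply: near_eq_cvg.
by near=> y; rewrite dtruncE //; near: y; exact: lt_nbhsr.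
Unshelve. all: by end_near. Qed.

Lemma dtrunc_bounds k z : 0 < z -> 0 <= dtrunc k z <= df z.
Proof.
move=> z0; rewrite dtruncE //.
have /andP[h1 h2] := dsoft_pos_bounds (ek k) (f z - f k.+1%:R^-1).
by have := df_gt0 z0; move=> h; apply/andP; split; nra.
Qed.

Lemma trunc_near k z : 0 < z ->
  Num.max (f z) (f k.+1%:R^-1) - k.+1%:R^-1 <= trunc k z + f k.+1%:R^-1
  <= Num.max (f z) (f k.+1%:R^-1).
Proof.
move=> z0; rewrite truncE //; have := ek k; move: (k.+1%:R^-1) => e e0.
have [h|h] := leP (f z) (f e).
  by rewrite soft_pos_le0 ?subr_le0 //; apply/andP; split; lra.
have fz : 0 <= f z - f e by lra.
by have /andP[h1 h2] := soft_pos_bounds e0 fz; apply/andP; split; lra.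
Qed.

Lemma trunc_cvg z : 0 < z -> trunc k z + f k.+1%:R^-1 @[k --> \oo] --> f z.
Proof.
move=> z0; apply/cvgrPdist_le => e e0; near=> k.
have kz : k.+1%:R^-1 < z by near: k; exact: (near_infty_natSinv_lt (PosNum z0)).
have ke : k.+1%:R^-1 < e by near: k; exact: (near_infty_natSinv_lt (PosNum e0)).
have := trunc_near k z0; rewrite max_l; last by apply: nondecr_on_pos => //; exact: ltW.
move: ke (trunc k z); move: (k.+1%:R^-1) => d ke t /andP[h1 h2].
by rewrite ler_distlC; apply/andP; split; lra.
Unshelve. all: by end_near. Qed.

Lemma dtrunc_cvg z : 0 < z -> dtrunc k z @[k --> \oo] --> df z.
Proof.
move=> z0; rewrite -[X in _ --> X]mul1r.
rewrite (_ : (fun k => _) = fun k => dsoft_pos k.+1%:R^-1 (f z - f k.+1%:R^-1) * df z); last first.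
  by apply/funext => k; rewrite dtruncE.
apply: cvgM; last exact: cvg_cst.
pose u0 := f z - f (z / 2).
have u00 : 0 < u0 by rewrite subr_gt0 incr_on_pos //; lra.
apply/cvgrPdist_le => e e0; near=> k.
have kz : k.+1%:R^-1 < z / 2.
  by near: k; apply: (near_infty_natSinv_lt (PosNum _)); lra.
have ke : k.+1%:R^-1 < e * u0.
  by near: k; apply: (near_infty_natSinv_lt (PosNum _)); rewrite mulr_gt0.
have /andP[_ h1] := dsoft_pos_bounds (ek k) (f z - f k.+1%:R^-1).
rewrite ger0_norm ?subr_ge0 //; apply: le_trans (dsoft_pos_ge (ek k) u00 _) _.
  by rewrite /u0 lerB // nondecr_on_pos // ltW.
by rewrite ler_pdivrMr // ltW.
Unshelve. all: by end_near. Qed.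

End truncation.

(** * The reference profile *)

Section real_dominated_convergence.
Context d (T : measurableType d) {R : realType} (mu : {measure set T -> \bar R}).

Lemma dominated_cvg_real (D : set T) (fk : nat -> T -> R) (f g : T -> R) :
  measurable D ->
  (forall k, measurable_fun D (fk k)) -> measurable_fun D f ->
  mu.-integrable D (EFin \o g) ->
  {ae mu, forall x, D x -> fk k x @[k --> \oo] --> f x} ->
  {ae mu, forall x, D x -> forall k, `|fk k x| <= g x} ->
  [/\ mu.-integrable D (EFin \o f), (forall k, mu.-integrable D (EFin \o fk k)) &
    \int[mu]_(x in D) fk k x @[k --> \oo] --> \int[mu]_(x in D) f x].
Proof.
move=> mD mfk mf gi fkf fkg.
have mE k : measurable_fun D (EFin \o fk k) by exact/measurable_EFinP.
have mfE : measurable_fun D (EFin \o f) by exact/measurable_EFinP.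
have fki k : mu.-integrable D (EFin \o fk k).
  apply/integrableP; split => //.
  case/integrableP: (gi) => mg; apply: le_lt_trans.
  apply: ae_ge0_le_integral => //.
  - by apply: measurableT_comp.
  - by apply: measurableT_comp.
  - apply: ae_imply fkg => x H Dx; rewrite lee_fin.
    by apply: le_trans (H Dx k) _; exact: ler_norm.
have [] := @dominated_convergence _ _ R mu _ mD (fun k => EFin \o fk k) (EFin \o f) (EFin \o g) mE mfE _ gi _.
- by apply: ae_imply fkf => x H Dx; apply: cvg_EFin; [near=> k|exact: H].
- by apply: ae_imply fkg => x H k Dx; rewrite lee_fin H.
move=> fi _ cv; split => //; apply: fine_cvg.
by rewrite fineK //; exact: integrable_fin_num.
Unshelve. all: by end_near. Qed.

Lemma dominated_integral_limit (D : set T) (fk : nat -> T -> R) (f g : T -> R) (I : nat -> R) (L : R) :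
  measurable D ->
  (forall k, measurable_fun D (fk k)) -> measurable_fun D f ->
  mu.-integrable D (EFin \o g) ->
  {ae mu, forall x, D x -> fk k x @[k --> \oo] --> f x} ->
  {ae mu, forall x, D x -> forall k, `|fk k x| <= g x} ->
  (forall k, mu.-integrable D (EFin \o fk k) -> \int[mu]_(x in D) fk k x = I k) ->
  I k @[k --> \oo] --> L ->
  mu.-integrable D (EFin \o f) /\ \int[mu]_(x in D) f x = L.
Proof.
move=> mD mfk mf gi fkf fkg II IL.
have [fi fki cv] := dominated_cvg_real mD mfk mf gi fkf fkg.
split=> //; apply: (cvg_unique _ cv) => //.
by rewrite (_ : (fun k => _) = I) //; apply/funext => k; exact: II.
Qed.

End real_dominated_convergence.

Section profile.
Context {R : realType}.
Local Notation mu := (@lebesgue_measure R).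
Variables (p h rhoi w : R -> R).
Hypothesis plaw : pressure_law p.
Hypothesis hpot : internal_potential p h.
Hypothesis C1 : is_Ck 1 rhoi.
Hypothesis rhoi_ge0 : forall y, 0 <= rhoi y.
Hypothesis Ww : weak_derivative (fun y => dpotential h (rhoi y)) w.
Local Notation h1 := (derive1 h).
Local Notation h2 := (derive1 (derive1 h)).
Local Notation drhoi := (derive1 rhoi).

Lemma der_rhoi (y : R) : is_derive y 1 rhoi (drhoi y).
Proof. by apply: derivable_der; have [] := is_Ck1 C1. Qed.

Lemma drhoi_cont : continuous drhoi.
Proof. by have [] := is_Ck1 C1. Qed.

Lemma rhoi_cont : continuous rhoi.
Proof.
move=> y; exact: der_continuous (der_rhoi y).
Qed.

Lemma h2_cont z : 0 < z -> {for z, continuous h2}.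
Proof. by case: hpot => _ _ + _; exact. Qed.

(** The classical derivative of [h' o rhoi] where it exists, and [0] at the
    vacuum. *)
Definition slope (y : R) : R := if 0 < rhoi y then h2 (rhoi y) * drhoi y else 0.

Let Tk k y := trunc h1 k (rhoi y).
Let dTk k y := dtrunc h1 h2 k (rhoi y) * drhoi y.
Let dh1 := der_h1 hpot.
Let h2p := h2_gt0 plaw hpot.

Lemma der_trunc_profile (f df : R -> R) k (y : R) :
  (forall z : R, 0 < z -> is_derive z 1 f (df z)) -> (forall z : R, 0 < z -> 0 < df z) ->
  is_derive y 1 (fun y => trunc f k (rhoi y)) (dtrunc f df k (rhoi y) * drhoi y).
Proof. by move=> fd df0; exact: der_comp (der_trunc fd df0 k _) (der_rhoi y). Qed.

Lemma dtrunc_profile_cont (f df : R -> R) k :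
  (forall z : R, 0 < z -> is_derive z 1 f (df z)) -> (forall z : R, 0 < z -> 0 < df z) ->
  (forall z, 0 < z -> {for z, continuous df}) ->
  continuous (fun y => dtrunc f df k (rhoi y) * drhoi y).
Proof.
move=> fd df0 dfc y; apply: cvgM; last exact: drhoi_cont.
exact: (cvg_comp _ _ (@rhoi_cont y) (@dtrunc_cont _ f df fd dfc df0 k (rhoi y))).
Qed.

Lemma der_Tk k (y : R) : is_derive y 1 (Tk k) (dTk k y).
Proof. by apply: der_trunc_profile. Qed.

Lemma dTk_cont k : continuous (dTk k).
Proof. by apply: dtrunc_profile_cont => //; exact: h2_cont. Qed.

Lemma dTk_le k y : `|dTk k y| <= `|slope y|.
Proof.
rewrite /dTk /slope; have := rhoi_ge0 y; rewrite le_eqVlt => /predU1P[<-|y0].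
  by rewrite dtrunc_le0 // mul0r normr0 normr_ge0.
rewrite y0 !normrM; apply: ler_wpM2r => //.
have /andP[d0 d1] := dtrunc_bounds dh1 h2p k y0.
by rewrite !ger0_norm // (le_trans d0).
Qed.

Lemma dTk_cvg y : dTk k y @[k --> \oo] --> slope y.
Proof.
rewrite /dTk /slope; have := rhoi_ge0 y; rewrite le_eqVlt => /predU1P[<-|y0].
  rewrite ltxx; under eq_fun do rewrite dtrunc_le0 // mul0r.
  exact: cvg_cst.
rewrite y0; apply: cvgM; last exact: cvg_cst.
exact: dtrunc_cvg dh1 h2p _ y0.
Qed.

Lemma measurable_slope : measurable_fun (setT : set R) slope.
Proof.
apply: (measurable_fun_cvg (h := dTk)) => [k|y _]; last exact: dTk_cvg.
by apply: continuous_measurable; exact: dTk_cont.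
Qed.

Lemma glue_cont (q theta : R -> R) c d : continuous theta ->
  (forall y, c <= y <= d -> {for y, continuous q}) ->
  (forall y, y < c \/ d < y -> theta y = 0) -> continuous (fun y => q y * theta y).
Proof.
move=> ct cq t0 y; have [ycd|] := boolP (c <= y <= d).
  by apply: cvgM; [exact: cq|exact: ct].
rewrite negb_and -!ltNge => yn.
have yn' : y < c \/ d < y by apply/orP.
rewrite /continuous_at (t0 _ yn') mulr0.
have c0 : (fun=> 0 : R) x @[x --> y] --> (0 : R) by exact: cvg_cst.
apply: (cvg_trans _ c0); apply: near_eq_cvg.
case: yn' => yn'; near=> z.
  by rewrite t0 ?mulr0 //; left; near: z; exact: lt_nbhsl.
by rewrite t0 ?mulr0 //; right; near: z; exact: lt_nbhsr.
Unshelve. all: by end_near. Qed.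

Lemma slope_cont y : 0 < rhoi y -> {for y, continuous slope}.
Proof.
move=> y0; suff : slope z @[z --> y] --> slope y by [].
have -> : slope y = h2 (rhoi y) * drhoi y by rewrite /slope y0.
have c1 : h2 (rhoi z) * drhoi z @[z --> y] --> h2 (rhoi y) * drhoi y.
  apply: cvgM; last exact: drhoi_cont.
  exact: (cvg_comp _ _ (@rhoi_cont y) (h2_cont y0)).
apply: (cvg_trans _ c1); apply: near_eq_cvg.
near=> z; rewrite /slope ifT //; near: z.
by apply: (cvgr_gt _ (@rhoi_cont y)).
Unshelve. all: by end_near. Qed.

Lemma der_h1_rhoi (y : R) : 0 < rhoi y -> is_derive y 1 (fun y => h1 (rhoi y)) (slope y).
Proof.
move=> y0; have := @der_comp _ h1 rhoi _ _ _ (dh1 y0) (der_rhoi y).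
by rewrite /slope y0.
Qed.

Lemma w_L1seg : L1seg w.
Proof.
case: Ww => _ [mw wK] _ M; apply/integrableP; split; first exact: measurable_funTS mw.
by apply: wK => //; exact: segment_compact.
Qed.

Lemma W_integrable M : mu.-integrable `[- M, M] (fun y => dpotential h (rhoi y)).
Proof.
case: Ww => [[mW WK] _ _]; apply/integrableP; split; first exact: measurable_funTS mW.
by apply: WK => //; exact: segment_compact.
Qed.

(** There [h' o rhoi] is of class C^1, and integration by parts against bumps
    identifies its weak derivative. *)
Lemma weak_slope_local c d : (forall y, c <= y <= d -> 0 < rhoi y) ->
  {ae mu, forall x, c < x < d -> w x = slope x}.
Proof.
move=> pos; have [cd|dc] := ltP c d; last first.
  by apply: aeW => x /andP[h1' h2']; lra.
have mI : measurable (`[c, d] : set R) by exact: measurable_itv.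
have vi : mu.-integrable `[c, d] (EFin \o slope).
  apply: continuous_compact_integrable; first exact: segment_compact.
  apply: continuous_in_subspaceT => x; rewrite inE /= in_itv /= => xcd.
  by apply: slope_cont; exact: pos.
have wi : mu.-integrable `[c, d] (EFin \o w).
  pose M := `|c| + `|d|.
  have mM : measurable (`[- M, M] : set R) by exact: measurable_itv.
  apply: integrableS (w_L1seg M) => // x /=; rewrite !in_itv /= => /andP[cx xd].
  have hc : - c <= `|c| by rewrite -normrN ler_norm.
  have := ler_norm d; have := normr_ge0 c; have := normr_ge0 d; rewrite /M.
  by move=> *; apply/andP; split; lra.
have fi : mu.-integrable `[c, d] (EFin \o (fun x => w x - slope x)) by exact: intB.
have H0 : {ae mu, forall x, c < x < d -> w x - slope x = 0}.
  apply: (ae_eq0_of_bumps fi) => k c' d' cc' c'd' dd'.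
  pose th := itv_bump k.+1%:R c' d'.
  have sth : smooth th by exact: smooth_itv_bump.
  have cth : continuous th by exact: smooth_cont.
  have cth' : continuous (derive1 th) by apply: smooth_cont; exact: smooth_derive1.
  have th0 y : y < c \/ d < y -> th y = 0.
    by move=> [yc|dy]; apply: itv_bump_out => //; [left|right]; lra.
  have dth0 y : y < c \/ d < y -> derive1 th y = 0.
    move=> yo; apply: der_derive1; apply: near_eq_is_derive (der_cst 0 y).
    case: yo => yo; near=> z; rewrite th0 //.
      by left; near: z; exact: lt_nbhsl.
    by right; near: z; exact: lt_nbhsr.
  pose A := `|c| + `|d|.
  have inA y : A < `|y| -> y < c \/ d < y.
    rewrite /A => Ay; have hd := ler_norm d; have hc := ler_norm (- c); rewrite normrN in hc.
    have := normr_ge0 c; have := normr_ge0 d; move=> *.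
    move: Ay; have [y0|y0] := leP 0 y; [rewrite (ger0_norm y0)|rewrite (ltr0_norm y0)].
      by move=> ?; right; lra.
    by move=> ?; left; lra.
  have tth : test_function th.
    by apply: (@test_function1 _ _ A) => // y /inA; exact: th0.
  pose q y := h1 (rhoi y).
  have cq y : c <= y <= d -> {for y, continuous q}.
    move=> ycd; exact: der_continuous (der_h1_rhoi (pos _ ycd)).
  pose G y := slope y * th y + q y * derive1 th y.
  have cG : continuous G.
    move=> y; apply: cvgD.
      by apply: (@glue_cont _ _ c d) => // z zcd; apply: slope_cont; exact: pos.
    exact: (@glue_cont _ _ c d).
  have dG (y : R) : is_derive y 1 (fun y => q y * th y) (G y).
    have [ycd|] := boolP (c <= y <= d).
      apply: is_derive_eq (der_mul (der_h1_rhoi (pos _ ycd)) (derivable_der (smooth_derivable (x := y) sth))) _.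
      by rewrite /G /q; ring.
    rewrite negb_and -!ltNge => yn.
    have yn' : y < c \/ d < y by apply/orP.
    rewrite /G th0 // dth0 // !mulr0 addr0; apply: near_eq_is_derive (der_cst 0 y).
    case: yn' => yn'; near=> z.
      by rewrite th0 ?mulr0 //; left; near: z; exact: lt_nbhsl.
    by rewrite th0 ?mulr0 //; right; near: z; exact: lt_nbhsr.
  have G0 : (\int[mu]_x (G x)%:E = 0)%E.
    by apply: (ftc_line (T := A) dG cG) => y /inA yo; rewrite th0 ?mulr0.
  have [_ _ /(_ th tth) wth] := Ww.
  have iv : mu.-integrable setT (EFin \o (fun y => slope y * th y)).
    apply: (@integrable_cts_supp _ _ A); first exact: measurableT.
      by apply: (@glue_cont _ _ c d) => // z zcd; apply: slope_cont; exact: pos.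
    by move=> y /inA yo; rewrite th0 ?mulr0.
  have iq : mu.-integrable setT (EFin \o (fun y => q y * derive1 th y)).
    apply: (@integrable_cts_supp _ _ A); first exact: measurableT.
      exact: (@glue_cont _ _ c d).
    by move=> y /inA yo; rewrite dth0 ?mulr0.
  have iw : mu.-integrable setT (EFin \o (fun y => w y * th y)).
    have i0 : mu.-integrable setT (EFin \o (fun y => th y * w y)).
      apply: (@L1seg_supp _ _ A); first exact: L1seg_mul cth w_L1seg.
      by move=> y /inA yo; rewrite th0 ?mul0r.
    by apply: eq_integrable i0 => // y _ /=; rewrite mulrC.
  have e1 : - (\int[mu]_y (w y * th y)) = \int[mu]_y (q y * derive1 th y).
    apply: EFin_inj; rewrite EFinN -!RintE // -wth; apply: eq_integral => y _.
    have [ycd|] := boolP (c <= y <= d); first by rewrite dpotential_gt0 ?EFinM // pos.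
    rewrite negb_and -!ltNge => /orP yn.
    by rewrite dth0 // mule0 mulr0.
  have e2 : (\int[mu]_y (slope y * th y)) + (\int[mu]_y (q y * derive1 th y)) = 0.
    by rewrite -RintegralD // /Rintegral G0.
  transitivity (\int[mu]_y (w y * th y - slope y * th y)).
    rewrite [LHS]Rintegral_mkcond; apply: eq_Rintegral => x _.
    rewrite patchE; case: ifPn => [_|]; first by rewrite mulrBr mulrC (mulrC (th x)).
    rewrite notin_setE /= in_itv /= => /negP; rewrite negb_and -!ltNge => /orP yn.
    by rewrite th0 // !mulr0 subrr.
  move/eqP: e2; rewrite -e1 subr_eq0 => /eqP e2.
  by rewrite RintegralB // -e2 subrr.
by apply: ae_imply H0 => x H /H /eqP; rewrite subr_eq0 => /eqP.
Unshelve. all: by end_near. Qed.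

(** A countable family of intervals covers the set where the profile is
    positive. *)
Lemma weak_slope_pos : {ae mu, forall x, 0 < rhoi x -> w x = slope x}.
Proof.
pose P (n : nat) x := forall c d : rat, unpickle n = Some (c, d) ->
  (forall y, ratr c <= y <= ratr d -> 0 < rhoi y) -> ratr c < x < ratr d -> w x = slope x.
have HP (n : nat) : {ae mu, forall x, P n x}.
  rewrite /P; case: (unpickle n) => [[c d]|]; last by apply: aeW.
  have [pos|npos] := pselect (forall y, ratr c <= y <= ratr d -> 0 < rhoi y).
    by apply: ae_imply (weak_slope_local pos) => x H c' d' [<- <-] _; exact: H.
  by apply: aeW => x c' d' [<- <-].
apply: ae_imply (ae_foralln HP) => x Hx x0.
have : \forall y \near x, 0 < rhoi y by apply: (cvgr_gt _ (@rhoi_cont x)).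
move=> /nbhs_ballP[e /= e0 He].
have xe1 : x - e < x by lra.
have xe2 : x < x + e by lra.
have [c] := rat_in_itvoo xe1.
rewrite in_itv /= => /andP[c1 c2].
have [d'] := rat_in_itvoo xe2.
rewrite in_itv /= => /andP[d1 d2].
apply: (Hx (pickle (c, d')) c d'); first by rewrite pickleK.
  move=> y /andP[cy yd]; apply: He; rewrite /ball /= ltr_distlC.
  by apply/andP; split; lra.
by rewrite c2.
Qed.

Lemma slope_L1seg : L1seg slope.
Proof.
move=> M; have mI : measurable (`[- M, M] : set R) by exact: measurable_itv.
have wi := w_L1seg M; apply/integrableP; split.
  by apply/measurable_EFinP; exact: measurable_funTS measurable_slope.
case/integrableP: (wi) => mw; apply: le_lt_trans.
apply: ae_ge0_le_integral => //.
- apply: measurableT_comp => //; apply/measurable_EFinP.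
  exact: measurable_funTS measurable_slope.
- by apply: measurableT_comp.
- apply: ae_imply weak_slope_pos => x H _; rewrite lee_fin.
  have [x0|x0] := ltP 0 (rhoi x); first by rewrite H.
  by rewrite /slope ltNge x0 normr0.
Qed.

Let ck (k : nat) := h1 k.+1%:R^-1.

Lemma natSinv_at_right : k.+1%:R^-1 @[k --> \oo] --> (0 : R)^'+.
Proof.
move=> A; rewrite /at_right /= => /nbhs_ballP[e /= e0 He].
suff : \forall k \near \oo, A k.+1%:R^-1 by [].
near=> k; apply: He => //=; rewrite /ball /= sub0r normrN ger0_norm ?invr_ge0 //.
by near: k; exact: (near_infty_natSinv_lt (PosNum e0)).
Unshelve. all: by end_near. Qed.

Lemma ck_cvg (l : R) : dpotential h 0 = l%:E -> ck k @[k --> \oo] --> l.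
Proof.
move=> e0; have := dpotential0_cvg plaw hpot; rewrite e0 => cv.
exact: (cvg_comp _ _ natSinv_at_right (fine_cvg cv)).
Qed.

Lemma trunc_level_cvg (z l : R) : 0 <= z -> dpotential h z = l%:E ->
  trunc h1 k z + ck k @[k --> \oo] --> l.
Proof.
rewrite le_eqVlt => /predU1P[<- /ck_cvg|z0].
  by under [in X in _ -> X]eq_fun do rewrite trunc_le0 // add0r.
rewrite dpotential_gt0 // => -[<-].
exact: trunc_cvg dh1 h2p _ z0.
Qed.

Lemma trunc_level_le (z l : R) k : 0 <= z -> dpotential h z = l%:E ->
  `|trunc h1 k z + ck k| <= `|l| + `|h1 1| + 1.
Proof.
have k1 : k.+1%:R^-1 <= 1 :> R by rewrite invf_le1 // ler1n.
have k0 : 0 < k.+1%:R^-1 :> R by rewrite invr_gt0.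
have c1 : ck k <= h1 1 by apply: (h1_le plaw hpot).
have hn := ler_norm (h1 1); have ln := ler_norm (- l); rewrite normrN in ln.
have ln2 := ler_norm l; have hn0 := normr_ge0 (h1 1); have ln0 := normr_ge0 l.
rewrite le_eqVlt => /predU1P[<-|z0] lE.
  rewrite trunc_le0 // add0r.
  have := dpotential0_le plaw hpot k0; rewrite lE lee_fin -/(ck k) => lc.
  by rewrite ler_norml; apply/andP; split; lra.
move: lE; rewrite dpotential_gt0 // => -[lE].
have := trunc_near dh1 h2p k z0; rewrite -/(ck k) lE.
move: k1 k0 c1; rewrite -/(ck k); move: (k.+1%:R^-1) (ck k) (trunc h1 k z) => e c t k1 k0 c1 /andP[t1 t2].
rewrite ler_norml; have [lc|cl] := leP l c.
  by move: t1 t2; rewrite max_r // => t1 t2; apply/andP; split; lra.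
by move: t1 t2; rewrite (max_l (ltW cl)) => t1 t2; apply/andP; split; lra.
Qed.

(** The truncations of [h' o rhoi] have slopes that vanish at the vacuum and are
    dominated by [slope]; in the limit the weak derivative has no part there. *)
Lemma weak_slopeE : {ae mu, forall x, w x = slope x}.
Proof.
apply: ae_eq_of_test; [exact: w_L1seg|exact: slope_L1seg|].
move=> th tth; have sth := test_function_smooth tth.
have cth : continuous th by exact: smooth_cont.
have cth' : continuous (derive1 th) by apply: smooth_cont; exact: smooth_derive1.
have [A A0 thA] := test_function_supp tth.
have dthA x : A < `|x| -> derive1 th x = 0 by exact: derive1_out.
have AA : - A <= A by lra.
have mI : measurable (`[- A, A] : set R) by exact: measurable_itv.
have nI x : ~ `[- A, A]%classic x -> A < `|x|.
  by rewrite /= in_itv /= -ler_norml => /negP; rewrite -ltNge.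
have Wi := W_integrable A.
pose q y := fine (dpotential h (rhoi y)).
have iq : mu.-integrable `[- A, A] (EFin \o q) by exact: integrable_fine_comp Wi.
have cw (f : R -> R) : continuous f -> {within `[- A, A], continuous f}.
  by exact: continuous_subspaceT.
have [B B0 HB] := bounded_on_segment AA (cw _ cth).
have [B' B'0 HB'] := bounded_on_segment AA (cw _ cth').
have fin : {ae mu, forall x, `[- A, A]%classic x -> dpotential h (rhoi x) \is a fin_num}.
  by apply: integrable_ae.
pose fk k y := dTk k y * th y + (Tk k y + ck k) * derive1 th y.
pose f y := slope y * th y + q y * derive1 th y.
pose g y := B * `|slope y| + B' * (`|q y| + `|h1 1| + 1).
have mq : measurable_fun (`[- A, A] : set R) q by exact: int_measurable iq.
have cTk k : continuous (Tk k).
  move=> y; exact: der_continuous (der_Tk k y).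
have cfk k : continuous (fk k).
  move=> y; apply: cvgD; apply: cvgM; [exact: dTk_cont|exact: cth| |exact: cth'].
  by apply: cvgD; [exact: cTk|exact: cvg_cst].
have i1 : mu.-integrable `[- A, A] (EFin \o (fun y => th y * slope y)).
  exact: L1seg_mul cth slope_L1seg A.
have i2 : mu.-integrable `[- A, A] (EFin \o (fun y => derive1 th y * q y)).
  apply: (@int_dom _ _ _ mu _ mI _ (fun x => B' * q x)).
  - by apply: measurable_funM => //; exact: continuous_measurable.
  - by move=> x xA; rewrite !normrM ler_wpM2r // (ger0_norm B'0) HB' // -in_itv.
  - by apply: intZ.
have [] := @dominated_integral_limit _ _ R mu `[- A, A] fk f g (fun=> 0) 0 mI.
- by move=> k; apply: continuous_measurable.
- apply: measurable_funD; apply: measurable_funM => //; try exact: continuous_measurable.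
  exact: measurable_funTS measurable_slope.
- apply: intD => //; apply: intZ => //.
    by apply: integrable_norm => //; exact: slope_L1seg.
  apply: intD => //; last by apply: cts_L1seg; exact: cst_continuous.
  apply: intD => //; last by apply: cts_L1seg; exact: cst_continuous.
  exact: integrable_norm.
- apply: ae_imply fin => y /[apply] yfin; apply: cvgD; apply: cvgM; try exact: cvg_cst.
    exact: dTk_cvg.
  by apply: trunc_level_cvg => //; rewrite fineK.
- apply: ae_imply fin => y H yI k; have yfin := H yI.
  have yA : - A <= y <= A by move: yI; rewrite /= in_itv.
  apply: le_trans (ler_normD _ _) _; apply: lerD.
    by rewrite normrM [leLHS]mulrC; apply: ler_pM => //; [exact: HB|exact: dTk_le].
  rewrite normrM [leLHS]mulrC; apply: ler_pM => //; first exact: HB'.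
  by apply: trunc_level_le => //; rewrite fineK.
- move=> k _.
  have dG (y : R) : is_derive y 1 (fun y => (Tk k y + ck k) * th y) (fk k y).
    apply: is_derive_eq (der_mul (der_add (der_Tk k y) (der_cst (ck k) y)) (derivable_der (smooth_derivable (x := y) sth))) _.
    by rewrite /fk; ring.
  have : (\int[mu]_x (fk k x)%:E = 0)%E.
    by apply: (ftc_line (T := A) dG (cfk k)) => y yA; rewrite thA ?mulr0.
  rewrite (@integral_restrict_itv _ _ `[- A, A]) //; first by rewrite /Rintegral => ->.
  by move=> x _ /nI xA; rewrite /fk thA // dthA // !mulr0 addr0.
- exact: cvg_cst.
move=> fi f0.
have e1 : (\int[mu]_(x in `[- A, A]) (th x * slope x)) +
    (\int[mu]_(x in `[- A, A]) (derive1 th x * q x)) = 0.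
  rewrite -RintegralD // -f0; apply: eq_Rintegral => x _.
  by rewrite /f mulrC (mulrC (q x)).
have loc (u z : R -> R) : (forall x, A < `|x| -> z x = 0) ->
    \int[mu]_x (u x * z x) = \int[mu]_(x in `[- A, A]) (z x * u x).
  move=> z0; rewrite (@Rintegral_supp _ _ A); first by apply: eq_Rintegral => x _; rewrite mulrC.
  by move=> x /z0 ->; rewrite mulr0.
rewrite !loc //; have [_ _ /(_ th tth)] := Ww.
have i3 : mu.-integrable `[- A, A] (EFin \o (fun y => th y * w y)).
  exact: L1seg_mul cth w_L1seg A.
rewrite (@integral_restrict_itv _ _ `[- A, A]) //; last first.
  by move=> x _ /nI xA; rewrite dthA // mule0.
rewrite [X in _ = (- X)%E -> _](@integral_restrict_itv _ _ `[- A, A]) //; last first.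
  by move=> x _ /nI xA; rewrite thA // mulr0.
have -> : (\int[mu]_(x in `[(- A)%R, A]) (w x * th x)%:E = (\int[mu]_(x in `[(- A)%R, A]) (th x * w x))%:E)%E.
  by rewrite -RintE //; apply: eq_integral => x _; rewrite mulrC.
have -> : (\int[mu]_(x in `[(- A)%R, A]) (dpotential h (rhoi x) * (derive1 th x)%:E) =
    (\int[mu]_(x in `[(- A)%R, A]) (derive1 th x * q x))%:E)%E.
  rewrite -RintE //; apply: ae_eq_integral => //.
  - apply: emeasurable_funM; first by case/integrableP: Wi.
    by apply/measurable_EFinP; exact: continuous_measurable.
  - by case/integrableP: i2.
  - by apply: ae_imply fin => x /[apply] xfin; rewrite mulrC EFinM fineK.
rewrite -EFinN => -[e2]; move/eqP: e1; rewrite e2 subr_eq0 => /eqP e1.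
by rewrite e1.
Qed.

End profile.

Section compact_profile.
Context {R : realType}.
Local Notation mu := (@lebesgue_measure R).
Variables (p h rhoi w : R -> R) (rhohat a r : R).
Hypothesis plaw : pressure_law p.
Hypothesis hpot : internal_potential p h.
Hypothesis rhohat_ge0 : 0 <= rhohat.
Hypothesis aE : dpotential h rhohat = a%:E.
Hypothesis C1 : is_Ck 1 rhoi.
Hypothesis rhoi_ge0 : forall y, 0 <= rhoi y.
Hypothesis r0 : 0 < r.
Hypothesis rhoi_out : forall y, r < `|y| -> rhoi y = rhohat.
Hypothesis Ww : weak_derivative (fun y => dpotential h (rhoi y)) w.
Local Notation h1 := (derive1 h).
Local Notation h2 := (derive1 (derive1 h)).
Local Notation drhoi := (derive1 rhoi).
Local Notation v := (slope h rhoi).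

Let dh1 := der_h1 hpot.
Let h2p := h2_gt0 plaw hpot.
Let h2c := h2_cont hpot.
Let ek (k : nat) := k.+1%:R^-1 : R.

Lemma drhoi_out y : r < `|y| -> drhoi y = 0.
Proof.
move=> yr; have h0 z : r < `|z| -> rhoi z - rhohat = 0 by move=> /rhoi_out ->; rewrite subrr.
have := der_derive1 (der_sub (der_rhoi C1 y) (der_cst rhohat y)).
by rewrite (derive1_out h0 yr) subr0.
Qed.

Lemma slope_out y : r < `|y| -> v y = 0.
Proof. by move=> yr; rewrite /slope drhoi_out // mulr0; case: ifP. Qed.

Lemma slope_integrable : mu.-integrable setT (EFin \o v).
Proof. exact: L1seg_supp (slope_L1seg plaw hpot C1 rhoi_ge0 Ww) slope_out. Qed.

Definition slope_mass : R := \int[mu]_y `|v y|.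

Lemma slope_mass_ge0 : 0 <= slope_mass.
Proof. by apply: Rintegral_ge0. Qed.

(** Approximations of class C^1 of [h'(rhoi) - h'(rhohat)], defined below as
    [gap]. *)
Definition gapk k y : R := trunc h1 k (rhoi y) - trunc h1 k rhohat.
Definition dgapk k y : R := dtrunc h1 h2 k (rhoi y) * drhoi y.

Lemma der_gapk k (y : R) : is_derive y 1 (gapk k) (dgapk k y).
Proof.
have d := der_sub (der_trunc_profile C1 k y dh1 h2p) (der_cst (trunc h1 k rhohat) y).
by rewrite subr0 in d.
Qed.

Lemma dgapk_cont k : continuous (dgapk k).
Proof. by apply: dtrunc_profile_cont. Qed.

Lemma gapk_out k y : r < `|y| -> gapk k y = 0.
Proof. by move=> /rhoi_out; rewrite /gapk => ->; rewrite subrr. Qed.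

Lemma dgapk_le k y : `|dgapk k y| <= `|v y|.
Proof. exact: dTk_le plaw hpot rhoi_ge0 k y. Qed.

Lemma dgapk_cvg y : dgapk k y @[k --> \oo] --> v y.
Proof. exact: dTk_cvg plaw hpot rhoi_ge0 y. Qed.

(** The truncations vanish far away and their total variation is at most that
    of [h' o rhoi]. *)
Lemma gapk_le k y : `|gapk k y| <= slope_mass.
Proof.
have r0' := r0.
have [yr|yr] := ltP r `|y|; first by rewrite gapk_out // normr0 slope_mass_ge0.
have ry : - r - 1 < y by move: yr; rewrite ler_norml; lra.
have mI : measurable (`[- r - 1, y] : set R) by exact: measurable_itv.
have di : mu.-integrable `[- r - 1, y] (EFin \o dgapk k).
  by apply: continuous_integrable_itv; exact: dgapk_cont.
have e1 : gapk k y = \int[mu]_(x in `[- r - 1, y]) dgapk k x.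
  rewrite /Rintegral (ftc_itv ry (der_gapk k) (@dgapk_cont k)) /=.
  rewrite [gapk k (_ - _)]gapk_out ?subr0 //.
  by rewrite -opprB opprK normrN ger0_norm; lra.
rewrite e1; apply: le_trans (le_normr_Rintegral _ _) _ => //.
have vi := slope_integrable.
have viS : mu.-integrable `[- r - 1, y] (EFin \o v) by apply: integrableS vi.
apply: le_trans (_ : \int[mu]_(x in `[- r - 1, y]) `|v x| <= _).
  apply: le_Rintegral => //; try exact: integrable_norm.
  by move=> x _; exact: dgapk_le.
rewrite /slope_mass /Rintegral fine_le //.
- by apply: integrable_fin_num => //; exact: integrable_norm.
- by apply: integrable_fin_num => //; exact: integrable_norm.
apply: ge0_subset_integral => //.
have niv : mu.-integrable setT (EFin \o (fun y => `|v y|)) by exact: integrable_norm.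
by case/integrableP: niv.
Qed.

(** If the profile touches the vacuum then [h'] must be finite there, since
    the total variation of [h'(rhoi)] is finite. *)
Lemma profile_fin y : dpotential h (rhoi y) \is a fin_num.
Proof.
have := rhoi_ge0 y; rewrite le_eqVlt => /predU1P[y0|y0]; last by rewrite dpotential_gt0.
have := rhohat_ge0; rewrite le_eqVlt => /predU1P[hat0|hat0].
  by rewrite -y0; move: aE; rewrite -hat0 => ->.
have ea : a = h1 rhohat by move: aE; rewrite dpotential_gt0 // => -[].
have lb k : a - 1 - slope_mass <= h1 (ek k).
  have := gapk_le k y; rewrite /gapk -y0 trunc_le0 // sub0r normrN.
  have /andP[+ _] := trunc_near dh1 h2p k hat0; rewrite -ea -/(ek k).
  have k1 : ek k <= 1 by rewrite invf_le1 // ler1n.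
  have am : a <= Num.max a (h1 (ek k)) by rewrite le_max lexx.
  move=> h3 h4; have := ler_norm (trunc h1 k rhohat).
  by move: k1 am h3 h4; move: (ek k) (Num.max a _) => e m; lra.
rewrite -y0 fin_numE; apply/andP; split; last first.
  by have := dpotential0_le plaw hpot ltr01; case: dpotential.
have : ((a - 1 - slope_mass)%:E <= dpotential h 0)%E.
  have cv := cvg_comp _ _ (@natSinv_at_right R) (dpotential0_cvg plaw hpot).
  rewrite -(cvg_lim _ cv) //; apply: lime_ge; first exact: cvgP cv.
  by near=> k; rewrite lee_fin; exact: lb.
by case: dpotential.
Unshelve. all: by end_near. Qed.

Definition gap y : R := fine (dpotential h (rhoi y)) - a.

Lemma dpotential_gap y : dpotential h (rhoi y) = (gap y + a)%:E.
Proof. by rewrite subrK fineK // profile_fin. Qed.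

Lemma gapk_cvg y : gapk k y @[k --> \oo] --> gap y.
Proof.
have c1 := trunc_level_cvg plaw hpot (rhoi_ge0 y) (dpotential_gap y).
have c2 := trunc_level_cvg plaw hpot rhohat_ge0 aE.
have c3 := cvgB c1 c2; rewrite addrK in c3.
have e : gapk ^~ y = (fun k => trunc h1 k (rhoi y) + h1 k.+1%:R^-1) \-
    (fun k => trunc h1 k rhohat + h1 k.+1%:R^-1).
  by apply/funext => k; rewrite /gapk /=; ring.
by suff : gapk ^~ y @ \oo --> gap y by []; rewrite e; exact: c3.
Qed.

Lemma gap_out y : r < `|y| -> gap y = 0.
Proof. by move=> yr; rewrite /gap rhoi_out // aE /= subrr. Qed.

Lemma gap_le y : `|gap y| <= slope_mass.
Proof.
have cv : `|gapk k y| @[k --> \oo] --> `|gap y| by apply: cvg_norm; exact: gapk_cvg.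
rewrite -(cvg_lim (@Rhausdorff R) cv); apply: limr_le; first exact: cvgP cv.
by near=> k; exact: gapk_le.
Unshelve. all: by end_near. Qed.

Lemma measurable_gap : measurable_fun (setT : set R) gap.
Proof.
apply: (measurable_fun_cvg (h := gapk)) => [k|y _]; last exact: gapk_cvg.
apply: continuous_measurable => y; exact: der_continuous (der_gapk k y).
Qed.

End compact_profile.

Section profile_moment.
Context {R : realType}.
Local Notation mu := (@lebesgue_measure R).
Variables (p h rhoi w : R -> R) (rhohat a r : R).
Hypothesis plaw : pressure_law p.
Hypothesis hpot : internal_potential p h.
Hypothesis rhohat_ge0 : 0 <= rhohat.
Hypothesis aE : dpotential h rhohat = a%:E.
Hypothesis C1 : is_Ck 1 rhoi.
Hypothesis rhoi_ge0 : forall y, 0 <= rhoi y.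
Hypothesis r0 : 0 < r.
Hypothesis rhoi_out : forall y, r < `|y| -> rhoi y = rhohat.
Hypothesis Ww : weak_derivative (fun y => dpotential h (rhoi y)) w.
Local Notation h1 := (derive1 h).
Local Notation p1 := (derive1 p).
Local Notation drhoi := (derive1 rhoi).
Local Notation v := (slope h rhoi).
Local Notation g := (gap h rhoi a).

Let ek (k : nat) := k.+1%:R^-1 : R.
Let dp := der_p plaw.
Let p1_gt0 z : 0 < z -> 0 < p1 z. Proof. by case: plaw => _ _ _; exact. Qed.
Let p1_cont z : 0 < z -> {for z, continuous p1}. Proof. by case: plaw => _ _ + _; exact. Qed.

Lemma right_value_cvg (f : R -> R) : {within `[0, +oo[, continuous f} ->
  f (ek k) @[k --> \oo] --> f 0.
Proof.
move=> fc; have fc1 : {within `[0, 1], continuous f}.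
  by apply: within_continuousW fc => x /=; rewrite !in_itv /= andbT => /andP[].
have [_ cr _] := (continuous_within_itvP f ltr01).1 fc1.
exact: (cvg_comp _ _ (@natSinv_at_right R) cr).
Qed.

(** The relation [p = z h' - h] extends to the vacuum when [h'] is finite
    there. *)
Lemma pressure_slopeE (z l : R) : 0 <= z -> dpotential h z = l%:E -> p z = z * l - h z.
Proof.
rewrite le_eqVlt => /predU1P[<-|z0]; last first.
  by rewrite dpotential_gt0 // => -[<-]; exact: pE hpot _ z0.
move=> /(ck_cvg plaw hpot) cl.
have [pc _ _ _] := plaw; have [hc _ _ _] := hpot.
have e0 : ek k @[k --> \oo] --> (0 : R).
  exact: (cvg_comp _ _ (@natSinv_at_right R) (cvg_at_right_filter (@cvg_id _ _))).
have c1 := cvgB (cvgM e0 cl) (right_value_cvg hc).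
apply: (cvg_unique _ (right_value_cvg pc)) => //.
rewrite (_ : (fun k => p (ek k)) = (fun k => ek k * h1 (ek k) - h (ek k))); first exact: c1.
by apply/funext => k; rewrite (pE hpot) // invr_gt0.
Qed.

Lemma ptrunc_cvg z : 0 <= z -> trunc p k z + p (ek k) @[k --> \oo] --> p z.
Proof.
rewrite le_eqVlt => /predU1P[<-|z0]; last exact: trunc_cvg dp p1_gt0 _ z0.
under eq_fun do rewrite trunc_le0 // add0r.
by apply: right_value_cvg; case: plaw.
Qed.

Lemma ptrunc_le k z B M : 1 <= M -> (forall x, 0 <= x <= M -> `|p x| <= B) -> 0 <= z <= M ->
  `|trunc p k z| <= 2 * B + 1.
Proof.
move=> M1 pB /andP[z0 zM].
have k1 : ek k <= 1 by rewrite invf_le1 // ler1n.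
have k0 : 0 < ek k by rewrite invr_gt0.
have B1 : `|p (ek k)| <= B by apply: pB; apply/andP; split; lra.
have B2 : `|p z| <= B by apply: pB; rewrite z0.
have B0 : 0 <= B by apply: le_trans B2.
move: z0; rewrite le_eqVlt => /predU1P[<-|z0].
  by rewrite trunc_le0 // normr0; lra.
have := trunc_near dp p1_gt0 k z0; rewrite -/(ek k).
move: B1 B2; rewrite !ler_norml => /andP[b1 b2] /andP[b3 b4].
have := le_max (- B) (p z) (p (ek k)); have := ge_max B (p z) (p (ek k)).
rewrite b1 b2 b3 b4 /=; move: (Num.max _ _) k1 k0 b1 b2; move: (ek k) (p (ek k)) (trunc p k z).
move=> e pe t m k1 k0 b1 b2 m1 m2 /andP[t1 t2].
by apply/andP; split; lra.
Qed.

Let K := r + 1.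

Lemma profile_bounded : exists2 M : R, 1 <= M & forall y, rhoi y <= M.
Proof.
have r0' := r0; have rr : - r <= r by lra.
have cw : {within `[- r, r], continuous rhoi}.
  by apply: continuous_subspaceT; exact: rhoi_cont.
have [M M0 HM] := bounded_on_segment rr cw.
exists (M + rhohat + 1) => [|y]; first by have := rhohat_ge0; lra.
have hh := rhohat_ge0; have [yr|yr] := ltP r `|y|; first by rewrite rhoi_out //; lra.
by have := HM y; rewrite -ler_norml => /(_ yr); have := ler_norm (rhoi y); lra.
Qed.

(** Integration by parts for the pressure of the profile, which is of class
    C^1 away from the vacuum and continuous across it. *)
Lemma pressure_moment :
  mu.-integrable `[- K, K] (EFin \o (fun y => (p (rhoi y) - p rhohat) + y * rhoi y * v y)) /\
  \int[mu]_(y in `[- K, K]) ((p (rhoi y) - p rhohat) + y * rhoi y * v y) = 0.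
Proof.
have r0' := r0; have K0 : - K < K by rewrite /K; lra.
have mI : measurable (`[- K, K] : set R) by exact: measurable_itv.
have [M M1 rhoM] := profile_bounded.
have M0 : 0 <= M by lra.
have [B B0 HB] := bounded_on_segment M0 (p_cont plaw (lexx 0)).
have hatM : rhohat <= M by rewrite -(rhoi_out (y := K)) // ger0_norm /K; lra.
pose Pk k y := trunc p k (rhoi y) - trunc p k rhohat.
pose dPk k y := dtrunc p p1 k (rhoi y) * drhoi y.
have dP k (y : R) : is_derive y 1 (Pk k) (dPk k y).
  have d := der_sub (der_trunc_profile C1 k y dp p1_gt0) (der_cst (trunc p k rhohat) y).
  by rewrite subr0 in d.
have cdP k : continuous (dPk k) by apply: dtrunc_profile_cont.
have cP k : continuous (Pk k).
  move=> y; exact: der_continuous (dP k y).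
have rv y : 0 < rhoi y -> p1 (rhoi y) * drhoi y = rhoi y * v y.
  by move=> y0; rewrite /slope y0 (dpE hpot) // mulrA.
pose fk k y := Pk k y + y * dPk k y.
have cfk k : continuous (fk k).
  by move=> y; apply: cvgD; [exact: cP|apply: cvgM; [exact: cvg_id|exact: cdP]].
have Lv := slope_L1seg plaw hpot C1 rhoi_ge0 Ww.
have crho := rhoi_cont C1.
pose G y := 2 * (2 * B + 1) + K * M * `|v y|.
have fkf y : fk k y @[k --> \oo] --> (p (rhoi y) - p rhohat) + y * rhoi y * v y.
  apply: cvgD.
    have c3 := cvgB (ptrunc_cvg (rhoi_ge0 y)) (ptrunc_cvg rhohat_ge0).
    have e : Pk ^~ y = (fun k => trunc p k (rhoi y) + p (ek k)) \- (fun k => trunc p k rhohat + p (ek k)).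
      by apply/funext => k; rewrite /Pk /=; ring.
    by suff : Pk ^~ y @ \oo --> p (rhoi y) - p rhohat by []; rewrite e; exact: c3.
  rewrite -mulrA; apply: cvgM; first exact: cvg_cst.
  rewrite /dPk; have := rhoi_ge0 y; rewrite le_eqVlt => /predU1P[<-|y0].
    under eq_fun do rewrite dtrunc_le0 // mul0r.
    by rewrite mul0r; exact: cvg_cst.
  rewrite -rv //; apply: cvgM; last exact: cvg_cst.
  exact: dtrunc_cvg dp p1_gt0 _ y0.
have dPle k y : `|dPk k y| <= M * `|v y|.
  rewrite /dPk; have := rhoi_ge0 y; rewrite le_eqVlt => /predU1P[<-|y0].
    by rewrite dtrunc_le0 // mul0r normr0 mulr_ge0.
  have /andP[d0 d1] := dtrunc_bounds dp p1_gt0 k y0.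
  apply: (@le_trans _ _ `|rhoi y * v y|); last first.
    by rewrite normrM ler_wpM2r // gtr0_norm.
  rewrite -rv // !normrM ler_wpM2r // !ger0_norm //.
  exact: le_trans d1.
apply: (@dominated_integral_limit _ _ R mu _ fk _ G (fun=> 0) 0 mI).
- by move=> k; exact: continuous_measurable.
- apply: (measurable_fun_cvg (h := fk)) => [k|y _]; last exact: fkf.
  exact: continuous_measurable.
- apply: intD => //; first by apply: cts_L1seg; exact: cst_continuous.
  apply: intZ => //; apply: integrable_norm => //; exact: Lv.
- by apply: aeW => y _; exact: fkf.
- apply: aeW => y /=; rewrite in_itv /= => yK k.
  have rM : 0 <= rhoi y <= M by rewrite rhoi_ge0 rhoM.
  have hM : 0 <= rhohat <= M by rewrite rhohat_ge0.
  have b1 := ptrunc_le k M1 HB rM; have b2 := ptrunc_le k M1 HB hM.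
  apply: le_trans (ler_normD _ _) _; apply: lerD.
    by apply: le_trans (ler_normB _ _) _; lra.
  rewrite normrM -mulrA; apply: ler_pM => //.
  by rewrite ler_norml.
- move=> k _.
  have dF (y : R) : is_derive y 1 (fun y => y * Pk k y) (fk k y).
    by apply: is_derive_eq (der_mul (der_id y) (dP k y)) _; rewrite /fk; ring.
  have PK y : r < `|y| -> Pk k y = 0 by move=> /rhoi_out; rewrite /Pk => ->; rewrite subrr.
  rewrite /Rintegral (ftc_itv K0 dF (cfk k)) /= !PK ?mulr0 ?subrr //.
    by rewrite normrN ger0_norm /K; lra.
  by rewrite ger0_norm /K; lra.
- exact: cvg_cst.
Qed.

Lemma rel_profileE y : rel h rhohat a (rhoi y) - g y * rhoi y = - (p (rhoi y) - p rhohat).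
Proof.
have gE := dpotential_gap plaw hpot rhohat_ge0 aE C1 rhoi_ge0 r0 rhoi_out Ww y.
rewrite (pressure_slopeE (rhoi_ge0 y) gE) (pressure_slopeE rhohat_ge0 aE) /rel; ring.
Qed.

Lemma profile_moment :
  [/\ mu.-integrable setT (EFin \o (fun y => y * rhoi y * v y)),
      mu.-integrable setT (EFin \o (fun y => rel h rhohat a (rhoi y) - g y * rhoi y)) &
      \int[mu]_y (rel h rhohat a (rhoi y) - g y * rhoi y) = \int[mu]_y (y * rhoi y * v y)].
Proof.
have mI : measurable (`[- K, K] : set R) by exact: measurable_itv.
have Lv := slope_L1seg plaw hpot C1 rhoi_ge0 Ww.
have out y : K < `|y| -> rel h rhohat a (rhoi y) - g y * rhoi y = 0.
  move=> yK; rewrite rel_profileE rhoi_out ?subrr ?oppr0 //.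
  by apply: lt_trans yK; rewrite /K ltrDl.
have out2 y : K < `|y| -> y * rhoi y * v y = 0.
  move=> yK; rewrite (slope_out h C1 rhoi_out) ?mulr0 //.
  by apply: lt_trans yK; rewrite /K ltrDl.
have Lyv : L1seg (fun y => y * rhoi y * v y).
  apply: L1seg_mul => // y; apply: cvgM; [exact: cvg_id|exact: rhoi_cont].
have [i1 e1] := pressure_moment.
have i2 := Lyv K.
have i3 : mu.-integrable `[- K, K] (EFin \o (fun y => rel h rhohat a (rhoi y) - g y * rhoi y)).
  apply: (@int_eq _ _ _ mu _ mI (fun y => y * rhoi y * v y - ((p (rhoi y) - p rhohat) + y * rhoi y * v y))).
    by move=> y _; rewrite rel_profileE; ring.
  exact: intB.
split.
- exact: L1seg_supp Lyv out2.
- by apply: (@integrable_supp _ _ K) => [y /out /= -> //|]; exact: i3.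
rewrite (Rintegral_supp out) (Rintegral_supp out2); apply/eqP; rewrite -subr_eq0 -RintegralB //; apply/eqP.
rewrite -[RHS]oppr0 -e1 -[RHS]mulN1r -RintegralZl //.
by apply: eq_Rintegral => y _; rewrite rel_profileE; ring.
Qed.

End profile_moment.

(** * Integration over boxes *)

Section boxes.
Context {R : realType}.
Local Notation mu := (@lebesgue_measure R).
Local Notation mu2 := (@lebesgue_measure R \x @lebesgue_measure R)%E.
Local Notation T2 := (measurableTypeR R * measurableTypeR R)%type.

Lemma ae_snd (P : R -> Prop) : {ae mu, forall y, P y} -> {ae mu2, forall x : R * R, P x.2}.
Proof.
move=> [N [mN N0 sub]]; exists (setT `*` N); split.
- exact: measurableX.
- by transitivity (mu setT * mu N)%E; [exact: product_measure1E|rewrite N0 mule0].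
- by move=> x nP; split => //; exact: sub.
Qed.

Lemma boxE (M t y : R) : ((t, y) \in box M) = (t \in `[0, M]) && (y \in `[- M, M]).
Proof.
apply/idP/idP; first by rewrite inE => -[/= -> ->].
by move=> /andP[h1 h2]; rewrite inE; split.
Qed.

Lemma box_section (f : R * R -> \bar R) (M t : R) :
  (\int[mu]_y (f \_ (box M)) (t, y) =
   ((fun t => \int[mu]_(y in `[(- M)%R, M]) f (t, y)) \_ `[0%R, M]) t)%E.
Proof.
rewrite patchE; case: ifPn => tM.
  rewrite [RHS]integral_mkcond; apply: eq_integral => y _; rewrite !patchE boxE.
  by move: tM; rewrite mem_setE => ->; rewrite mem_setE.
rewrite integral0_eq // => y _; rewrite patchE boxE.
by move: tM; rewrite mem_setE => /negbTE ->.
Qed.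

Lemma fubini_box (f : R * R -> R) (M : R) : mu2.-integrable (box M) (EFin \o f) ->
  [/\ mu.-integrable `[0, M] (EFin \o (fun t => \int[mu]_(y in `[- M, M]) f (t, y))),
      {ae mu, forall t, 0 <= t <= M -> mu.-integrable `[- M, M] (EFin \o (fun y => f (t, y)))} &
      \int[mu2]_(x in box M) f x =
      \int[mu]_(t in `[0, M]) \int[mu]_(y in `[- M, M]) f (t, y)].
Proof.
move=> fi; have mB := @measurable_box R M.
have mI : measurable (`[0, M] : set R) by exact: measurable_itv.
have mJ : measurable (`[- M, M] : set R) by exact: measurable_itv.
have fi' : mu2.-integrable setT ((EFin \o f) \_ (box M)).
  by move: fi => /(integrable_mkcond _ mB).
have iF : mu.-integrable setT (fubini_F mu ((EFin \o f) \_ (box M))) by exact: integrable_fubini_F.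
have eF : fubini_F mu ((EFin \o f) \_ (box M)) =
    ((fun t => \int[mu]_(y in `[(- M)%R, M]) (f (t, y))%:E) \_ `[0%R, M])%E.
  by apply/funext => t; exact: box_section.
have iG : mu.-integrable `[0, M] (fun t => \int[mu]_(y in `[(- M)%R, M]) (f (t, y))%:E)%E.
  by apply/integrable_mkcond => //; rewrite -eF.
have iG' : mu.-integrable `[0, M] (EFin \o (fun t => \int[mu]_(y in `[- M, M]) f (t, y))).
  exact: integrable_fine_comp iG.
split=> //.
- have := ae_integrable1 fi'; apply: ae_imply => t + t0.
  move=> it; apply/integrable_mkcond => //; move: it.
  congr (_.-integrable _ _); apply/funext => y /=.
  by rewrite !patchE boxE in_itv /= t0 /= mem_setE.
- apply: EFin_inj.
  transitivity (\int[mu2]_(x in box M) (f x)%:E)%E; first by rewrite -RintE.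
  transitivity (\int[mu]_(t in `[0%R, M]) \int[mu]_(y in `[(- M)%R, M]) (f (t, y))%:E)%E.
    rewrite integral_mkcond -(integral12_prod_meas1 fi').
    by rewrite [RHS]integral_mkcond; apply: eq_integral => t _; exact: box_section.
  rewrite -RintE //.
  have fin : {ae mu, forall t, `[0, M]%classic t ->
      (\int[mu]_(y in `[(- M)%R, M]) (f (t, y))%:E)%E \is a fin_num} by exact: integrable_ae.
  apply: ae_eq_integral => //.
  - by case/integrableP: iG.
  - by case/integrableP: iG'.
  - by apply: ae_imply fin => t /[apply] tf; rewrite /Rintegral fineK.
Qed.

Lemma integrable_snd_box (b : R -> R) (M : R) : measurable_fun (setT : set R) b -> L1seg b ->
  mu2.-integrable (box M) (fun x => (b x.2)%:E).
Proof.
move=> mb bi; have mB := @measurable_box R M.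
have mJ : measurable (`[- M, M] : set R) by exact: measurable_itv.
have mf : measurable_fun (setT : set T2) (fun x : T2 => (b x.2)%:E).
  by apply/measurable_EFinP; exact: measurableT_comp.
have mfa : measurable_fun (setT : set T2) ((fun x : T2 => `|b x.2|%:E) \_ (box M)).
  apply/(measurable_restrictT _ _).1 => //; apply: measurable_funTS.
  by apply/measurable_EFinP; apply: measurableT_comp => //; exact: measurableT_comp.
apply/integrableP; split; first exact: measurable_funTS.
rewrite integral_mkcond.
rewrite (@fubini_tonelli1 _ _ _ _ _ mu mu _ mfa); last first.
  by move=> x; rewrite patchE; case: ifP => //; rewrite lee_fin.
have -> : fubini_F mu ((fun x : T2 => `|b x.2|%:E) \_ (box M)) =
    ((fun t => \int[mu]_(y in `[(- M)%R, M]) `|b y|%:E) \_ `[0%R, M])%E.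
  by apply/funext => t; exact: box_section.
rewrite -integral_mkcond integral_cst; last exact: measurable_itv.
rewrite lte_mul_pinfty //; first exact: integral_ge0.
  apply/fin_numPlt; apply/andP; split.
    by apply: lt_le_trans (integral_ge0 _ _) => //.
  by case/integrableP: (bi M).
have mfin : (mu (`[0%R, M] : set R) < +oo)%E.
  by rewrite lebesgue_measure_itv /=; case: ifP => _; rewrite -?EFinB ?ltry.
exact: mfin.
Qed.

End boxes.

(** * The mass equation tested with the profile *)

Section mass_equation.
Context {R : realType}.
Local Notation mu := (@lebesgue_measure R).
Local Notation mu2 := (@lebesgue_measure R \x @lebesgue_measure R)%E.
Local Notation T2 := (measurableTypeR R * measurableTypeR R)%type.
Local Notation H := (half_plane R).
Variables (alpha : R) (p : R -> R) (rho0 n0 : R -> R) (rho n : R * R -> R).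
Hypothesis rho0_loc : locally_integrable setT rho0.
Hypothesis sol : weak_solution alpha p rho0 n0 rho n.

(** The integrand of the mass equation tested with [phi(t) G(y)], where [dG]
    stands for the derivative of [G]. *)
Definition mass_form (phi G dG : R -> R) (x : R * R) : R :=
  (derive1 phi x.1 - phi x.1 / 2) * (G x.2 * rho x)
  - phi x.1 * (dG x.2 * (x.2 / 2 * rho x - n x)).

Definition mass_identity (M : R) (phi G dG : R -> R) :=
  \int[mu2]_(x in box M) mass_form phi G dG x =
  - (phi 0 * \int[mu]_(y in `[- M, M]) (G y * rho0 y)).

Let Lrho : L1box (EFin \o rho).
Proof. by case: sol => -[L _ _ _] _ _ _; exact: L1loc_L1box. Qed.

Let Ln : L1box (EFin \o n).
Proof. by case: sol => -[_ L _ _] _ _ _; exact: L1loc_L1box. Qed.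

Let mrho : measurable_fun (H : set T2) rho. Proof. by apply/measurable_EFinP; case: Lrho. Qed.
Let mn : measurable_fun (H : set T2) n. Proof. by apply/measurable_EFinP; case: Ln. Qed.

Lemma snd_continuous (f : R -> R) : continuous f -> continuous (fun x : R * R => f x.2).
Proof. by move=> cf x; apply: (@continuous_comp _ _ _ snd f); [exact: cvg_snd|exact: cf]. Qed.

Lemma drift_L1box : L1box (EFin \o (fun x => x.2 / 2 * rho x - n x)).
Proof.
have ch : continuous (fun y : R => y / 2) by move=> y; apply: cvgM; [exact: cvg_id|exact: cvg_cst].
have L1 : L1box (EFin \o (fun x => x.2 / 2 * rho x)).
  exact: L1boxM (snd_continuous ch) (@measurable_snd_comp _ _ H ch) Lrho.
have L2 : L1box (EFin \o (fun x => -1 * n x)).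
  by apply: (@L1boxM _ (fun=> -1)) => //; exact: cst_continuous.
have e : (fun x => x.2 / 2 * rho x + -1 * n x) = (fun x => x.2 / 2 * rho x - n x).
  by apply/funext => x; ring.
rewrite -e; exact: (L1boxD L1 L2).
Qed.

Let drift (x : R * R) := x.2 / 2 * rho x - n x.
Let mdrift : measurable_fun (H : set T2) drift.
Proof. by apply/measurable_EFinP; case: drift_L1box. Qed.
Lemma measurable_mass_form phi G dG : continuous phi -> continuous (derive1 phi) ->
  measurable_fun (setT : set R) G -> measurable_fun (setT : set R) dG ->
  measurable_fun (H : set T2) (mass_form phi G dG).
Proof.
move=> cphi cdphi mG mdG.
have ms (f : R -> R) : measurable_fun (setT : set R) f ->
    measurable_fun (H : set T2) (fun x : T2 => f x.2).
  by move=> mf; apply: measurable_funTS; exact: measurableT_comp.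
apply: measurable_funB; apply: measurable_funM.
- apply: measurable_funB; first exact: measurable_fst_comp.
  by apply: measurable_funM => //; exact: measurable_fst_comp.
- by apply: measurable_funM => //; exact: ms.
- exact: measurable_fst_comp.
- by apply: measurable_funM => //; exact: ms.
Qed.

Variables (phi : R -> R) (M : R).
Hypothesis tphi : test_function phi.
Hypothesis phiM : forall t, M < `|t| -> phi t = 0.

Let sphi : smooth phi. Proof. exact: test_function_smooth tphi. Qed.
Let cphi : continuous phi. Proof. exact: smooth_cont. Qed.
Let cdphi : continuous (derive1 phi). Proof. by apply: smooth_cont; exact: smooth_derive1. Qed.
Let dphiM t : M < `|t| -> derive1 phi t = 0. Proof. exact: derive1_out. Qed.

Lemma mass_test G : test_function G -> (forall y, M < `|y| -> G y = 0) ->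
  mu2.-integrable (box M) (EFin \o mass_form phi G (derive1 G)) ->
  mass_identity M phi G (derive1 G).
Proof.
move=> tG GM mi.
have sG := test_function_smooth tG.
have dGM y : M < `|y| -> derive1 G y = 0 by exact: derive1_out.
pose f2 (x : R * R) := phi x.1 * G x.2.
have s2 : smooth f2.
  apply: smoothM; first by apply: (@smooth_comp _ _ fst phi) => //; exact: smooth_fst.
  by apply: (@smooth_comp _ _ snd G) => //; exact: smooth_snd.
have t2 : test_function f2.
  apply: (@test_function2 _ _ M) => // x [x1|x2]; first by rewrite /f2 phiM // mul0r.
  by rewrite /f2 GM // mulr0.
have e1 : dtime f2 = (fun x => derive1 phi x.1 * G x.2).
  apply: (@dtimeE _ f2 (fun x => derive1 phi x.1 * G x.2)) => t y /=.
  apply: is_derive_eq (der_mul (derivable_der (smooth_derivable (x := t) sphi)) (der_cst (G y) t)) _.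
  by rewrite /=; ring.
have e2 : dspace f2 = (fun x => phi x.1 * derive1 G x.2).
  apply: (@dspaceE _ f2 (fun x => phi x.1 * derive1 G x.2)) => t y /=.
  apply: is_derive_eq (der_mul (der_cst (phi t) y) (derivable_der (smooth_derivable (x := y) sG))) _.
  by rewrite /=; ring.
have [_ _ /(_ f2 t2) + _] := sol; rewrite e1 e2 /f2 /=.
have -> : (\int[mu]_y (phi 0%R * G y * rho0 y)%:E =
    (phi 0%R * \int[mu]_(y in `[(- M)%R, M]) (G y * rho0 y))%:E)%E.
  have mI : measurable (`[- M, M] : set R) by exact: measurable_itv.
  have L0 := locally_integrable_L1seg rho0_loc.
  have i0 : mu.-integrable `[- M, M] (EFin \o (fun y => G y * rho0 y)).
    by apply: (L1seg_mul _ L0); exact: smooth_cont.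
  have i1 : mu.-integrable `[- M, M] (EFin \o (fun y => phi 0 * (G y * rho0 y))) by apply: intZ.
  rewrite -RintegralZl // -RintE // (@integral_restrict_itv _ _ `[- M, M]) //.
    by apply: eq_integral => y _; rewrite mulrA.
  move=> y _ /=; rewrite in_itv /= -ler_norml => /negP; rewrite -ltNge => yM.
  by rewrite GM // mulr0 mul0r.
have -> : (\int[mu2]_(x in H) (derive1 phi x.1 * G x.2 * rho x +
      phi x.1 * derive1 G x.2 * (- (x.2 / 2) * rho x + n x) -
      2^-1 * (phi x.1 * G x.2) * rho x)%:E =
    (\int[mu2]_(x in box M) mass_form phi G (derive1 G) x)%:E)%E.
  rewrite -RintE //; last exact: measurable_box.
  rewrite [LHS]integral_mkcond [RHS]integral_mkcond; apply: eq_integral => x _.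
  rewrite !patchE; case: ifPn => [xH|]; case: ifPn => //.
  - by move=> _; congr EFin; rewrite /mass_form; ring.
  - rewrite notin_setE => nb.
    have [x1|x1] := ltP M `|x.1|.
      by rewrite phiM // dphiM // !(mul0r, mulr0, addr0, subrr).
    have [x2|x2] := ltP M `|x.2|.
      by rewrite GM // dGM // !(mul0r, mulr0, addr0, subrr).
    exfalso; apply: nb; split; rewrite /= in_itv /= -?ler_norml //.
    by move: xH; rewrite inE => xH; rewrite xH (le_trans (ler_norm _) x1).
  - by rewrite inE => /box_half_plane xH; rewrite notin_setE.
by rewrite -EFinN => -[e]; rewrite /mass_identity -e opprK.
Qed.

(** Dominated convergence in the spatial factor. Near the vacuum the slopes are
    not bounded, and only their products with the drift are dominated. *)
Lemma mass_limit (Gj dGj : nat -> R -> R) (G dG : R -> R) (B : R) (dom : R * R -> R) :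
  (forall j, measurable_fun (setT : set R) (Gj j)) ->
  (forall j, measurable_fun (setT : set R) (dGj j)) ->
  (forall y, Gj j y @[j --> \oo] --> G y) ->
  (forall y, dGj j y @[j --> \oo] --> dG y) ->
  0 <= B -> (forall j y, `|Gj j y| <= B) ->
  mu2.-integrable (box M) (EFin \o dom) ->
  {ae mu2, forall x, box M x -> forall j, `|dGj j x.2 * drift x| <= dom x} ->
  (forall j, mu2.-integrable (box M) (EFin \o mass_form phi (Gj j) (dGj j)) ->
     mass_identity M phi (Gj j) (dGj j)) ->
  mu2.-integrable (box M) (EFin \o mass_form phi G dG) /\ mass_identity M phi G dG.
Proof.
move=> mG mdG cG cdG B0 GB di domE idj.
have mB := @measurable_box R M.
have mGl : measurable_fun (setT : set R) G.
  by apply: (measurable_fun_cvg (h := Gj)) => // y _; exact: cG.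
have mdGl : measurable_fun (setT : set R) dG.
  by apply: (measurable_fun_cvg (h := dGj)) => // y _; exact: cdG.
have [C C0 HC] := test_bounded tphi.
have [C' C'0 HC'] := test_bounded (test_derive1 tphi).
have BH := @box_half_plane R M.
apply: (@dominated_integral_limit _ _ R mu2 _ (fun j => mass_form phi (Gj j) (dGj j)) _
  (fun x => (C' + C) * B * `|rho x| + C * dom x)
  (fun j => - (phi 0 * \int[mu]_(y in `[- M, M]) (Gj j y * rho0 y)))).
- exact: mB.
- by move=> j; apply: measurable_funS (measurable_mass_form cphi cdphi (mG j) (mdG j)).
- by apply: measurable_funS (measurable_mass_form cphi cdphi mGl mdGl).
- apply: intD => //; apply: intZ => //; apply: integrable_norm => //.
  exact: (L1box_box_integrable M Lrho).
- apply: aeW => x _; apply: cvgB; apply: cvgM; try exact: cvg_cst.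
    by apply: cvgM; [exact: cG|exact: cvg_cst].
  by apply: cvgM; [exact: cdG|exact: cvg_cst].
- apply: ae_imply domE => x Hx xB j.
  apply: le_trans (ler_normB _ _) _; apply: lerD.
    rewrite normrM -mulrA; apply: ler_pM => //.
      apply: le_trans (ler_normB _ _) _; apply: lerD; first exact: HC'.
      rewrite normrM; apply: le_trans (_ : `|phi x.1| * 1 <= _); last by rewrite mulr1.
      by apply: ler_wpM2l => //; rewrite ger0_norm //; lra.
    by rewrite normrM ler_wpM2r.
  by rewrite normrM; apply: ler_pM => //; exact: Hx.
- by move=> j /idj.
- apply: cvgN; apply: cvgM; first exact: cvg_cst.
  have mI : measurable (`[- M, M] : set R) by exact: measurable_itv.
  have L0 := locally_integrable_L1seg rho0_loc.
  have m0 : measurable_fun (setT : set R) rho0 by case: rho0_loc.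
  have [|||||_ _] := @dominated_cvg_real _ _ R mu _ (fun j y => Gj j y * rho0 y)
    (fun y => G y * rho0 y) (fun y => B * `|rho0 y|) mI; last by apply.
  + by move=> j; apply: measurable_funM; apply: measurable_funTS; [exact: mG|exact: m0].
  + by apply: measurable_funM; apply: measurable_funTS; [exact: mGl|exact: m0].
  + by apply: intZ => //; apply: integrable_norm => //; exact: L0.
  + by apply: aeW => y _; apply: cvgM; [exact: cG|exact: cvg_cst].
  + by apply: aeW => y _ j; rewrite normrM ler_wpM2r.
Qed.

Lemma mass_C1 (G dG : R -> R) (r : R) : 0 < r -> r + 1 <= M ->
  (forall y : R, is_derive y 1 G (dG y)) -> continuous dG ->
  (forall y, r < `|y| -> G y = 0) -> mass_identity M phi G dG.
Proof.
move=> r0 rM dGd dGc Gr.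
have [Gj [B [tGj Gjr GjB GjG dGjG]]] := mollify r0 dGd dGc Gr.
have B0 : 0 <= B by have [h _] := GjB 0%N 0; exact: le_trans h.
have cGj j : continuous (Gj j) by apply: smooth_cont; exact: test_function_smooth.
have cdGj j : continuous (derive1 (Gj j)).
  by apply: smooth_cont; apply: smooth_derive1; exact: test_function_smooth.
have mB := @measurable_box R M.
have [] // := @mass_limit Gj (fun j => derive1 (Gj j)) G dG B (fun x => B * `|drift x|).
- by move=> j; exact: continuous_measurable.
- by move=> j; exact: continuous_measurable.
- by move=> j y; case: (GjB j y).
- apply: intZ => //; apply: integrable_norm => //.
  exact: (L1box_box_integrable M drift_L1box).
- by apply: aeW => x _ j; rewrite normrM ler_wpM2r //; case: (GjB j x.2).
- move=> j; apply: mass_test => // y My; apply: Gjr; exact: le_lt_trans My.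
Qed.

End mass_equation.

Section measurable_profile.
Context {R : realType}.
Local Notation mu := (@lebesgue_measure R).
Local Notation mu2 := (@lebesgue_measure R \x @lebesgue_measure R)%E.
Variables (p h : R -> R).
Hypothesis plaw : pressure_law p.
Hypothesis hpot : internal_potential p h.

Lemma measurable_rel_entropy_profile (t : R) (r m rb : R -> R) :
  measurable_fun (setT : set R) r -> measurable_fun (setT : set R) m ->
  measurable_fun (setT : set R) rb ->
  measurable_fun (setT : set R) (fun y => rel_entropy h t (r y) (m y) (rb y) 0).
Proof.
move=> mr mm mb; under eq_fun do rewrite rel_entropy0.
apply: emeasurable_funD.
  by apply: emeasurable_funM => //; exact: measurable_sq_over.
rewrite (_ : (fun y => _) = fun y => if (0 <= r y) && (0 <= rb y)
  then (potential h (r y) - potential h (rb y) - dpotential h (rb y) * (r y - rb y)%:E)%E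
  else +oo%E); last first.
  by apply/funext => y; rewrite /rel_potential /potential; case: ifPn => // /andP[-> ->].
apply: measurable_fun_ifT => //.
  by apply: measurable_and; exact: measurable_fun_ler.
have mp (f : R -> R) : measurable_fun (setT : set R) f ->
    measurable_fun (setT : set R) (fun y => potential h (f y)).
  by move=> mf; exact: (measurableT_comp (measurable_potential hpot) mf).
apply: emeasurable_funB; first by apply: emeasurable_funB; exact: mp.
apply: emeasurable_funM; first exact: (measurableT_comp (measurable_dpotential hpot) mb).
by apply/measurable_EFinP; exact: measurable_funB.
Qed.

(** Relative entropy is infinite where the reference density is negative, and
    a continuous function is negative on an open set or nowhere. *)
Lemma profile_ge0 (t : R) (r m rb : R -> R) : continuous rb ->
  measurable_fun (setT : set R) r -> measurable_fun (setT : set R) m ->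
  (rel_energy h t r m rb (cst 0%R) < +oo)%E -> forall y, 0 <= rb y.
Proof.
move=> cb mr mm fin y; rewrite leNgt; apply/negP => y0.
have : \forall z \near y, rb z < 0 by apply: (cvgr_lt _ (cb y)).
move=> /nbhs_ballP[e /= e0 He].
have mb : measurable_fun (setT : set R) rb by exact: continuous_measurable.
have mf := measurable_rel_entropy_profile t mr mm mb.
have mI : measurable (`]y - e, y + e[ : set R) by exact: measurable_itv.
have le1 : (\int[mu]_(z in `](y - e)%R, (y + e)%R[) rel_entropy h t (r z) (m z) (rb z) 0 <=
    rel_energy h t r m rb (cst 0%R))%E.
  apply: ge0_subset_integral => // z _; exact: rel_entropy_ge0 plaw hpot.
move: le1; rewrite (_ : (\int[mu]_(z in _) _)%E = +oo%E); first by rewrite leye_eq => /eqP h0; rewrite h0 in fin.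
transitivity (\int[mu]_(z in `](y - e)%R, (y + e)%R[) (cst +oo%E z))%E.
  apply: eq_integral => z; rewrite inE /= in_itv /= => /andP[z1 z2].
  have zb : rb z < 0 by apply: He; rewrite /ball /= ltr_distlC; apply/andP; split; lra.
  rewrite rel_entropy0 /rel_potential [(0 <= rb z)%R]leNgt zb andbF addey //.
  rewrite /sq_over; case: ifP => _; last by rewrite -EFinM.
  case: ifP => _; first by rewrite mule0.
  by rewrite gt0_muley // lte_fin divr_gt0 ?expR_gt0.
have mue : mu (`](y - e)%R, (y + e)%R[ : set R) = (2 * e)%:E.
  rewrite lebesgue_measure_itv /= lte_fin ifT; last lra.
  by rewrite -EFinB; congr EFin; ring.
rewrite integral_cst //; transitivity (+oo * (2 * e)%:E)%E; first by rewrite -mue.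
by rewrite gt0_mulye // lte_fin; lra.
Qed.

End measurable_profile.

Section mass_of_profile.
Context {R : realType}.
Local Notation mu := (@lebesgue_measure R).
Local Notation mu2 := (@lebesgue_measure R \x @lebesgue_measure R)%E.
Local Notation T2 := (measurableTypeR R * measurableTypeR R)%type.
Local Notation H := (half_plane R).
Variables (alpha rhohat a r : R) (p h rhoi w : R -> R) (rho0 n0 : R -> R) (rho n : R * R -> R).
Hypothesis plaw : pressure_law p.
Hypothesis hpot : internal_potential p h.
Hypothesis rhohat_ge0 : 0 <= rhohat.
Hypothesis aE : dpotential h rhohat = a%:E.
Hypothesis C1 : is_Ck 1 rhoi.
Hypothesis rhoi_ge0 : forall y, 0 <= rhoi y.
Hypothesis r0 : 0 < r.
Hypothesis rhoi_out : forall y, r < `|y| -> rhoi y = rhohat.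
Hypothesis Ww : weak_derivative (fun y => dpotential h (rhoi y)) w.
Hypothesis rho0_loc : locally_integrable setT rho0.
Hypothesis sol : weak_solution alpha p rho0 n0 rho n.
Let source x := w x.2 * (x.2 / 2 * (rho x - rhoi x.2) - n x).
Hypothesis Lsource : L1loc_half_plane (EFin \o source).
Local Notation v := (slope h rhoi).
Local Notation g := (gap h rhoi a).
Let drift (x : R * R) := x.2 / 2 * rho x - n x.

Let mv : measurable_fun (setT : set R) v.
Proof. exact: measurable_slope plaw hpot C1 rhoi_ge0. Qed.

Let mg : measurable_fun (setT : set R) g.
Proof. exact: measurable_gap plaw hpot rhohat_ge0 aE C1 rhoi_ge0 r0 rhoi_out Ww. Qed.

Let Lrho : L1box (EFin \o rho).
Proof. by case: sol => -[L _ _ _] _ _ _; exact: L1loc_L1box. Qed.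

Let ms (f : R -> R) : measurable_fun (setT : set R) f ->
  measurable_fun (H : set T2) (fun x : T2 => f x.2).
Proof. by move=> mf; apply: measurable_funTS; exact: measurableT_comp. Qed.

(** The source of the relative entropy inequality is [slope] times the drift up
    to a function of the space variable alone. *)
Lemma slope_drift_L1box : L1box (EFin \o (fun x => v x.2 * drift x)).
Proof.
pose b y := 2^-1 * (y * rhoi y * v y).
have crho := rhoi_cont C1.
have cb : continuous (fun y : R => 2^-1 * (y * rhoi y)).
  move=> y; apply: cvgM; first exact: cvg_cst.
  by apply: cvgM; [exact: cvg_id|exact: crho].
have bE : b = (fun y => (2^-1 * (y * rhoi y)) * v y).
  by apply/funext => y; rewrite /b; ring.
have Lb1 : L1seg b by rewrite bE; exact: L1seg_mul cb (slope_L1seg plaw hpot C1 rhoi_ge0 Ww).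
have mb : measurable_fun (setT : set R) b.
  by rewrite bE; apply: measurable_funM => //; exact: continuous_measurable.
have Lb : L1box (EFin \o (fun x => b x.2)).
  apply: L1boxP; first by apply/measurable_EFinP; exact: ms.
  by move=> M; exact: integrable_snd_box.
have LS := L1boxD (L1loc_L1box Lsource) Lb.
apply: L1box_ae LS _ _.
  apply/measurable_EFinP; apply: measurable_funM; first exact: ms.
  by apply/measurable_EFinP; case: (drift_L1box sol).
apply: ae_imply (ae_snd (weak_slopeE plaw hpot C1 rhoi_ge0 Ww)) => x wv _ /=.
by rewrite /source /b /drift wv; congr EFin; ring.
Qed.

Lemma gap_rho_L1box : L1box (EFin \o (fun x => g x.2 * rho x)).
Proof.
have mrho : measurable_fun (H : set T2) rho by apply/measurable_EFinP; case: Lrho.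
have mgr : measurable_fun (H : set T2) (fun x => g x.2 * rho x).
  by apply: measurable_funM => //; exact: ms.
apply: L1boxP; first exact/measurable_EFinP.
move=> M; have mB := @measurable_box R M.
apply: (@int_dom _ _ _ mu2 _ mB _ (fun x => slope_mass h rhoi * rho x)).
- by apply: measurable_funS mgr => //; exact: box_half_plane.
- move=> x _; rewrite !normrM ler_wpM2r // (ger0_norm (slope_mass_ge0 h rhoi)).
  exact: gap_le plaw hpot rhohat_ge0 aE C1 rhoi_ge0 r0 rhoi_out Ww _.
- by apply: intZ => //; exact: (L1box_box_integrable M Lrho).
Qed.

Definition gap_mass t := \int[mu]_y (g y * rho (t, y)).
Definition slope_work t := \int[mu]_y (v y * (y / 2 * rho (t, y) - n (t, y))).

Let g_out y : r < `|y| -> g y = 0.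
Proof. exact: (@gap_out R h rhoi rhohat a r aE rhoi_out y). Qed.

Let v_out y : r < `|y| -> v y = 0.
Proof. exact: (@slope_out R h rhoi rhohat r C1 rhoi_out y). Qed.

Section fixed_horizon.
Variable M : R.
Hypothesis rM : r + 1 <= M.

Let Mr (y : R) : M < `|y| -> r < `|y|.
Proof. by have := rM => h1 h2; lra. Qed.

Lemma gap_mass_integrable :
  mu.-integrable `[0, M] (EFin \o gap_mass) /\
  {ae mu, forall t, 0 <= t <= M -> mu.-integrable setT (EFin \o (fun y => g y * rho (t, y)))}.
Proof.
have [i1 i2 _] := fubini_box (L1box_box_integrable M gap_rho_L1box); split.
  apply: eq_integrable i1 => // t _ /=; congr EFin; apply/esym/Rintegral_supp => y /Mr yr.
  by rewrite g_out ?mul0r.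
apply: ae_imply i2 => t Ht /Ht it; apply: (@integrable_supp _ _ M) => // y /Mr yr /=.
by rewrite g_out ?mul0r.
Qed.

Lemma slope_work_integrable :
  mu.-integrable `[0, M] (EFin \o slope_work) /\
  {ae mu, forall t, 0 <= t <= M -> mu.-integrable setT
    (EFin \o (fun y => v y * (y / 2 * rho (t, y) - n (t, y))))}.
Proof.
have [i1 i2 _] := fubini_box (L1box_box_integrable M slope_drift_L1box); split.
  apply: eq_integrable i1 => // t _ /=; congr EFin; apply/esym/Rintegral_supp => y /Mr yr.
  by rewrite v_out ?mul0r.
apply: ae_imply i2 => t Ht /Ht it; apply: (@integrable_supp _ _ M) => // y /Mr yr /=.
by rewrite v_out ?mul0r.
Qed.

(** [h'(rhoi) - h'(rhohat)] need not be of class C^1, but it is a limit of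
    factors of class C^1 to which the mass equation applies; the source being
    integrable provides the domination. *)
Lemma mass_profile (phi : R -> R) : test_function phi ->
  (forall t, M < `|t| -> phi t = 0) ->
  \int[mu]_(t in `[0, M]) ((derive1 phi t - phi t / 2) * gap_mass t - phi t * slope_work t) =
  - (phi 0 * \int[mu]_y (g y * rho0 y)).
Proof.
move=> tphi phiM.
have c1 := gapk_cvg plaw hpot rhohat_ge0 aE C1 rhoi_ge0 r0 rhoi_out Ww.
have [im em] : mu2.-integrable (box M) (EFin \o mass_form rho n phi g v) /\
    mass_identity rho0 rho n M phi g v.
  have der := der_gapk rhohat plaw hpot C1.
  have cd k := @dgapk_cont R p h rhoi plaw hpot C1 k.
  apply: (@mass_limit R alpha p rho0 n0 rho n rho0_loc sol phi M tphi (gapk h rhoi rhohat) (dgapk h rhoi) g v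
    (slope_mass h rhoi) (fun x => `|v x.2 * drift x|)).
  - move=> k; apply: continuous_measurable => y; exact: der_continuous (der k y).
  - by move=> k; exact: continuous_measurable.
  - exact: c1.
  - by move=> y; exact: dgapk_cvg plaw hpot rhoi_ge0 y.
  - exact: slope_mass_ge0.
  - by move=> k y; exact: gapk_le plaw hpot C1 rhoi_ge0 r0 rhoi_out Ww k y.
  - apply: integrable_norm => //; exact: (L1box_box_integrable M slope_drift_L1box).
  - apply: aeW => x _ k; rewrite normrM [leRHS]normrM; apply: ler_wpM2r => //.
    exact: dgapk_le plaw hpot rhoi_ge0 k _.
  - move=> k _; apply: (mass_C1 rho0_loc sol tphi phiM r0 rM (der k) (cd k)).
    by move=> y; exact: gapk_out.
have [_ _ e] := fubini_box im.
move: em; rewrite /mass_identity e => em.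
rewrite -[X in _ * X](_ : \int[mu]_(y in `[- M, M]) (g y * rho0 y) = _); last first.
  by apply/esym/Rintegral_supp => y /Mr yr; rewrite g_out ?mul0r.
rewrite -em /Rintegral; congr fine.
have [ig ag] := gap_mass_integrable; have [is_ as_] := slope_work_integrable.
have mI : measurable (`[0, M] : set R) by exact: measurable_itv.
have mJ : measurable (`[- M, M] : set R) by exact: measurable_itv.
have sphi := test_function_smooth tphi.
have [iF _ _] := fubini_box im.
have cphi : continuous phi by exact: smooth_cont.
have cdphi : continuous (derive1 phi) by apply: smooth_cont; exact: smooth_derive1.
have mphi : measurable_fun `[0, M] phi by exact: continuous_measurable.
have mdphi : measurable_fun `[0, M] (derive1 phi) by exact: continuous_measurable.
apply: ae_eq_integral => //.
- apply/measurable_EFinP; apply: measurable_funB; apply: measurable_funM => //.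
  + by apply: measurable_funB => //; exact: measurable_funM.
  + exact: int_measurable ig.
  + exact: int_measurable is_.
- by case/integrableP: iF.
- apply: ae_imply2 ag as_ => t A S /=; rewrite in_itv /= => t0M.
  have {}A := A t0M; have {}S := S t0M.
  have iA : mu.-integrable `[- M, M] (EFin \o (fun y => g y * rho (t, y))) by apply: integrableS A.
  have iS : mu.-integrable `[- M, M] (EFin \o (fun y => v y * (y / 2 * rho (t, y) - n (t, y)))).
    by apply: integrableS S.
  congr EFin; rewrite /gap_mass /slope_work.
  rewrite (@Rintegral_supp _ _ M); last by move=> y /Mr yr; rewrite g_out ?mul0r.
  rewrite (@Rintegral_supp _ (fun y => v y * _) M); last by move=> y /Mr yr; rewrite v_out ?mul0r.
  rewrite -!RintegralZl // -RintegralB //.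
  + by apply: intZ.
  + by apply: intZ.
Qed.

End fixed_horizon.

End mass_of_profile.

(** * The total relative entropy inequality *)

Section energy_shift.
Context {R : realType}.
Local Notation mu := (@lebesgue_measure R).

Lemma ge0_integral_shift (f f' : R -> \bar R) (k : R -> R) :
  measurable_fun (setT : set R) f -> measurable_fun (setT : set R) f' ->
  (forall y, (0 <= f y)%E) -> (\int[mu]_y f y < +oo)%E ->
  mu.-integrable setT (EFin \o k) ->
  {ae mu, forall y, f' y = (f y + (k y)%:E)%E} ->
  (\int[mu]_y f' y = (\int[mu]_y f y) + (\int[mu]_y k y)%:E)%E.
Proof.
move=> mf mf' f0 ffin ki ff'.
have fi : mu.-integrable setT f.
  apply/integrableP; split => //; rewrite (_ : (fun y => _) = f) //.
  by apply/funext => y; rewrite gee0_abs.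
rewrite -RintE // -integralD //; apply: ae_eq_integral => //.
- by apply: emeasurable_funD => //; case/integrableP: ki.
- by apply: ae_imply ff' => y ->.
Qed.

Variables (rhohat a : R) (p h rhoi w : R -> R) (r : R).
Hypothesis plaw : pressure_law p.
Hypothesis hpot : internal_potential p h.
Hypothesis rhohat_ge0 : 0 <= rhohat.
Hypothesis aE : dpotential h rhohat = a%:E.
Hypothesis C1 : is_Ck 1 rhoi.
Hypothesis rhoi_ge0 : forall y, 0 <= rhoi y.
Hypothesis r0 : 0 < r.
Hypothesis rhoi_out : forall y, r < `|y| -> rhoi y = rhohat.
Hypothesis Ww : weak_derivative (fun y => dpotential h (rhoi y)) w.
Local Notation g := (gap h rhoi a).

Definition profile_defect (y : R) : R := rel h rhohat a (rhoi y) - g y * rhoi y.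

Lemma profile_defect_integrable : mu.-integrable setT (EFin \o profile_defect).
Proof. by have [] := profile_moment plaw hpot rhohat_ge0 aE C1 rhoi_ge0 r0 rhoi_out Ww. Qed.

(** The kinetic energy does not see the reference density, and the relative
    potentials differ by an affine function of the density. *)
Lemma rel_entropy_shift t q m y : 0 <= q ->
  rel_entropy h t q m rhohat 0 =
  (rel_entropy h t q m (rhoi y) 0 + (profile_defect y + g y * q)%:E)%E.
Proof.
move=> q0; rewrite !rel_entropy0 (rel_potentialE q0 rhohat_ge0 aE).
rewrite (rel_potentialE q0 (rhoi_ge0 y) (dpotential_gap plaw hpot rhohat_ge0 aE C1 rhoi_ge0 r0 rhoi_out Ww y)).
by rewrite -addeA -EFinD; congr (_ + _%:E)%E; rewrite /profile_defect /rel; ring.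
Qed.

Variables (t : R) (q m : R -> R).
Hypothesis mq : measurable_fun (setT : set R) q.
Hypothesis mm : measurable_fun (setT : set R) m.
Hypothesis q0 : {ae mu, forall y, 0 <= q y}.
Hypothesis gqi : mu.-integrable setT (EFin \o (fun y => g y * q y)).

Let ki : mu.-integrable setT (EFin \o (fun y => profile_defect y + g y * q y)).
Proof. by apply: intD => //; exact: profile_defect_integrable. Qed.

Let kE : \int[mu]_y (profile_defect y + g y * q y) =
  (\int[mu]_y profile_defect y) + (\int[mu]_y (g y * q y)).
Proof. by rewrite RintegralD //; exact: profile_defect_integrable. Qed.

Let mrhoi : measurable_fun (setT : set R) rhoi.
Proof. by apply: continuous_measurable; exact: rhoi_cont. Qed.

Lemma energy_shift : (rel_energy h t q m rhoi (cst 0%R) < +oo)%E ->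
  rel_energy h t q m (cst rhohat) (cst 0) =
  (rel_energy h t q m rhoi (cst 0%R) +
   ((\int[mu]_y profile_defect y) + (\int[mu]_y (g y * q y)))%:E)%E.
Proof.
move=> fin; rewrite -kE; apply: ge0_integral_shift => //.
- exact: (measurable_rel_entropy_profile hpot t mq mm mrhoi).
- exact: (measurable_rel_entropy_profile hpot t mq mm (@measurable_cst _ _ _ _ _ rhohat)).
- by move=> y; exact: rel_entropy_ge0 plaw hpot.
- by apply: ae_imply q0 => y q0y; exact: rel_entropy_shift.
Qed.

Lemma energy_shift_back : (rel_energy h t q m (cst rhohat) (cst 0%R) < +oo)%E ->
  rel_energy h t q m rhoi (cst 0) =
  (rel_energy h t q m (cst rhohat) (cst 0%R) +
   (- ((\int[mu]_y profile_defect y) + (\int[mu]_y (g y * q y))))%:E)%E.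
Proof.
move=> fin; rewrite -kE -mulN1r -RintegralZl //; apply: ge0_integral_shift => //.
- exact: (measurable_rel_entropy_profile hpot t mq mm (@measurable_cst _ _ _ _ _ rhohat)).
- exact: (measurable_rel_entropy_profile hpot t mq mm mrhoi).
- by move=> y; exact: rel_entropy_ge0 plaw hpot.
- by apply: intZ.
- apply: ae_imply q0 => y q0y; rewrite (rel_entropy_shift t (m y) y q0y).
  by rewrite mulN1r EFinN addeK.
Qed.

End energy_shift.

Section total_inequality.
Context {R : realType}.
Local Notation mu := (@lebesgue_measure R).
Local Notation mu2 := (@lebesgue_measure R \x @lebesgue_measure R)%E.
Local Notation T2 := (measurableTypeR R * measurableTypeR R)%type.
Local Notation H := (half_plane R).
Variables (alpha rhohat a : R) (p h : R -> R) (rho0 n0 : R -> R) (rho n : R * R -> R).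
Hypothesis alpha_ge0 : 0 <= alpha.
Hypothesis plaw : pressure_law p.
Hypothesis hpot : internal_potential p h.
Hypothesis rhohat_ge0 : 0 <= rhohat.
Hypothesis aE : dpotential h rhohat = a%:E.
Hypothesis rho0_loc : locally_integrable setT rho0.
Hypothesis n0_loc : locally_integrable setT n0.
Hypothesis rho0_ge0 : {ae mu, forall y, 0 <= rho0 y}.
Hypothesis energy0_fin :
  (rel_energy h 0 rho0 n0 (cst rhohat) (cst 0%R) < +oo)%E.
Hypothesis sol : weak_solution alpha p rho0 n0 rho n.
Let sq x := sq_over (n x) (rho x).
Let Dp t := (alpha%:E * \int[mu]_y sq^\+ (t, y))%E.

Let mrho : measurable_fun (H : set T2) rho.
Proof. by case: sol => -[[L _] _ _ _] _ _ _; exact/measurable_EFinP. Qed.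

Let mn : measurable_fun (H : set T2) n.
Proof. by case: sol => -[_ [L _] _ _] _ _ _; exact/measurable_EFinP. Qed.

Let msq : measurable_fun (H : set T2) sq.
Proof. by case: sol => -[_ _ [L _] _] _ _ _. Qed.

Let rho_ge0 : {ae mu2, forall x, H x -> 0 <= rho x}.
Proof. by case: sol. Qed.

Lemma dissipationE :
  {ae mu, forall t, 0 <= t ->
     dissipation alpha (fun y => rho (t, y)) (fun y => n (t, y)) = Dp t}.
Proof.
have mp : measurable_fun (H : set T2) sq^\+%E by exact: measurable_funepos.
apply: ae_imply (ae_section rho_ge0) => t Ht t0; have {}Ht := Ht t0.
have mpt : measurable_fun (setT : set R) (fun y => sq^\+%E (t, y)) by exact: measurable_section.
rewrite /Dp -ge0_integralZl_EFin //; apply: ae_eq_integral => //.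
- by apply: emeasurable_funM => //; exact: measurable_section t0 msq.
- by apply: emeasurable_funM.
- apply: ae_imply Ht => y y0 _; congr (_ * _)%E.
  by rewrite funeposE; apply/esym/max_idPl; exact: sq_over_ge0.
Qed.

Let mDp : measurable_fun `[(0 : R), +oo[ Dp.
Proof.
by apply: measurable_funeM; apply: measurable_integral_section; exact: measurable_funepos.
Qed.

Let Dp_ge0 t : (0 <= Dp t)%E.
Proof. by rewrite mule_ge0 ?lee_fin // integral_ge0. Qed.

Variables (rhoi w : R -> R) (r : R).
Let E t := rel_energy h t (fun y => rho (t, y)) (fun y => n (t, y)) rhoi (cst 0%R).
Let Eh t := rel_energy h t (fun y => rho (t, y)) (fun y => n (t, y)) (cst rhohat) (cst 0%R).
Let source (x : R * R) := w x.2 * (x.2 / 2 * (rho x - rhoi x.2) - n x).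
Hypothesis C1 : is_Ck 1 rhoi.
Hypothesis r0 : 0 < r.
Hypothesis rhoi_out : forall y, r < `|y| -> rhoi y = rhohat.
Hypothesis Ww : weak_derivative (fun y => dpotential h (rhoi y)) w.
Hypothesis LE : L1loc `[0, +oo[ E.
Hypothesis Lsource : L1loc_half_plane (EFin \o source).
Hypothesis EI : forall phi : R -> R, test_function phi ->
          (forall t, 0 <= t -> 0 <= phi t) ->
          (\int[mu]_(t in `[0%R, +oo[)
             ((- derive1 phi t)%:E * E t
              + (phi t)%:E * (2^-1%:E * E t
                  + dissipation alpha (fun y => rho (t, y))
                                      (fun y => n (t, y))))
           <= (phi 0%R)%:E * rel_energy h 0 rho0 n0 rhoi (cst 0%R)
              + \int[mu]_(t in `[0%R, +oo[)
                  ((phi t)%:E * \int[mu]_y (source (t, y))%:E))%E.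

Let E_integrable M : mu.-integrable `[0, M] E.
Proof.
case: LE => mE EK; have sub : `[0, M] `<=` `[(0 : R), +oo[ by exact: subset_itvl.
apply/integrableP; split; first exact: measurable_funS mE.
by apply: EK => //; exact: segment_compact.
Qed.

Let E_fin M : {ae mu, forall t, 0 <= t <= M -> E t \is a fin_num}.
Proof.
have mI : measurable (`[0, M] : set R) by exact: measurable_itv.
have : {ae mu, forall t, `[0, M]%classic t -> E t \is a fin_num}.
  by apply: integrable_ae.
by apply: ae_imply => t; rewrite /= in_itv.
Qed.

Let ms t : 0 <= t -> measurable_fun (setT : set R) (fun y => rho (t, y)) /\
  measurable_fun (setT : set R) (fun y => n (t, y)).
Proof.
move=> t0; split; apply/measurable_EFinP.
  by apply: (@measurable_section _ (EFin \o rho)) => //; exact/measurable_EFinP.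
by apply: (@measurable_section _ (EFin \o n)) => //; exact/measurable_EFinP.
Qed.

Let rhoi_ge0 y : 0 <= rhoi y.
Proof.
have [N [mN N0 HN]] := E_fin 1.
have [t t01 Nt] : exists2 t, `[0, 1]%classic t & ~ N t.
  apply: contrapT => nex.
  have sub : `[(0 : R), 1] `<=` N.
    by move=> t t01; apply: contrapT => Nt; apply: nex; exists t.
  have : (mu (`[0%R, 1%R] : set R) <= mu N)%E by apply: le_measure; rewrite ?inE.
  by rewrite N0 lebesgue_measure_itv /= lte_fin ltr01 -EFinB lee_fin subr0 ler10.
have t0 : 0 <= t by move: t01; rewrite /= in_itv /= => /andP[].
have [mr mm] := ms t0.
apply: (profile_ge0 plaw hpot (rhoi_cont C1) mr mm (t := t)).
suff : E t \is a fin_num by rewrite fin_numElt => /andP[].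
by apply: contrapT => nE; apply: Nt; apply: HN => /= H1; apply: nE; apply: H1; move: t01; rewrite /= in_itv.
Qed.

Local Notation v := (slope h rhoi).
Local Notation g := (gap h rhoi a).
Let A0 := \int[mu]_y profile_defect rhohat a h rhoi y.
Let Gt := gap_mass a h rhoi rho.
Let St := slope_work h rhoi rho n.

Let E_shift M : r + 1 <= M ->
  {ae mu, forall t, 0 <= t <= M -> Eh t = (E t + (A0 + Gt t)%:E)%E}.
Proof.
move=> rM.
have [_ ig] := gap_mass_integrable plaw hpot rhohat_ge0 aE C1 rhoi_ge0 r0 rhoi_out Ww sol rM.
have h1 := ae_imply2 (fun x A B => conj A B) ig (E_fin M).
apply: ae_imply2 h1 (ae_section rho_ge0) => t [gi Ef] rp tM.
have t0 : 0 <= t by case/andP: tM.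
have [mr mm] := ms t0.
apply: (energy_shift plaw hpot rhohat_ge0 aE C1 rhoi_ge0 r0 rhoi_out Ww mr mm (rp t0) (gi tM)).
by have := Ef tM; rewrite fin_numElt => /andP[].
Qed.

Let source_sum M : r + 1 <= M ->
  {ae mu, forall t, 0 <= t <= M -> (\int[mu]_y (source (t, y))%:E = (St t - A0 / 2)%:E)%E}.
Proof.
move=> rM.
have [_ is_] := slope_work_integrable plaw hpot C1 rhoi_ge0 rhoi_out Ww sol Lsource rM.
have [i1 i2 e] := profile_moment plaw hpot rhohat_ge0 aE C1 rhoi_ge0 r0 rhoi_out Ww.
apply: ae_imply is_ => t iS tM; have {}iS := iS tM.
have i3 : mu.-integrable setT (EFin \o (fun y => 2^-1 * (y * rhoi y * v y))) by apply: intZ.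
have -> : St t - A0 / 2 = \int[mu]_y (v y * (y / 2 * rho (t, y) - n (t, y)) - 2^-1 * (y * rhoi y * v y)).
  rewrite RintegralB // RintegralZl // /St /A0 /profile_defect e.
  by congr (_ - _); rewrite mulrC.
rewrite -RintE //; last by apply: intB.
have t0 : 0 <= t by case/andP: tM.
apply: ae_eq_integral => //.
- by case: Lsource => ml _; exact: measurable_section t0 ml.
- have i4 : mu.-integrable setT (EFin \o (fun y => v y * (y / 2 * rho (t, y) - n (t, y)) - 2^-1 * (y * rhoi y * v y))) by apply: intB.
  by case/integrableP: i4.
- apply: ae_imply (weak_slopeE plaw hpot C1 rhoi_ge0 Ww) => y wv _.
  by congr EFin; rewrite /source /= wv; ring.
Qed.

Let E0_shift : rel_energy h 0 rho0 n0 rhoi (cst 0) =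
  ((\int[mu]_y rel_entropy_init h rhohat rho0 n0 y) - (A0 + \int[mu]_y (g y * rho0 y)))%:E.
Proof.
have m0 : measurable_fun (setT : set R) rho0 by case: rho0_loc.
have m1 : measurable_fun (setT : set R) n0 by case: n0_loc.
have mg := measurable_gap plaw hpot rhohat_ge0 aE C1 rhoi_ge0 r0 rhoi_out Ww.
have L0 := locally_integrable_L1seg rho0_loc.
have gi : mu.-integrable setT (EFin \o (fun y => g y * rho0 y)).
  apply: (@integrable_supp _ _ r) => [y yr /=|]; first by rewrite (gap_out aE rhoi_out) ?mul0r.
  have mI : measurable (`[- r, r] : set R) by exact: measurable_itv.
  apply: (@int_dom _ _ _ mu _ mI _ (fun y => slope_mass h rhoi * rho0 y)).
  - by apply: measurable_funM; apply: measurable_funTS; [exact: mg|exact: m0].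
  - move=> y _; rewrite normrM [leRHS]normrM ler_wpM2r // (ger0_norm (slope_mass_ge0 h rhoi)).
    exact: gap_le plaw hpot rhohat_ge0 aE C1 rhoi_ge0 r0 rhoi_out Ww _.
  - by apply: intZ => //; exact: L0.
rewrite (energy_shift_back plaw hpot rhohat_ge0 aE C1 rhoi_ge0 r0 rhoi_out Ww m0 m1 rho0_ge0 gi energy0_fin).
by rewrite (rel_energy_initE plaw hpot rhohat_ge0 aE rho0_loc n0_loc energy0_fin).
Qed.

(** The weight [exp(t/2)] absorbs the term [1/2 E] of the inequality. Changing
    the reference density from [rhoi] to [rhohat] adds terms that balance by the
    mass equation tested with [phi(t) gap(y)] and by [profile_moment]. *)
Lemma total_energy_inequality (psi : R -> R) : test_function psi ->
  (forall t, 0 <= t -> 0 <= psi t) -> (forall t, 0 <= t -> derive1 psi t <= 0) ->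
  (\int[mu]_(t in `[0%R, +oo[) ((expR (t / 2))%:E *
     ((- derive1 psi t)%:E * Eh t + (psi t)%:E * Dp t)) <=
   (psi 0%R * \int[mu]_y rel_entropy_init h rhohat rho0 n0 y)%:E)%E.
Proof.
move=> tpsi psi0 dpsi0; have [T T0 psiT] := test_function_supp tpsi.
have spsi := test_function_smooth tpsi.
have r0' := r0.
pose M := T + r + 1.
have rM : r + 1 <= M by rewrite /M; lra.
have M0 : 0 < M by rewrite /M; lra.
have TM : T < M by rewrite /M; lra.
pose phi t := expR (t / 2) * psi t.
have sphi : smooth phi by apply: smoothM => //; exact: smooth_exp_half.
have dphi (t : R) : is_derive t 1 phi (expR (t / 2) * (derive1 psi t + psi t / 2)).
  have d1 := @der_comp _ (@expR R) (fun t => t * 2^-1) _ _ _ (is_derive_expR _) (der_mul (der_id t) (der_cst 2^-1 t)).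
  apply: is_derive_eq (der_mul d1 (derivable_der (smooth_derivable (x := t) spsi))) _.
  by ring.
have phiT t : T < `|t| -> phi t = 0 by move=> /psiT; rewrite /phi => ->; rewrite mulr0.
have phiM t : M < `|t| -> phi t = 0 by move=> Mt; apply: phiT; exact: lt_trans TM Mt.
have tphi : test_function phi by exact: (@test_function1 _ _ T).
have phi_ge0 t : 0 <= t -> 0 <= phi t by move=> /psi0; apply: mulr_ge0; exact: expR_ge0.
have phi0 : phi 0 = psi 0 by rewrite /phi mul0r expR0 mul1r.
have dphiE t : derive1 phi t = expR (t / 2) * (derive1 psi t + psi t / 2) by exact: der_derive1 (dphi t).
have mI : measurable (`[0, M] : set R) by exact: measurable_itv.
have sub : `[0, M] `<=` `[(0 : R), +oo[ by exact: subset_itvl.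
have outI t : `[(0 : R), +oo[%classic t -> ~ `[0, M]%classic t -> T < `|t|.
  rewrite /= !in_itv /= andbT => -> /= /negP; rewrite -ltNge => Mt.
  by apply: lt_le_trans (ler_norm t); exact: lt_trans Mt.
have dpsiT t : T < `|t| -> derive1 psi t = 0 by exact: derive1_out.
have dphiT t : T < `|t| -> derive1 phi t = 0 by exact: derive1_out.
have cphi : continuous phi by exact: smooth_cont.
have cdphi : continuous (derive1 phi) by apply: smooth_cont; exact: smooth_derive1.
have mphi : measurable_fun `[0, M] phi by exact: continuous_measurable.
have mdphi : measurable_fun `[0, M] (derive1 phi) by exact: continuous_measurable.
have mpsi : measurable_fun `[0, M] psi by apply: continuous_measurable; exact: smooth_cont.
have mdpsi : measurable_fun `[0, M] (derive1 psi).
  by apply: continuous_measurable; apply: smooth_cont; exact: smooth_derive1.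
have mexp : measurable_fun `[0, M] (fun t : R => expR (t / 2)).
  by apply: continuous_measurable; apply: smooth_cont; exact: smooth_exp_half.
have mE : measurable_fun (`[0, M] : set R) E by case/integrableP: (E_integrable M).
have mEh : measurable_fun (`[0, M] : set R) Eh.
  have m1 := measurable_integral_section (measurable_rel_entropy_at hpot rhohat_ge0 aE mrho msq).
  exact: measurable_funS m1.
have mD : measurable_fun (`[0, M] : set R) Dp by exact: measurable_funS mDp.
have [igt _] := gap_mass_integrable plaw hpot rhohat_ge0 aE C1 rhoi_ge0 r0 rhoi_out Ww sol rM.
have [ist _] := slope_work_integrable plaw hpot C1 rhoi_ge0 rhoi_out Ww sol Lsource rM.
pose Q t := ((expR (t / 2))%:E * ((- derive1 psi t)%:E * E t + (psi t)%:E * Dp t))%E.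
pose u t := - derive1 psi t * expR (t / 2) * (A0 + Gt t).
have mQ : measurable_fun (`[0, M] : set R) Q.
  apply: emeasurable_funM; first exact/measurable_EFinP.
  apply: emeasurable_funD; apply: emeasurable_funM => //; apply/measurable_EFinP => //.
  exact: measurableT_comp.
have E_ge0 t : (0 <= E t)%E.
  by apply: integral_ge0 => y _; exact: rel_entropy_ge0 plaw hpot.
have Q_ge0 t : 0 <= t -> (0 <= Q t)%E.
  move=> t0; apply: mule_ge0; first by rewrite lee_fin expR_ge0.
  apply: adde_ge0; apply: mule_ge0 => //; rewrite lee_fin ?psi0 //.
  by rewrite oppr_ge0 dpsi0.
have seg t : `[0, M]%classic t -> 0 <= t <= M by rewrite /= in_itv.
have cu : continuous (fun t => - derive1 psi t * expR (t / 2)).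
  move=> t; apply: cvgM; last exact: (smooth_cont smooth_exp_half).
  by apply: cvgN; apply: (smooth_cont (smooth_derive1 spsi)).
have bnd (c f : R -> R) : continuous c -> mu.-integrable `[0, M] (EFin \o f) ->
    mu.-integrable `[0, M] (EFin \o (fun t => c t * f t)).
  move=> cc fi; have cw : {within `[0, M], continuous c} by exact: continuous_subspaceT.
  have [B B0 HB] := bounded_on_segment (ltW M0) cw.
  apply: (@int_dom _ _ _ mu _ mI _ (fun t => B * f t)); last by apply: intZ.
    by apply: measurable_funM; [exact: continuous_measurable|exact: int_measurable fi].
  by move=> t /seg tM; rewrite normrM [leRHS]normrM ler_wpM2r // (ger0_norm B0) HB.
have icst (k : R) : mu.-integrable `[0, M] (EFin \o (fun _ : R => k)).
  by apply: continuous_integrable_itv; exact: cst_continuous.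
have iu : mu.-integrable `[0, M] (EFin \o u).
  by apply: (bnd _ (fun t => A0 + Gt t)) => //; apply: intD.
have QE : {ae mu, forall t, 0 <= t <= M ->
    ((- derive1 phi t)%:E * E t + (phi t)%:E * (2^-1%:E * E t
       + dissipation alpha (fun y => rho (t, y)) (fun y => n (t, y))) = Q t)%E}.
  apply: ae_imply2 (E_fin M) dissipationE => t Ef De tM.
  have t0 : 0 <= t by case/andP: tM.
  rewrite (De t0) /Q dphiE /phi -(fineK (Ef tM)).
  move: (Dp_ge0 t); case: (Dp t) => [d| |] //= _.
    by rewrite -!(EFinM, EFinD); congr EFin; ring.
  have := psi0 t t0; rewrite le_eqVlt => /predU1P[<-|pt].
    by rewrite mulr0 !mul0e !adde0 -!EFinM; congr EFin; ring.
  have et : 0 < expR (t / 2) by exact: expR_gt0.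
  have pe : 0 < expR (t / 2) * psi t by exact: mulr_gt0.
  rewrite -!EFinM addey // [in RHS]gt0_muley ?lte_fin // addey //.
  by rewrite !gt0_muley ?lte_fin // addey.
have hyp := EI tphi phi_ge0.
have lhsE : (\int[mu]_(t in `[0%R, +oo[)
    ((- derive1 phi t)%:E * E t + (phi t)%:E * (2^-1%:E * E t
       + dissipation alpha (fun y => rho (t, y)) (fun y => n (t, y)))) =
    \int[mu]_(t in `[0%R, M]) Q t)%E.
  rewrite (@integral_restrict_itv _ _ `[0, M]) //; last first.
    by move=> t th tM; rewrite dphiT ?phiT ?oppr0 ?mul0e ?adde0 //; exact: outI.
  have mdis : measurable_fun (`[0, M] : set R)
      (fun t => dissipation alpha (fun y => rho (t, y)) (fun y => n (t, y))).
    have m1 : measurable_fun (H : set T2) (fun x => (alpha%:E * sq x)%E) by exact: measurable_funeM.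
    by apply: measurable_funS (measurable_integral_section m1).
  apply: ae_eq_integral => //.
  apply: emeasurable_funD.
    by apply: emeasurable_funM => //; apply/measurable_EFinP; exact: measurableT_comp.
  apply: emeasurable_funM; first exact/measurable_EFinP.
  by apply: emeasurable_funD => //; exact: measurable_funeM.
pose k0 := A0 + \int[mu]_y (g y * rho0 y).
pose X := \int[mu]_(t in `[0, M]) (phi t * (St t - A0 / 2)).
pose U := \int[mu]_(t in `[0, M]) u t.
have iX : mu.-integrable `[0, M] (EFin \o (fun t => phi t * (St t - A0 / 2))).
  by apply: (bnd _ (fun t => St t - A0 / 2)) => //; apply: intB.
have srcE : (\int[mu]_(t in `[0%R, +oo[) ((phi t)%:E * \int[mu]_y (source (t, y))%:E) = X%:E)%E.
  rewrite (@integral_restrict_itv _ _ `[0, M]) //; last first.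
    by move=> t th tM; rewrite phiT ?mul0e //; exact: outI.
  have [ml _] := Lsource.
  rewrite -RintE //; apply: ae_eq_integral => //.
  - apply: emeasurable_funM; first exact/measurable_EFinP.
    by apply: measurable_funS (measurable_integral_section ml).
  - by case/integrableP: iX.
  - apply: ae_imply (source_sum rM) => t Ht /seg tM.
    by rewrite (Ht tM) -EFinM.
(* The contribution of the change of reference density reduces to its initial
   value. *)
have XU : X + U = psi 0 * k0.
  have mp := mass_profile plaw hpot rhohat_ge0 aE C1 rhoi_ge0 r0 rhoi_out Ww rho0_loc sol Lsource rM tphi phiM.
  have idphi : mu.-integrable `[0, M] (EFin \o derive1 phi) by exact: continuous_integrable_itv.
  have iG : mu.-integrable `[0, M] (EFin \o (fun t => (derive1 phi t - phi t / 2) * Gt t)).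
    apply: bnd => // t; apply: cvgB; first exact: cdphi.
    by apply: cvgM; [exact: cphi|exact: cvg_cst].
  have iS : mu.-integrable `[0, M] (EFin \o (fun t => phi t * St t)) by exact: bnd.
  have iGS : mu.-integrable `[0, M] (EFin \o (fun t => (derive1 phi t - phi t / 2) * Gt t - phi t * St t)).
    by apply: intB.
  have ftc : \int[mu]_(t in `[0, M]) derive1 phi t = - phi 0.
    rewrite /Rintegral (ftc_itv (f := phi) M0 _ cdphi) /=.
      by rewrite (phiT M) ?sub0r // gtr0_norm.
    by move=> x; rewrite dphiE.
  transitivity (\int[mu]_(t in `[0, M]) (-1 * ((derive1 phi t - phi t / 2) * Gt t - phi t * St t)
      + - A0 * derive1 phi t)).
    rewrite -RintegralD //; apply: eq_Rintegral => t _.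
    by rewrite /u dphiE /phi; ring.
  rewrite RintegralD //; last 2 first.
  - by apply: intZ.
  - by apply: intZ.
  rewrite !RintegralZl // ftc mp phi0 /k0; ring.
have hQ : (\int[mu]_(t in `[0%R, M]) Q t <=
    (psi 0%R * ((\int[mu]_y rel_entropy_init h rhohat rho0 n0 y) - k0) + X)%:E)%E.
  by move: hyp; rewrite lhsE srcE E0_shift phi0 -EFinM -EFinD.
have iQ : mu.-integrable `[0, M] Q.
  apply/integrableP; split => //.
  have -> : (\int[mu]_(t in `[0%R, M]) `|Q t| = \int[mu]_(t in `[0%R, M]) Q t)%E.
    by apply: eq_integral => t; rewrite inE => /seg/andP[t0 _]; rewrite gee0_abs // Q_ge0.
  exact: le_lt_trans hQ (ltry _).
rewrite (@integral_restrict_itv _ _ `[0, M]) //; last first.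
  by move=> t th tM; rewrite dpsiT ?psiT ?oppr0 ?mul0e ?adde0 ?mule0 //; exact: outI.
have goalE : (\int[mu]_(t in `[0%R, M]) ((expR (t / 2))%:E *
     ((- derive1 psi t)%:E * Eh t + (psi t)%:E * Dp t)) =
    \int[mu]_(t in `[0%R, M]) (Q t + (u t)%:E))%E.
  apply: ae_eq_integral => //.
  - apply: emeasurable_funM; first exact/measurable_EFinP.
    apply: emeasurable_funD; apply: emeasurable_funM => //; apply/measurable_EFinP => //.
    exact: measurableT_comp.
  - by apply: emeasurable_funD => //; case/integrableP: iu.
  - apply: ae_imply2 (E_fin M) (E_shift rM) => t Ef Es /seg tM.
    have t0 : 0 <= t by case/andP: tM.
    rewrite (Es tM) /Q -(fineK (Ef tM)).
    move: (Dp_ge0 t); case: (Dp t) => [d| |] //= _.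
      by rewrite /u -!(EFinM, EFinD); congr EFin; ring.
    have := psi0 t t0; rewrite le_eqVlt => /predU1P[<-|pt].
      by rewrite !mul0e !adde0 -!(EFinM, EFinD); congr EFin; rewrite /u; ring.
    have et : 0 < expR (t / 2) by exact: expR_gt0.
    by rewrite -!(EFinM, EFinD) [((psi t)%:E * +oo)%E]gt0_muley ?lte_fin // !addey // gt0_muley ?lte_fin.
rewrite goalE integralD //; last first.
apply: le_trans (leeD hQ (lexx _)) _.
rewrite RintE // -/U -EFinD lee_fin -addrA.
by rewrite XU -mulrDr subrK.
Qed.

End total_inequality.

(** * Decay of the relative entropy *)

Theorem theorem2p4 (R : realType) (alpha rhohat : R) (p h : R -> R)
    (rho0 n0 : R -> R) (rho n : R * R -> R)
    (alpha_ge0 : 0 <= alpha)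
    (p_law : pressure_law p)
    (h_pot : internal_potential p h)
    (rhohat_case : 0 < rhohat \/ (rhohat = 0 /\ vacuum_condition p))
    (rho0_loc : locally_integrable setT rho0)
    (n0_loc : locally_integrable setT n0)
    (rho0_ge0 : {ae lebR R, forall y, 0 <= rho0 y})
    (energy0_fin : (rel_energy h 0 rho0 n0 (cst rhohat) (cst 0%R) < +oo)%E)
    (sol : weak_solution alpha p rho0 n0 rho n)
    (entropy_cond :
       local_entropy_inequality alpha h rho0 n0 rho n \/
       total_rel_entropy_inequality alpha h rhohat rhohat rho0 n0 rho n) :
  {ae lebR R, forall t, 0 < t ->
     (rel_energy h t (fun y => rho (t, y)) (fun y => n (t, y))
        (cst rhohat) (cst 0%R)
      <= (expR (- (t / 2)))%:E
         * rel_energy h 0 rho0 n0 (cst rhohat) (cst 0%R))%E} /\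
  {ae lebR R, forall t, 0 < t ->
     (alpha%:E * \int[lebR R]_(s in `]t, +oo[)
        \int[lebR R]_y sq_over `|n (s, y)| (rho (s, y))
      <= (expR (- (t / 2)))%:E
         * rel_energy h 0 rho0 n0 (cst rhohat) (cst 0%R))%E}.
Proof.
have [a aE [hat0 relpos fluxC]] := reference_slope p_law h_pot rhohat_case.
have [[Lrho Ln Lsq _] rho_ge0 _ _] := sol.
have mrho : measurable_fun (half_plane R : set (measurableTypeR R * measurableTypeR R)%type) rho.
  by apply/measurable_EFinP; case: Lrho.
have msq := (L1loc_L1box Lsq).1.
rewrite (rel_energy_initE p_law h_pot hat0 aE rho0_loc n0_loc energy0_fin).
apply: (decay_conclusion alpha_ge0 p_law h_pot hat0 aE mrho msq rho_ge0).
case: entropy_cond => [LEI|].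
  exact: local_energy_inequality alpha_ge0 p_law h_pot hat0 aE relpos fluxC rho0_loc n0_loc energy0_fin sol LEI.
move=> [rhoi [w [C1 [r r0 rhoi_ends] Ww [LE Lsource] EI]]].
have rhoi_out y : r < `|y| -> rhoi y = rhohat.
  have [h1 h2] := rhoi_ends y; rewrite ltr_normr => /orP[|]; first exact: h1.
  by rewrite ltrNr; exact: h2.
apply: (total_energy_inequality alpha_ge0 p_law h_pot hat0 aE rho0_loc n0_loc rho0_ge0 energy0_fin
  sol C1 r0 rhoi_out Ww LE Lsource EI).
Qed.
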